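(* Let $\mathbb X$ be a weighted projective line of type $(p_1,\dots,p_t)$, $t\ge3$, and let $E$ be an indecomposable vector bundle over $\mathbb X$ such that there is a short exact sequence $$0\longrightarrow L(\vec\omega)\longrightarrow E\longrightarrow L(\vec x)\longrightarrow 0,$$ where $L$ is a line bundle and $\vec x=\sum_{i=1}^t l_i\vec x_i$ with $0\le l_i\le p_i-1$ and $0\le\vec x\le\vec\delta$. Let $I=\{i\mid l_i\ne p_i-1\}$. Then the projective cover and the injective hull of $E$ are $$\mathfrak P(E)=L(\vec\omega)\oplus\bigoplus_{j\in I}L(\vec x-(1+l_j)\vec x_j),\qquad \mathfrak I(E)=L(\vec x)\oplus\bigoplus_{j\in I}L((1+l_j)\vec x_j+\vec\omega).$$ Further, the line bundle summands of $\mathfrak P(E)$ (resp. of $\mathfrak I(E)$) are mutually $\mathrm{Hom}_{\mathbb X}$-orthogonal, i.e. there are no nonzero morphisms between two different summands among $L(\vec\omega)$ and $L(\vec x-(1+l_j)\vec x_j)$, $j\in I$ (resp. among $L(\vec x)$ and $L((1+l_j)\vec x_j+\vec\omega)$, $j\in I$).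
   Context: $k$ is an algebraically closed field. Given integers $p_i\ge2$ ($1\le i\le t$) and pairwise distinct nonzero parameters $\lambda_3=1,\lambda_4,\dots,\lambda_t\in k$: $\mathbb L$ is the abelian group generated by $\vec x_1,\dots,\vec x_t$ with relations $p_1\vec x_1=\dots=p_t\vec x_t=:\vec c$, ordered by $\vec y\le\vec z\iff\vec z-\vec y\in\mathbb L_+:=\sum_{i}\mathbb N\vec x_i$. The algebra $S=k[x_1,\dots,x_t]/(x_i^{p_i}-x_1^{p_1}-\lambda_ix_2^{p_2}\mid i=3,\dots,t)$ is $\mathbb L$-graded with $\deg x_i=\vec x_i$, and the weighted projective line $\mathbb X$ is the $\mathbb L$-graded projective spectrum of $S$. $\mathrm{coh}(\mathbb X)$ denotes its category of coherent sheaves, with shifts $F\mapsto F(\vec x)$, and $\mathrm{vect}(\mathbb X)$ the subcategory of vector bundles; line bundles are the $\mathcal O(\vec x)$, $\vec x\in\mathbb L$, with $\mathrm{Hom}_{\mathbb X}(\mathcal O(\vec x),\mathcal O(\vec y))\cong S_{\vec y-\vec x}$. Put $\vec\omega=(t-2)\vec c-\sum_{i=1}^t\vec x_i$ and $\vec\delta=2\vec\omega+\vec c$. A short exact sequence in $\mathrm{vect}(\mathbb X)$ is called distinguished if it stays exact under $\mathrm{Hom}_{\mathbb X}(L',-)$ for all line bundles $L'$. With this exact structure $\mathrm{vect}(\mathbb X)$ is a Frobenius category whose indecomposable projective-injective objects are exactly the line bundles, and every vector bundle $E$ has a projective cover $\mathfrak P(E)\to E$ and an injective hull $E\to\mathfrak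 I(E)$, both being finite direct sums of line bundles (i.e. every morphism from a line bundle to $E$, resp. from $E$ to a line bundle, factors through the cover, resp. the hull, which are minimal with this property). *)

(* Defs.v *)
From HB Require Import structures.
From mathcomp Require Import all_boot all_order all_algebra.
From mathcomp Require Import boolp mpoly.

Set Implicit Arguments.
Unset Strict Implicit.
Unset Printing Implicit Defensive.

Import GRing.Theory.
Local Open Scope ring_scope.
Local Open Scope quotient_scope.

(* Indices are shifted by one: x_1, ..., x_t are indexed by 0, ..., t-1.  Only
   the values of [lam] at indices >= 2 (lambda_3, ..., lambda_t) are used. *)
Record wpl (k : closedFieldType) (t : nat) := Wpl {
  wt : 'I_t -> nat;
  lam : 'I_t -> k;
  t_ge3 : (3 <= t)%N;
  wt_ge2 : forall i, (2 <= wt i)%N;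
  lam_3 : forall i : 'I_t, i = 2%N :> nat -> lam i = 1;
  lam_neq0 : forall i : 'I_t, (2 <= i)%N -> lam i != 0;
  lam_inj : forall i j : 'I_t, (2 <= i)%N -> (2 <= j)%N ->
    lam i = lam j -> i = j }.

Section WeightedProjectiveLine.
Variables (k : closedFieldType) (t : nat) (X : wpl k t).

Definition idx1 : 'I_t := Ordinal (ltnW (ltnW (t_ge3 X))).
Definition idx2 : 'I_t := Ordinal (ltnW (t_ge3 X)).

Definition free_gen (i : 'I_t) : {ffun 'I_t -> int} :=
  [ffun j => (j == i)%:R].

Definition relL : {pred {ffun 'I_t -> int}} := fun v =>
  `[< exists n : 'I_t -> int,
      v = \sum_i (free_gen i *+ wt X i - free_gen idx1 *+ wt X idx1) *~ n i >].

Lemma relL_zmod : zmod_closed relL.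
Proof.
split; first by apply/asboolP; exists (fun=> 0); rewrite big1.
move=> u v /asboolP[m ->] /asboolP[n ->]; apply/asboolP.
exists (fun i => m i - n i); rewrite -sumrB.
by apply: eq_bigr => i _; rewrite mulrzBr.
Qed.
HB.instance Definition _ :=
  GRing.isZmodClosed.Build {ffun 'I_t -> int} relL relL_zmod.

Definition L : zmodType := Quotient.quot relL.
Definition piL (v : {ffun 'I_t -> int}) : L := \pi_(Quotient.quot relL) v.

Definition xL (i : 'I_t) : L := piL (free_gen i).
Definition cL : L := xL idx1 *+ wt X idx1.
Definition omegaL : L := cL *+ (t - 2) - \sum_i xL i.
Definition deltaL : L := omegaL *+ 2 + cL.

Definition leL (y z : L) : Prop :=
  exists n : 'I_t -> nat, z - y = \sum_i xL i *+ n i.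

Definition rel_poly (i : 'I_t) : {mpoly k[t]} :=
  'X_i ^+ wt X i - 'X_idx1 ^+ wt X idx1 - lam X i *: 'X_idx2 ^+ wt X idx2.

Definition relS : {pred {mpoly k[t]}} := fun f =>
  `[< exists q : 'I_t -> {mpoly k[t]},
      f = \sum_(i < t | (2 <= i)%N) q i * rel_poly i >].

Lemma relS_idealr : idealr_closed relS.
Proof.
split.
- by apply/asboolP; exists (fun=> 0); rewrite big1 // => i _; rewrite mul0r.
- apply/asboolP => -[q /(congr1 (meval (fun=> 0)))].
  rewrite meval1 rmorph_sum big1 /= => [|i _]; first by move/eqP; rewrite oner_eq0.
  have w0 j : (wt X j == 0)%N = false by case: (wt X j) (wt_ge2 X j).
  by rewrite mevalM /rel_poly !mevalB mevalZ !rmorphXn /= !mevalXU !expr0n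
    !w0 mulr0 !subr0 mulr0.
- move=> a u v /asboolP[p ->] /asboolP[q ->]; apply/asboolP.
  exists (fun i => a * p i + q i); rewrite mulr_sumr -big_split /=.
  by apply: eq_bigr => i _; rewrite mulrDl mulrA.
Qed.
HB.instance Definition _ := isIdealr.Build {mpoly k[t]} relS relS_idealr.

Definition S : comNzRingType := {ideal_quot relS}.
Definition piS (f : {mpoly k[t]}) : S := \pi_({ideal_quot relS}) f.

Definition wdeg (m : 'X_{1..t}) : L := \sum_i xL i *+ m i.

Definition homogeneous (d : L) (s : S) : Prop :=
  exists f : {mpoly k[t]}, (forall m, m \in msupp f -> wdeg m = d) /\
    s = piS f.

Lemma homog0 d : homogeneous d 0.
Proof. by exists 0; split=> [m|]; rewrite ?msupp0 // /piS raddf0. Qed.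

Lemma homogN d s : homogeneous d s -> homogeneous d (- s).
Proof.
case=> f [hf ->]; exists (- f); split; last by rewrite /piS raddfN.
by move=> m; rewrite (perm_mem (msuppN f)); apply: hf.
Qed.

Lemma homogD d s s' : homogeneous d s -> homogeneous d s' -> homogeneous d (s + s').
Proof.
case=> f [hf ->] [g [hg ->]]; exists (f + g); split; last by rewrite /piS raddfD.
by move=> m /msuppD_le; rewrite mem_cat => /orP[/hf|/hg].
Qed.

Lemma homogM d e s s' : homogeneous d s -> homogeneous e s' -> homogeneous (d + e) (s * s').
Proof.
case=> f [hf ->] [g [hg ->]]; exists (f * g); split; last by rewrite /piS rmorphM.
move=> m /msuppM_le /allpairsP[[m1 m2] /= [/hf <- /hg <- ->]].
by rewrite /wdeg -big_split /=; apply: eq_bigr => i _; rewrite mnmDE mulrnDr.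
Qed.

Lemma homog1 : homogeneous 0 1.
Proof.
exists 1; split; last by rewrite /piS rmorph1.
move=> m; rewrite msupp1 inE => /eqP ->.
by rewrite /wdeg big1 // => i _; rewrite mnm0E.
Qed.

Lemma homogX d s n : homogeneous d s -> homogeneous (d *+ n) (s ^+ n).
Proof.
move=> hs; elim: n => [|n IHn]; first exact: homog1.
by rewrite exprS mulrS; apply: homogM.
Qed.

(* [gact a b s m] is the product of s and m; it is meaningful only when s is
   homogeneous of degree b - a. *)
Record gmod := Gmod {
  gsort :> L -> zmodType;
  gact : forall a b : L, S -> gsort a -> gsort b;
  gactDr : forall a b s (m m' : gsort a), homogeneous (b - a) s ->
    gact b s (m + m') = gact b s m + gact b s m';
  gactDl : forall a b s s' (m : gsort a), homogeneous (b - a) s ->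
    homogeneous (b - a) s' -> gact b (s + s') m = gact b s m + gact b s' m;
  gact1 : forall a (m : gsort a), gact a 1 m = m;
  gactA : forall a b c s s' (m : gsort a), homogeneous (b - a) s ->
    homogeneous (c - b) s' -> gact c s' (gact b s m) = gact c (s' * s) m }.

Record ghom (M N : gmod) := Ghom {
  gfun :> forall a, M a -> N a;
  gfunD : forall a (m m' : M a), gfun (m + m') = gfun m + gfun m';
  gfun_act : forall a b s (m : M a), homogeneous (b - a) s ->
    gfun (gact b s m) = gact b s (gfun m) }.

Definition gdsum (J : finType) (A : J -> gmod) (M : gmod)
    (iota : forall j, ghom (A j) M) : Prop :=
  forall b (m : M b), exists! c : (forall j, A j b), m = \sum_j iota j b (c j).

Lemma gmod_shift_sub (x b c : L) : (x + c) - (x + b) = c - b.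
Proof. by rewrite opprD addrACA subrr add0r. Qed.

Lemma gmod_shift_homog x b c s : homogeneous (c - b) s -> homogeneous (x + c - (x + b)) s.
Proof. by rewrite gmod_shift_sub. Qed.

Definition gshift (M : gmod) (x : L) : gmod :=
  @Gmod (fun b => M (x + b)) (fun b c => @gact M (x + b) (x + c))
    (fun b c s m m' h => gactDr m m' (gmod_shift_homog x h))
    (fun b c s s' m h h' =>
       gactDl m (gmod_shift_homog x h) (gmod_shift_homog x h'))
    (fun b m => gact1 m)
    (fun b c e s s' m h h' =>
       gactA m (gmod_shift_homog x h) (gmod_shift_homog x h')).

(* An index for the standard open set D(f), f homogeneous of positive degree.
   These sets form a base, stable under intersection, of the topology of the
   L-graded projective spectrum of S. *)
Record sopen := Sopen {
  sof :> S;
  sodeg : L;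
  so_homog : homogeneous sodeg sof;
  so_pos : leL 0 sodeg /\ sodeg <> 0 }.

(* D(g) is contained in D(f): some power of g is a multiple of f. *)
Definition sub_open (g f : sopen) : Prop :=
  exists (n : nat) (s : S),
    homogeneous (sodeg g *+ n - sodeg f) s /\ (g : S) ^+ n = (f : S) * s.

(* A quasi-coherent sheaf of L-graded modules, given on the base of standard
   open sets.  [sec f] is the graded module of sections over D(f); f acts
   bijectively on it, so that it is a module over the localization S_f.  For
   D(g) contained in D(f), the restriction [res f g] identifies [sec g] with
   the localization of [sec f] at g; this entails the sheaf condition. *)
Record qcoh := Qcoh {
  sec :> sopen -> gmod;
  res : forall (f g : sopen) (a : L), sec f a -> sec g a;
  resD : forall f g a (m m' : sec f a), sub_open g f ->
    res g (m + m') = res g m + res g m';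
  res_act : forall f g a b s (m : sec f a), sub_open g f -> homogeneous (b - a) s ->
    res g (gact b s m) = gact b s (res g m);
  res_id : forall f a (m : sec f a), res f m = m;
  res_comp : forall f g h a (m : sec f a), sub_open g f -> sub_open h g ->
    res h (res g m) = res h m;
  so_act_inj : forall f a (m m' : sec f a),
    gact (a + sodeg f) (f : S) m = gact (a + sodeg f) (f : S) m' -> m = m';
  so_act_surj : forall f a (m : sec f (a + sodeg f)),
    exists m' : sec f a, gact (a + sodeg f) (f : S) m' = m;
  loc_inj : forall f g a (m : sec f a), sub_open g f -> res g m = 0 ->
    exists n, gact (a + sodeg g *+ n) ((g : S) ^+ n) m = 0;
  loc_surj : forall f g a (m : sec g a), sub_open g f ->
    exists (n : nat) (m' : sec f (a + sodeg g *+ n)),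
      res g m' = gact (a + sodeg g *+ n) ((g : S) ^+ n) m }.

Record qhom (F G : qcoh) := Qhom {
  hfun :> forall f, ghom (F f) (G f);
  hfun_res : forall f g a (m : F f a), sub_open g f ->
    hfun g a (res g m) = res g (hfun f a m) }.

Definition hom_zero (F G : qcoh) (u : qhom F G) : Prop :=
  forall f a (m : F f a), u f a m = 0.

Definition comp_eq (F G H : qcoh) (v : qhom G H) (u : qhom F G) (w : qhom F H) :
    Prop :=
  forall f a (m : F f a), v f a (u f a m) = w f a m.

Definition inverse_homs (F G : qcoh) (u : qhom F G) (v : qhom G F) : Prop :=
  (forall f a (m : F f a), v f a (u f a m) = m) /\
  (forall f a (m : G f a), u f a (v f a m) = m).

Definition is_iso (F G : qcoh) (u : qhom F G) : Prop :=
  exists v : qhom G F, inverse_homs u v.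

Definition isomorphic (F G : qcoh) : Prop := exists u : qhom F G, is_iso u.

Definition is_zero (F : qcoh) : Prop := forall f a (m : F f a), m = 0.

(* Standard open sets are affine, so exactness is tested on sections there. *)
Definition short_exact (A B C : qcoh) (u : qhom A B) (v : qhom B C) : Prop :=
  [/\ forall f a (m m' : A f a), u f a m = u f a m' -> m = m',
      forall f a (m : B f a), v f a m = 0 <-> exists m', u f a m' = m
    & forall f a (m : C f a), exists m', v f a m' = m].

Definition is_dsum (J : finType) (A : J -> qcoh) (P : qcoh) : Prop :=
  exists iota : forall j, qhom (A j) P,
  forall f, gdsum (fun j => hfun (iota j) f).

Lemma shift_act_inj (F : qcoh) x f a (m m' : F f (x + a)) :
  gact (x + (a + sodeg f)) (f : S) m = gact (x + (a + sodeg f)) (f : S) m' ->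
  m = m'.
Proof. by rewrite addrA; apply: so_act_inj. Qed.

Lemma shift_act_surj (F : qcoh) x f a (m : F f (x + (a + sodeg f))) :
  exists m' : F f (x + a), gact (x + (a + sodeg f)) (f : S) m' = m.
Proof. by move: m; rewrite addrA; apply: so_act_surj. Qed.

Lemma shift_loc_inj (F : qcoh) x f g a (m : F f (x + a)) :
  sub_open g f -> res g m = 0 ->
  exists n, gact (x + (a + sodeg g *+ n)) ((g : S) ^+ n) m = 0.
Proof.
by move=> gf /(loc_inj gf)[n m0]; exists n; move: m0; rewrite -addrA.
Qed.

Lemma shift_loc_surj (F : qcoh) x f g a (m : F g (x + a)) :
  sub_open g f ->
  exists (n : nat) (m' : F f (x + (a + sodeg g *+ n))),
    res g m' = gact (x + (a + sodeg g *+ n)) ((g : S) ^+ n) m.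
Proof.
by move=> /(loc_surj m)[n [m']]; move: m'; rewrite -addrA; exists n, m'.
Qed.

(* The shift F(x): F(x)_b = F_(x + b). *)
Definition shift (F : qcoh) (x : L) : qcoh :=
  @Qcoh (fun f => gshift (F f) x) (fun f g a => @res F f g (x + a))
    (fun f g a m m' h => resD m m' h)
    (fun f g a b s m h hs => res_act m h (gmod_shift_homog x hs))
    (fun f a m => res_id m)
    (fun f g h a m h1 h2 => res_comp m h1 h2)
    (fun f a => @shift_act_inj F x f a)
    (fun f a => @shift_act_surj F x f a)
    (fun f g a => @shift_loc_inj F x f g a)
    (fun f g a => @shift_loc_surj F x f g a).

(* S_f = S[T] / (f T - 1), where S[T] is L-graded by deg T = - deg f; the
   degree a part of S_f is the image of the degree a part of S[T]. *)

Definition pdeg (f : sopen) (a : L) (p : {poly S}) : Prop :=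
  forall i, homogeneous (a + sodeg f *+ i) p`_i.

Definition in_locI (f : S) (p : {poly S}) : Prop :=
  exists q, p = (f *: 'X - 1) * q.

Section Localization.
Variables (f : sopen) (a : L).

Definition gpoly_pred : {pred {poly S}} := fun p => `[< pdeg f a p >].

Lemma gpoly_zmod : zmod_closed gpoly_pred.
Proof.
split; first by apply/asboolP => i; rewrite coef0; apply: homog0.
move=> p q /asboolP hp /asboolP hq; apply/asboolP => i; rewrite coefB.
by apply: homogD (hp i) _; apply: homogN.
Qed.
HB.instance Definition _ :=
  GRing.isZmodClosed.Build {poly S} gpoly_pred gpoly_zmod.

Record gpoly := GPoly { gpoly_val : {poly S}; _ : gpoly_val \in gpoly_pred }.
HB.instance Definition _ := [isSub for gpoly_val].
HB.instance Definition _ := [Choice of gpoly by <:].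
HB.instance Definition _ := [SubChoice_isSubZmodule of gpoly by <:].

Definition loc_pred : {pred gpoly} := fun p => `[< in_locI f (val p) >].

Lemma loc_zmod : zmod_closed loc_pred.
Proof.
split; first by apply/asboolP; exists 0; rewrite mulr0.
move=> p q /asboolP[p' hp] /asboolP[q' hq]; apply/asboolP.
by exists (p' - q'); rewrite mulrBr -hp -hq.
Qed.
HB.instance Definition _ := GRing.isZmodClosed.Build gpoly loc_pred loc_zmod.

Definition locS : zmodType := Quotient.quot loc_pred.

(* The class in S_f of a polynomial in T that is homogeneous of degree a. *)
Definition locpi (p : {poly S}) : locS :=
  \pi_(Quotient.quot loc_pred) (insubd (0 : gpoly) p).
Definition locrep (x : locS) : {poly S} :=
  val (repr (x : Quotient.quot loc_pred)).

Lemma locrepP x : pdeg f a (locrep x).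
Proof. by apply/asboolP; apply: (valP (repr (x : Quotient.quot loc_pred))). Qed.

Lemma insubdE p : pdeg f a p -> val (insubd (0 : gpoly) p) = p.
Proof. by move=> hp; apply: insubdK; apply/asboolP. Qed.

Lemma locrepK x : locpi (locrep x) = x.
Proof. by rewrite /locpi /locrep valKd reprK. Qed.

Lemma locpiE p q : pdeg f a p -> pdeg f a q ->
  locpi p = locpi q <-> in_locI f (p - q).
Proof.
move=> hp hq; split=> [/eqP|h].
  by rewrite -Quotient.idealrBE => /asboolP; rewrite raddfB /= !insubdE.
apply/eqP; rewrite -Quotient.idealrBE; apply/asboolP.
by rewrite raddfB /= !insubdE.
Qed.

Lemma locpiD p q : pdeg f a p -> pdeg f a q ->
  locpi (p + q) = locpi p + locpi q.
Proof.
move=> hp hq; rewrite /locpi -raddfD; congr (\pi _); apply: val_inj.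
rewrite raddfD /= !insubdE // => i.
by rewrite coefD; apply: homogD.
Qed.

End Localization.

Lemma in_locI0 f : in_locI f 0.
Proof. by exists 0; rewrite mulr0. Qed.

Lemma in_locID f p q : in_locI f p -> in_locI f q -> in_locI f (p + q).
Proof. by move=> [u ->] [v ->]; exists (u + v); rewrite mulrDr. Qed.

Lemma in_locIN f p : in_locI f p -> in_locI f (- p).
Proof. by move=> [u ->]; exists (- u); rewrite mulrN. Qed.

Lemma in_locIM f p q : in_locI f q -> in_locI f (p * q).
Proof. by move=> [u ->]; exists (p * u); rewrite mulrCA. Qed.

Lemma in_locIZ f s q : in_locI f q -> in_locI f (s *: q).
Proof. by rewrite -mul_polyC; apply: in_locIM. Qed.

Lemma in_locI_sum f (I : Type) (r : seq I) (F : I -> {poly S}) :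
  (forall i, in_locI f (F i)) -> in_locI f (\sum_(i <- r) F i).
Proof.
move=> h; elim/big_ind: _ => [|p q|i _]; first exact: in_locI0.
  exact: in_locID.
exact: h.
Qed.

Lemma in_locI_trans f q p r :
  in_locI f (p - q) -> in_locI f (q - r) -> in_locI f (p - r).
Proof. by move=> h1 h2; have := in_locID h1 h2; rewrite addrA subrK. Qed.

Lemma in_locI_sym f p q : in_locI f (p - q) -> in_locI f (q - p).
Proof. by move/in_locIN; rewrite opprB. Qed.

Lemma in_locI1X f n : in_locI f ((f *: 'X) ^+ n - 1).
Proof.
rewrite subrX1; eexists; reflexivity.
Qed.

Lemma locpi_repK f a p : pdeg f a p -> in_locI f (locrep (locpi f a p) - p).
Proof.
move=> hp; apply/(locpiE (locrepP _) hp).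
by rewrite locrepK.
Qed.

Lemma pdegD f a p q : pdeg f a p -> pdeg f a q -> pdeg f a (p + q).
Proof. by move=> hp hq i; rewrite coefD; apply: homogD. Qed.

Lemma pdegZ f a b s p : homogeneous (b - a) s -> pdeg f a p ->
  pdeg f b (s *: p).
Proof.
move=> hs hp i; rewrite coefZ.
by have -> : b + sodeg f *+ i = b - a + (a + sodeg f *+ i);
  [rewrite addrA subrK | apply: homogM].
Qed.

Lemma pdegZX f a s n : homogeneous (a + sodeg f *+ n) s ->
  pdeg f a (s *: 'X^n).
Proof.
move=> hs i; rewrite coefZ coefXn; case: eqP => [->|_]; rewrite ?mulr1 //.
by rewrite mulr0; apply: homog0.
Qed.

Lemma pdegC f a s : homogeneous a s -> pdeg f a s%:P.
Proof.
move=> hs i; rewrite coefC; case: eqP => [->|_]; last exact: homog0.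
by rewrite mulr0n addr0.
Qed.

Lemma pdeg_sum f a (I : Type) (r : seq I) (F : I -> {poly S}) :
  (forall i, pdeg f a (F i)) -> pdeg f a (\sum_(i <- r) F i).
Proof.
move=> h; elim/big_ind: _ => [i|p q|i _]; last exact: h.
  by rewrite coef0; apply: homog0.
exact: pdegD.
Qed.

Definition loc_act f a b (s : S) (x : locS f a) : locS f b :=
  locpi f b (s *: locrep x).

Lemma loc_act_pi f a b s p : homogeneous (b - a) s -> pdeg f a p ->
  loc_act b s (locpi f a p) = locpi f b (s *: p).
Proof.
move=> hs hp; apply/locpiE; [exact: pdegZ (locrepP _)|exact: pdegZ hp|].
by rewrite -scalerBr; apply: in_locIZ; apply: locpi_repK.
Qed.

Lemma loc_actDr f a b s (m m' : locS f a) : homogeneous (b - a) s ->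
  loc_act b s (m + m') = loc_act b s m + loc_act b s m'.
Proof.
move=> hs; rewrite -(locrepK m) -(locrepK m').
have [h h'] := (locrepP m, locrepP m').
rewrite -locpiD // !loc_act_pi //; last exact: pdegD.
by rewrite scalerDr locpiD //; apply: pdegZ hs _.
Qed.

Lemma loc_actDl f a b s s' (m : locS f a) : homogeneous (b - a) s ->
  homogeneous (b - a) s' -> loc_act b (s + s') m = loc_act b s m + loc_act b s' m.
Proof.
move=> hs hs'; rewrite -(locrepK m); have h := locrepP m.
rewrite !loc_act_pi //; last exact: homogD.
by rewrite scalerDl locpiD //; [apply: pdegZ hs _ | apply: pdegZ hs' _].
Qed.

Lemma loc_act1 f a (m : locS f a) : loc_act a 1 m = m.
Proof. by rewrite /loc_act scale1r locrepK. Qed.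

Lemma loc_actA f a b c s s' (m : locS f a) : homogeneous (b - a) s ->
  homogeneous (c - b) s' -> loc_act c s' (loc_act b s m) = loc_act c (s' * s) m.
Proof.
move=> hs hs'; rewrite -(locrepK m); have h := locrepP m.
rewrite !loc_act_pi //; first by rewrite scalerA.
- by have := homogM hs' hs; rewrite addrA subrK.
- exact: pdegZ h.
Qed.

Definition locG (f : sopen) : gmod :=
  Gmod (@loc_actDr f) (@loc_actDl f) (@loc_act1 f) (@loc_actA f).

(* The element s T^n = s / g^n of S_g that is inverse to f, when D(g) is
   contained in D(f). *)
Definition inv_on (g f : sopen) : {poly S} :=
  if pselect (sub_open g f) is left h then
    sval (cid (svalP (cid h))) *: 'X^(sval (cid h))
  else 0.

Lemma inv_onP g f : sub_open g f ->
  [/\ exists n s, homogeneous (sodeg g *+ n - sodeg f) s /\ inv_on g f = s *: 'X^n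
    & in_locI g ((f : S) *: inv_on g f - 1)].
Proof.
rewrite /inv_on; case: pselect => // h _.
set n := sval (cid h); case: (cid (svalP (cid h))) => s /= [hs e].
split; first by exists n, s.
by rewrite scalerA -e -exprZn; apply: in_locI1X.
Qed.

Lemma pdeg_comp g f a p : sub_open g f -> pdeg f a p ->
  pdeg g a (p \Po inv_on g f).
Proof.
move=> /inv_onP[[n [s [hs ->]]] _] hp.
rewrite comp_polyE; apply: pdeg_sum => i.
rewrite exprZn scalerA -exprM; apply: pdegZX.
have -> : a + sodeg g *+ (n * i) =
    (a + sodeg f *+ i) + (sodeg g *+ n - sodeg f) *+ i.
  by rewrite mulrnBl -mulrnA addrACA subrr addr0.
by apply: homogM (hp i) _; apply: homogX.
Qed.

Lemma in_locI_comp (g f : S) u p : in_locI g (f *: u - 1) ->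
  in_locI f p -> in_locI g (p \Po u).
Proof.
move=> hu [q ->]; rewrite comp_polyM mulrC; apply: in_locIM.
by rewrite comp_polyB comp_polyZ comp_polyX comp_polyC.
Qed.

Lemma in_locI_inv_uniq (g f : S) u v : in_locI g (f *: u - 1) ->
  in_locI g (f *: v - 1) -> in_locI g (u - v).
Proof.
move=> hu hv; have -> : u - v = u * (1 - f *: v) + v * (f *: u - 1).
  by rewrite !mulrBr !mulr1 -!scalerAr [v * u]mulrC addrA subrK.
by apply: in_locID; apply: in_locIM => //; apply: in_locI_sym.
Qed.

Lemma in_locI_comp_eq (g : S) u v p : in_locI g (u - v) ->
  in_locI g ((p \Po u) - (p \Po v)).
Proof.
move=> huv; rewrite !comp_polyE -sumrB; apply: in_locI_sum => i.
by rewrite -scalerBr; apply: in_locIZ; rewrite subrXX mulrC; apply: in_locIM.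
Qed.

Definition loc_res (f g : sopen) (a : L) (x : locS f a) : locS g a :=
  locpi g a (locrep x \Po inv_on g f).

Lemma loc_res_pi f g a p : sub_open g f -> pdeg f a p ->
  loc_res g (locpi f a p) = locpi g a (p \Po inv_on g f).
Proof.
move=> gf hp; apply/locpiE; [exact: pdeg_comp (locrepP _)|exact: pdeg_comp|].
have [_ hu] := inv_onP gf.
by rewrite -comp_polyB; apply: in_locI_comp hu _; apply: locpi_repK.
Qed.

Lemma loc_resD f g a (m m' : locS f a) : sub_open g f ->
  loc_res g (m + m') = loc_res g m + loc_res g m'.
Proof.
move=> gf; rewrite -(locrepK m) -(locrepK m').
have [h h'] := (locrepP m, locrepP m').
rewrite -(locpiD h h') !loc_res_pi //; last exact: pdegD.
by rewrite comp_polyD locpiD //; apply: pdeg_comp.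
Qed.

Lemma loc_res_act f g a b s (m : locS f a) : sub_open g f ->
  homogeneous (b - a) s -> loc_res g (loc_act b s m) = loc_act b s (loc_res g m).
Proof.
move=> gf hs; rewrite -(locrepK m); have h := locrepP m.
rewrite loc_act_pi // !loc_res_pi //; last exact: pdegZ h.
by rewrite loc_act_pi ?comp_polyZ //; apply: pdeg_comp.
Qed.

Lemma sub_open_refl f : sub_open f f.
Proof.
exists 1%N, 1; split; last by rewrite expr1 mulr1.
by rewrite mulr1n subrr; apply: homog1.
Qed.

Lemma sub_open_trans g f h : sub_open g f -> sub_open h g -> sub_open h f.
Proof.
move=> [n [s [hs e]]] [m [s' [hs' e']]]; exists (m * n)%N, (s * s' ^+ n); split.
  have -> : sodeg h *+ (m * n) - sodeg f =
      (sodeg g *+ n - sodeg f) + (sodeg h *+ m - sodeg g) *+ n.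
    by rewrite mulrnBl -mulrnA [RHS]addrC addrA subrK.
  by apply: homogM hs _; apply: homogX.
by rewrite exprM e' exprMn e mulrA.
Qed.

Lemma loc_res_id f a (m : locS f a) : loc_res f m = m.
Proof.
rewrite -(locrepK m); have h := locrepP m; have ff := sub_open_refl f.
rewrite loc_res_pi //; apply/locpiE => //; first exact: pdeg_comp.
have [_ hu] := inv_onP ff; rewrite -[X in _ - X]comp_polyXr.
by apply: in_locI_comp_eq; apply: in_locI_inv_uniq hu _; exists 1; rewrite mulr1.
Qed.

Lemma loc_res_comp f g h a (m : locS f a) : sub_open g f -> sub_open h g ->
  loc_res h (loc_res g m) = loc_res h m.
Proof.
move=> gf hg; have hf := sub_open_trans gf hg.
rewrite -(locrepK m); have hm := locrepP m.
rewrite !loc_res_pi //; last exact: pdeg_comp.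
apply/(locpiE (pdeg_comp hg (pdeg_comp gf hm)) (pdeg_comp hf hm)).
have [[_ hgf] [_ hhg]] := (inv_onP gf, inv_onP hg); have [_ hhf] := inv_onP hf.
rewrite -comp_polyA; apply: in_locI_comp_eq; apply: in_locI_inv_uniq hhf.
by have := in_locI_comp hhg hgf; rewrite comp_polyB comp_polyZ comp_polyC.
Qed.

Lemma loc_act_inj (f : sopen) a (m m' : locS f a) :
  loc_act (a + sodeg f) (f : S) m = loc_act (a + sodeg f) (f : S) m' -> m = m'.
Proof.
rewrite -(locrepK m) -(locrepK m'); have [h h'] := (locrepP m, locrepP m').
have hf : homogeneous (a + sodeg f - a) f by rewrite addrC addKr; apply: so_homog.
rewrite !loc_act_pi // => /locpiE e; apply/locpiE => //.
have {}e := e (pdegZ hf h) (pdegZ hf h').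
move: e; rewrite -scalerBr; set p := _ - _ => e.
have -> : p = 'X * ((f : S) *: p) - ((f : S) *: 'X - 1) * p.
  by rewrite mulrBl mul1r -scalerAl -scalerAr opprB addrC subrK.
apply: in_locID; first exact: in_locIM.
by apply: in_locIN; exists p.
Qed.

Lemma loc_act_surj (f : sopen) a (m : locS f (a + sodeg f)) :
  exists m' : locS f a, loc_act (a + sodeg f) (f : S) m' = m.
Proof.
rewrite -(locrepK m); have h := locrepP m.
have hf : homogeneous (a + sodeg f - a) f by rewrite addrC addKr; apply: so_homog.
have hX : pdeg f a (locrep m * 'X).
  move=> [|i]; rewrite coefMX; first exact: homog0.
  by rewrite /= mulrS addrA; apply: h.
exists (locpi f a (locrep m * 'X)); rewrite loc_act_pi //.
apply/locpiE => //; first exact: pdegZ hX.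
by exists (locrep m); rewrite mulrBl mul1r -scalerAl mulrC scalerAr.
Qed.

Lemma loc_norm (f : sopen) a p : pdeg f a p ->
  exists (N : nat) (c : S), homogeneous (a + sodeg f *+ N) c /\
    in_locI f ((f : S) ^+ N *: p - c%:P).
Proof.
move=> hp; exists (size p), (\sum_(i < size p) p`_i * (f : S) ^+ (size p - i)).
split.
  elim/big_ind: _ => [|u v|i _]; [exact: homog0|exact: homogD|].
  have -> : a + sodeg f *+ size p =
      a + sodeg f *+ i + sodeg f *+ (size p - i).
    by rewrite -addrA -mulrnDr subnKC // ltnW.
  by apply: homogM (hp i) _; apply/homogX/so_homog.
rewrite -{2}(coefK p) poly_def scaler_sumr rmorph_sum -sumrB /=.
apply: in_locI_sum => i; rewrite scalerA mulrC -scalerA -alg_polyC -scalerA.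
rewrite -scalerBr; apply: in_locIZ.
rewrite -{1}(subnK (ltnW (ltn_ord i))) exprD -scalerA -exprZn -scalerBr.
by apply/in_locIZ/in_locI1X.
Qed.

Lemma in_locI_const (g c : S) : in_locI g c%:P -> exists n, g ^+ n * c = 0.
Proof.
case=> q e; exists (size q).
have h i : q`_i = - (g ^+ i * c).
  have ei j : (if j == 0%N then c else 0) =
      g * (if j == 0%N then 0 else q`_j.-1) - q`_j.
    by rewrite -coefC e mulrBl mul1r -scalerAl coefB coefZ coefXM.
  elim: i => [|i IHi]; first by have /= -> := ei 0%N; rewrite expr0 mul1r mulr0 sub0r opprK.
  have /eqP := ei i.+1; rewrite /= eq_sym subr_eq0 => /eqP <-.
  by rewrite IHi mulrN exprS mulrA.
by have := h (size q); rewrite nth_default // => /eqP; rewrite eq_sym oppr_eq0 => /eqP.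
Qed.

Lemma loc_loc_inj f g a (m : locS f a) : sub_open g f -> loc_res g m = 0 ->
  exists n, loc_act (a + sodeg g *+ n) ((g : S) ^+ n) m = 0.
Proof.
move=> gf; rewrite -(locrepK m); have h := locrepP m.
set p := locrep m in h *; have [_ hu] := inv_onP gf.
have pdeg0 b e : pdeg b e 0 by move=> i; rewrite coef0; apply: homog0.
have locpi0 b e : locpi b e 0 = 0.
  by apply: (addrI (locpi b e 0)); rewrite -locpiD // !addr0.
rewrite loc_res_pi // -(locpi0 g a) => /locpiE; rewrite subr0 => e.
have {}e := e (pdeg_comp gf h) (pdeg0 _ _).
have [N [c [hc hpc]]] := loc_norm h.
have : in_locI g c%:P.
  have h1 := in_locI_comp hu hpc; rewrite comp_polyB comp_polyZ comp_polyC in h1.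
  have := in_locID (in_locIZ ((f : S) ^+ N) e) (in_locIN h1).
  by rewrite opprB addrC subrK.
case/in_locI_const => n nc0; exists n.
have hg : homogeneous (a + sodeg g *+ n - a) ((g : S) ^+ n).
  by rewrite addrC addKr; apply/homogX/so_homog.
rewrite loc_act_pi //; apply: etrans (locpi0 f _).
apply/(locpiE (pdegZ hg h) (pdeg0 _ _)).
rewrite subr0.
have hfN : in_locI f (p - 'X^N * ((f : S) ^+ N *: p)).
  rewrite -scalerAr scalerAl -exprZn -{1}(mul1r p) -mulrBl mulrC.
  by apply/in_locIM/in_locI_sym/in_locI1X.
have hc2 : in_locI f (p - 'X^N * c%:P).
  by apply: in_locI_trans hfN _; rewrite -mulrBr; apply: in_locIM.
have := in_locIZ ((g : S) ^+ n) hc2.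
by rewrite scalerBr scalerAr -[_ *: _%:P]mul_polyC -polyCM nc0 mulr0 subr0.
Qed.

Lemma loc_loc_surj f g a (m : locS g a) : sub_open g f ->
  exists (n : nat) (m' : locS f (a + sodeg g *+ n)),
    loc_res g m' = loc_act (a + sodeg g *+ n) ((g : S) ^+ n) m.
Proof.
move=> gf; rewrite -(locrepK m); have h := locrepP m.
have [n [c [hc hmc]]] := loc_norm h.
exists n, (locpi f _ c%:P).
have hg : homogeneous (a + sodeg g *+ n - a) ((g : S) ^+ n).
  by rewrite addrC addKr; apply/homogX/so_homog.
rewrite loc_act_pi // loc_res_pi //; last exact: pdegC.
rewrite comp_polyC; apply/locpiE; [exact: pdegC|exact: pdegZ hg h|].
exact: in_locI_sym.
Qed.

Definition structure_sheaf : qcoh :=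
  @Qcoh locG loc_res loc_resD loc_res_act loc_res_id loc_res_comp
    loc_act_inj loc_act_surj loc_loc_inj loc_loc_surj.

Definition line_bundle (F : qcoh) : Prop :=
  exists y : L, isomorphic F (shift structure_sheaf y).

(* The sets D(h_i) cover Proj^L S: every homogeneous element of positive degree
   lies in the radical of the ideal (h_i). *)
Definition covering (n : nat) (h : 'I_n -> sopen) : Prop :=
  forall g : sopen, exists (N : nat) (c : 'I_n -> S),
    (g : S) ^+ N = \sum_i c i * (h i : S).

(* Locally, a finite direct sum of shifts of the structure sheaf; in
   particular coherent.  The category of vector bundles is the full subcategory
   of qcoh on these objects. *)
Definition vector_bundle (F : qcoh) : Prop :=
  exists (n : nat) (h : 'I_n -> sopen), covering h /\
  forall i, exists (r : nat) (y : 'I_r -> L)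
    (iota : forall j, ghom (shift structure_sheaf (y j) (h i)) (F (h i))),
    gdsum iota.

Definition indecomposable (E : qcoh) : Prop :=
  ~ is_zero E /\
  forall A : bool -> qcoh, (forall b, vector_bundle (A b)) -> is_dsum A E ->
    exists b, is_zero (A b).

Definition line_bundle_sum (P : qcoh) : Prop :=
  exists (n : nat) (A : 'I_n -> qcoh),
    (forall i, line_bundle (A i)) /\ is_dsum A P.

(* Covers and hulls are relative to the exact structure on vector bundles given
   by the short exact sequences that stay exact under Hom(F, -) for all line
   bundles F; its projective and its injective objects are the finite direct
   sums of line bundles.  The last clause is minimality: no endomorphism of P
   over E (of I under E) other than automorphisms. *)
Definition projective_cover (E P : qcoh) (p : qhom P E) : Prop :=
  [/\ line_bundle_sum P,
      forall (F : qcoh) (u : qhom F E), line_bundle F ->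
        exists v : qhom F P, comp_eq p v u
    & forall u : qhom P P, comp_eq p u p -> is_iso u].

Definition injective_hull (E I : qcoh) (q : qhom E I) : Prop :=
  [/\ line_bundle_sum I,
      forall (F : qcoh) (u : qhom E F), line_bundle F ->
        exists v : qhom I F, comp_eq v q u
    & forall u : qhom I I, comp_eq u q q -> is_iso u].

Definition hom_orthogonal (J : finType) (A : J -> qcoh) : Prop :=
  forall i j, i != j -> forall u : qhom (A i) (A j), hom_zero u.

Definition xsum (l : 'I_t -> nat) : L := \sum_i xL i *+ l i.

(* The index set I of the indices j with l_j <> p_j - 1. *)
Definition nonmax (l : 'I_t -> nat) : finType :=
  {j : 'I_t | l j != (wt X j - 1)%N}.

Definition cover_summand (Lb : qcoh) (l : 'I_t -> nat)
    (o : option (nonmax l)) : qcoh :=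
  if o is Some j then shift Lb (xsum l - xL (val j) *+ (1 + l (val j)))
  else shift Lb omegaL.

Definition hull_summand (Lb : qcoh) (l : 'I_t -> nat)
    (o : option (nonmax l)) : qcoh :=
  if o is Some j then shift Lb (xL (val j) *+ (1 + l (val j)) + omegaL)
  else shift Lb (xsum l).

End WeightedProjectiveLine.

(* Main.v *)
Require Import Defs.
From HB Require Import structures.
From mathcomp Require Import all_boot all_order all_algebra.
From mathcomp Require Import boolp ssrcomplements mpoly.
From mathcomp Require Import ring zify.

Set Implicit Arguments.
Unset Strict Implicit.
Unset Printing Implicit Defensive.

Import GRing.Theory Num.Theory Order.TTheory.
Local Open Scope ring_scope.
Local Open Scope quotient_scope.

(* Let L = O, so that E is an extension of O(x) by O(omega).  It does not split,
   since E is indecomposable.  Cech cohomology for the covering by D(x_1) and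
   D(x_2), computed with the basis of S over k[x_1, x_2] given by the monomials
   in x_3, ..., x_t with exponents below the weights, shows that H^1(O(omega - x))
   is a line spanned by a monomial, and that multiplying this class by a
   homogeneous element kills it for the elements x_j^(1 + l_j), but not for the
   divisors of x^l.  By the pencil relations (at least two of the l_j differ from
   p_j - 1) every homogeneous element is, up to a multiple of a divisor of x^l, in
   the ideal of the x_j^(1 + l_j) with j in I.  So these elements generate the
   maps from line bundles to O(x) that lift to E as well as the maps from O(omega)
   to line bundles that extend to E.  The degrees of the summands are pairwise
   incomparable, which gives orthogonality; as End(O(y)) = k, an endomorphism of
   the cover over E, or of the hull under E, is then the identity. *)

(** Cover and hull rest on one computation. Lifting s : O(y) -> O(x) to E is obstructed by the image
    of s under the connecting map, and extending s : O(omega) -> O(y) to E is obstructed by the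
    pushout of the sequence along s. Both obstructions are s times the class of E, so the same test,
    whether s times the socle monomial lies in (x_1^n, x_2^n), decides both. The obstacle is that a
    sheaf is given only by modules over the standard open sets, where an element becomes a multiple
    of a generator only after multiplication by a power of the equation. Line bundles are therefore
    handled through a compatible family of generators, morphisms are built from graphs that are
    stable under such powers, and Cech classes are numerators over (x_1 x_2)^n, with n allowed to
    grow. *)

(* The square-zero extension of the integers by an abelian group; through the
   embedding [sqz_inr] the tactic [ring] proves identities in abelian groups. *)
Definition sqz (V : zmodType) : Type := (int * V)%type.

Section SquareZero.
Variable V : zmodType.
HB.instance Definition _ := GRing.Zmodule.on (sqz V).

Definition sqz_mul (x y : sqz V) : sqz V :=
  (x.1 * y.1, y.2 *~ x.1 + x.2 *~ y.1).

Lemma sqz_mulA : associative sqz_mul.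
Proof.
move=> [a u] [b v] [c w]; congr pair; rewrite /= ?mulrA //.
by rewrite !mulrzDl -!mulrzA addrA [b * a]mulrC [c * a]mulrC.
Qed.

Lemma sqz_mulC : commutative sqz_mul.
Proof. by move=> [a u] [b v]; congr pair; rewrite /= 1?mulrC 1?addrC. Qed.

Lemma sqz_mul1 : left_id (1, 0) sqz_mul.
Proof. by move=> [a u]; congr pair; rewrite /= ?mul1r // mul0rz addr0. Qed.

Lemma sqz_mulDl : left_distributive sqz_mul +%R.
Proof.
move=> [a u] [b v] [c w]; congr pair; rewrite /= ?mulrDl //.
by rewrite mulrzDr mulrzDl addrACA.
Qed.

Lemma sqz_oner_neq0 : ((1, 0) : sqz V) != 0.
Proof. by apply/eqP => -[]. Qed.

HB.instance Definition _ := GRing.Zmodule_isComNzRing.Build (sqz V)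
  sqz_mulA sqz_mulC sqz_mul1 sqz_mulDl sqz_oner_neq0.

Definition sqz_inr (v : V) : sqz V := (0, v).
Lemma sqz_inr_additive : zmod_morphism sqz_inr.
Proof. by move=> u v; congr pair; rewrite /= subr0. Qed.
HB.instance Definition _ := GRing.isZmodMorphism.Build V (sqz V) sqz_inr sqz_inr_additive.

Lemma sqz_inr_inj : injective sqz_inr.
Proof. by move=> u v []. Qed.
End SquareZero.

Ltac zmod := apply: sqz_inr_inj; ring.


(** * The grading group *)

Section GradingGroup.
Variables (k : closedFieldType) (t : nat) (X : wpl k t).
Implicit Types (i j : 'I_t) (v : 'I_t -> int).

Lemma wt_gt0 i : (0 < wt X i)%N.
Proof. exact: ltnW (wt_ge2 X i). Qed.

Lemma piL_is_zmod_morphism : zmod_morphism (piL X).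
Proof. by move=> u v; rewrite /piL raddfB. Qed.
HB.instance Definition _ :=
  GRing.isZmodMorphism.Build _ _ (piL X) piL_is_zmod_morphism.

Lemma sum_xL v : \sum_i xL X i *~ v i = piL X [ffun i => v i].
Proof.
transitivity (piL X (\sum_i free_gen i *~ v i)).
  by rewrite raddf_sum; apply: eq_bigr => i _; rewrite raddfMz.
congr (piL X _); apply/ffunP => j; rewrite sum_ffunE ffunE (bigD1 j) //=.
rewrite big1 ?addr0 => [|i ij]; rewrite ffunMzE mulrzz !ffunE ?eqxx ?mul1r //=.
by rewrite eq_sym (negPf ij) mul0r.
Qed.

(** A combination of the relations p_i e_i - p_1 e_1 with coefficients n_i has i-th coordinate p_i
    n_i for i > 1, while the first one is p_1 times n_1 minus the total. Correcting n_1 by the total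
    gives coefficients of sum zero. *)
Lemma piL_eq0 (u : {ffun 'I_t -> int}) : piL X u = 0 ->
  exists z : 'I_t -> int, \sum_i z i = 0 /\ forall i, u i = (wt X i)%:Z * z i.
Proof.
rewrite -(raddf0 (piL X)) => /eqP; rewrite -Quotient.idealrBE subr0.
move=> /asboolP[n ->].
pose z i : int := n i - (i == idx1 X)%:R * \sum_j n j.
have uE i : (\sum_j (free_gen j *+ wt X j - free_gen (idx1 X) *+ wt X (idx1 X))
    *~ n j) i = (wt X i)%:Z * n i
      - (i == idx1 X)%:R * (wt X (idx1 X))%:Z * \sum_j n j.
  rewrite sum_ffunE (eq_bigr (fun j => (wt X j)%:Z * (j == i)%:R * n j
      - (i == idx1 X)%:R * (wt X (idx1 X))%:Z * n j)); last first.
    move=> j _; rewrite ffunMzE mulrzz !ffunE !ffunMnE !ffunE.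
    by rewrite [i == j]eq_sym -!(mulr_natr _%:R) !natz; ring.
  rewrite sumrB (bigD1 i) //= eqxx mulr1.
  rewrite [X in _ + X - _]big1 => [|j ji].
    by rewrite addr0 mulr_sumr.
  by rewrite (negPf ji) mulr0 mul0r.
exists z; split.
  rewrite sumrB [X in _ - X](bigD1 (idx1 X)) // eqxx mul1r.
  rewrite [X in _ - (_ + X)]big1 => [|j ji]; last by rewrite (negPf ji) mul0r.
  by rewrite addr0 subrr.
move=> i; rewrite uE /z mulrBr; congr (_ - _).
by case: eqP => [->|_]; rewrite /= ?mulr1n ?mulr0n; ring.
Qed.

Lemma xL_wt i : xL X i *+ wt X i = cL X.
Proof.
apply/eqP; rewrite -subr_eq0 /cL /xL -!raddfMn -raddfB /=.
rewrite -(raddf0 (piL X)) -Quotient.idealrBE subr0; apply/asboolP.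
exists (fun j => (j == i)%:R); rewrite (bigD1 i) //= eqxx.
rewrite big1 ?addr0 ?mulr1z // => j ji.
by rewrite (negPf ji) mulr0z.
Qed.

(** Turns questions about L into integer arithmetic: each z_i is bounded from its own coordinate,
    and the bounds are compared with the prescribed sum N. The proof moves N c into the first
    coordinate and uses the kernel of the projection to L. *)
Lemma sum_xL_eq_cL v (N : int) : \sum_i xL X i *~ v i = cL X *~ N ->
  exists z : 'I_t -> int, \sum_i z i = N /\ forall i, v i = (wt X i)%:Z * z i.
Proof.
move=> e; pose j := idx1 X; pose w i := v i - (i == j)%:R * ((wt X j)%:Z * N).
have : piL X [ffun i => w i] = 0.
  rewrite -sum_xL; under eq_bigr do rewrite mulrzBr.
  rewrite sumrB e [X in _ - X](bigD1 j) // eqxx mul1r big1 => [|i ij].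
    by rewrite Monoid.mulm1 mulrzA -pmulrn xL_wt subrr.
  by rewrite (negPf ij) mul0r.
case/piL_eq0 => z [z0 zE]; exists (fun i => z i + (i == j)%:R * N); split.
  rewrite big_split /= z0 add0r (bigD1 j) // eqxx mul1r big1 ?Monoid.mulm1 // => i ij.
  by rewrite (negPf ij) mul0r.
move=> i; have := zE i; rewrite ffunE /w => /eqP; rewrite subr_eq => /eqP ->.
by case: eqP => [->|_]; rewrite /= ?mulr1n ?mulr0n; ring.
Qed.

Lemma sum_xL_eq0 v : \sum_i xL X i *~ v i = 0 ->
  exists z : 'I_t -> int, \sum_i z i = 0 /\ forall i, v i = (wt X i)%:Z * z i.
Proof. by rewrite -(mulr0z (cL X)); apply: sum_xL_eq_cL. Qed.

Lemma wdeg_eqP (m m' : 'X_{1..t}) : wdeg X m = wdeg X m' ->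
  exists z : 'I_t -> int, \sum_i z i = 0 /\
    forall i, (m i)%:Z - (m' i)%:Z = (wt X i)%:Z * z i.
Proof.
move=> /eqP; rewrite -subr_eq0 -sumrB => /eqP e; apply: sum_xL_eq0.
by rewrite -[RHS]e; apply: eq_bigr => i _; rewrite mulrzBr.
Qed.

Lemma wdegD (m m' : 'X_{1..t}) : wdeg X (m + m')%MM = wdeg X m + wdeg X m'.
Proof. by rewrite -big_split; apply: eq_bigr => i _; rewrite mnmDE mulrnDr. Qed.

Lemma wdeg0 : wdeg X 0%MM = 0.
Proof. by rewrite /wdeg big1 // => i _; rewrite mnm0E. Qed.

Lemma wdeg1 i : wdeg X U_(i)%MM = xL X i.
Proof.
rewrite /wdeg (bigD1 i) //= mnm1E eqxx big1 ?addr0 // => j ji.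
by rewrite mnm1E eq_sym (negPf ji).
Qed.

Lemma wdegMn m n : wdeg X (m *+ n)%MM = wdeg X m *+ n.
Proof. by elim: n => [|n IHn]; rewrite ?mulm0n ?wdeg0 // mulmSr wdegD IHn mulrSr. Qed.

(** The z_i are nonnegative because the exponents are, and they sum to zero. This gives S_0 = k and
    the antisymmetry of the order. *)
Lemma wdeg_eq0 (m : 'X_{1..t}) : wdeg X m = 0 -> m = 0%MM.
Proof.
rewrite -wdeg0 => /wdeg_eqP[z [z0 zE]].
have zge i : 0 <= z i.
  have := zE i; rewrite mnm0E subr0 => e.
  by rewrite -(pmulr_rge0 _ (_ : 0 < (wt X i)%:Z)) -?e // ltz_nat wt_gt0.
apply/mnmP => i; rewrite mnm0E.
have zi0 : z i = 0.
  have := z0 => /eqP; rewrite psumr_eq0; last by move=> j _; apply: zge.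
  by move=> /allP/(_ i (mem_index_enum _))/eqP.
by have := zE i; rewrite mnm0E zi0 mulr0 subr0 => -[].
Qed.

Lemma leL0P (d : L X) : leL 0 d <-> exists m, d = wdeg X m.
Proof.
split=> [[n e]|[m ->]]; last by exists m; rewrite subr0.
exists [multinom n i | i < t]; rewrite -[d]subr0 e; apply: eq_bigr => i _.
by rewrite mnmE.
Qed.

Lemma leL0D (d e : L X) : leL 0 d -> leL 0 e -> leL 0 (d + e).
Proof.
move=> /leL0P[m ->] /leL0P[m' ->]; apply/leL0P; exists (m + m')%MM.
by rewrite wdegD.
Qed.

Lemma leL0_anti (d e : L X) : leL 0 d -> leL 0 e -> d + e = 0 -> d = 0.
Proof.
move=> /leL0P[m ->] /leL0P[m' ->]; rewrite -wdegD => /wdeg_eq0/eqP.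
by rewrite mnmD_eq0 => /andP[/eqP -> _]; rewrite wdeg0.
Qed.

Lemma xL_pos i : leL 0 (xL X i) /\ xL X i <> 0.
Proof.
rewrite -wdeg1; split; first by apply/leL0P; eexists.
by move/wdeg_eq0/eqP; rewrite mnm1_eq0.
Qed.

Lemma omegaLE : omegaL X + \sum_i xL X i = cL X *+ (t - 2).
Proof. by rewrite /omegaL subrK. Qed.

Lemma sum_Posz (I : finType) (n : I -> nat) :
  \sum_i (n i)%:Z = (\sum_i n i)%N%:Z.
Proof. by rewrite (big_morph Posz PoszD (erefl _)). Qed.

(** * Inequalities between the degrees of the summands *)

Section Degrees.
Variable l : 'I_t -> nat.
Hypothesis ll : forall i, (l i <= wt X i - 1)%N.

(** If delta - x is the sum of the n_i x_i, adding x and twice the sum of the x_i gives that the sum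
    of the (l_i + n_i + 2) x_i is (2t - 3) c. Hence every z_i is at least 1, and at least 2 when l_i
    = p_i - 1, so t plus the number of maximal l_i is at most 2t - 3. *)
Lemma sum_max_le : leL (xsum X l) (deltaL X) ->
  (\sum_(i < t) (l i == wt X i - 1) + 3 <= t)%N.
Proof.
case=> n e; have [z [sz zE]] : exists z : 'I_t -> int,
    \sum_i z i = ((t - 2) * 2 + 1)%N%:Z /\
    forall i, (l i + n i + 2)%N%:Z = (wt X i)%:Z * z i.
  apply: sum_xL_eq_cL; under eq_bigr do rewrite -pmulrn !mulrnDr.
  rewrite !big_split /= -e -/(xsum X l) -pmulrn mulrnDr mulrnA -omegaLE.
  by rewrite mulrnDl /deltaL; zmod.
have zge i : (1 + (l i == wt X i - 1))%N%:Z <= z i.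
  have := zE i; have := ll i; have := wt_ge2 X i.
  by case: eqP => [->|_] /=; nia.
have : \sum_i (1 + (l i == wt X i - 1))%N%:Z <= \sum_i z i.
  by apply: ler_sum.
rewrite sz sum_Posz big_split /= sum1_card card_ord.
have := t_ge3 X; set s := (\sum_i _)%N; lia.
Qed.

Lemma xsum_split j :
  xsum X l = xL X j *+ l j + \sum_(i | i != j) xL X i *+ l i.
Proof. by rewrite /xsum (bigD1 j). Qed.

(** The difference is (t - 2) c minus the sum of the (l_i + 1) x_i over i different from j. Each of
    these t - 1 coordinates is positive and hence costs at least one c. *)
Lemma not_le_omega_cover j :
  ~ leL 0 (omegaL X - (xsum X l - xL X j *+ (1 + l j))).
Proof.
case/leL0P=> m; rewrite /omegaL => e.
pose v i : int := ((i != j) * (l i + 1))%N%:Z + (m i)%:Z.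
have [z [sz zE]] : exists z : 'I_t -> int,
    \sum_i z i = (t - 2)%N%:Z /\ forall i, v i = (wt X i)%:Z * z i.
  apply: sum_xL_eq_cL; under eq_bigr do rewrite mulrzDr -!pmulrn.
  rewrite big_split -/(wdeg X m) -e -pmulrn (bigD1 j) //= eqxx mulr0n add0r.
  under eq_bigr => i /negPf ij do rewrite ij mul1n mulrnDr.
  rewrite big_split /= (xsum_split j) (bigD1 (P := xpredT) j) //=.
  by zmod.
have zge i : (i != j)%N%:Z <= z i.
  have := zE i; rewrite /v; have := ll i; have := wt_ge2 X i.
  by case: (i != j) => /=; nia.
have : \sum_i (i != j)%N%:Z <= \sum_i z i by apply: ler_sum.
rewrite sz sum_Posz (bigD1 j) //= eqxx add0n.
rewrite (eq_bigr (fun=> 1%N)) => [|i ->//]; rewrite sum1_card cardC1 card_ord.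
by have := t_ge3 X; lia.
Qed.

(** Since 1 + l_i < p_i, the positive term cannot fill a whole c, so no z_h is positive; and z_j is
    negative, which contradicts the sum zero. *)
Lemma not_le_cover_cover i j : i != j -> l i != (wt X i - 1)%N ->
  ~ leL 0 (xL X i *+ (1 + l i) - xL X j *+ (1 + l j)).
Proof.
move=> ij lim /leL0P[m e].
pose v h : int := ((h == i) * (1 + l h))%N%:Z - ((h == j) * (1 + l h))%N%:Z
   - (m h)%:Z.
have dE (h : 'I_t) : \sum_h' xL X h' *+ ((h' == h) * (1 + l h')) =
    xL X h *+ (1 + l h).
  rewrite (bigD1 h) //= eqxx mul1n big1 ?addr0 // => h' /negPf ->.
  by rewrite mul0n.
have [z [sz zE]] : exists z : 'I_t -> int,
    \sum_h z h = 0 /\ forall h, v h = (wt X h)%:Z * z h.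
  apply: sum_xL_eq0; under eq_bigr do rewrite !mulrzBr -!pmulrn.
  by rewrite !sumrB !dE -/(wdeg X m) -e subrr.
have zle h : z h <= - (h == j)%N%:Z.
  have := zE h; rewrite /v; have := ll h; have := wt_ge2 X h.
  case: (eqVneq h i) lim ij => [->|_] lim ij.
    by rewrite (negPf ij) /=; move: lim; nia.
  by case: (h == j) => /=; nia.
have : \sum_h z h <= \sum_h - (h == j)%N%:Z by apply: ler_sum.
rewrite sz sumrN sum_Posz (bigD1 j) //= eqxx; lia.
Qed.

Hypothesis max_le : (\sum_(i < t) (l i == wt X i - 1) + 3 <= t)%N.

(** Here (t - 2) c would have to be covered by the (l_i + 1) x_i with i different from j; only a
    maximal l_i yields a whole c, and there are at most t - 3 of them. *)
Lemma not_le_cover_omega j :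
  ~ leL 0 (xsum X l - xL X j *+ (1 + l j) - omegaL X).
Proof.
case/leL0P=> m; rewrite /omegaL => e.
pose v i : int := ((i != j) * (l i + 1))%N%:Z - (m i)%:Z.
have [z [sz zE]] : exists z : 'I_t -> int,
    \sum_i z i = (t - 2)%N%:Z /\ forall i, v i = (wt X i)%:Z * z i.
  apply: sum_xL_eq_cL; under eq_bigr do rewrite mulrzBr -!pmulrn.
  rewrite sumrB -/(wdeg X m) -e -pmulrn (bigD1 j) //= eqxx mulr0n add0r.
  under eq_bigr => i /negPf ij do rewrite ij mul1n mulrnDr.
  rewrite big_split /= (xsum_split j) (bigD1 (P := xpredT) j) //=.
  by zmod.
have zle i : z i <= (l i == wt X i - 1)%N%:Z.
  have := zE i; rewrite /v; have := ll i; have := wt_ge2 X i.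
  by case: (i != j); case: eqP => [->|] /=; nia.
have : \sum_i z i <= \sum_i (l i == wt X i - 1)%N%:Z by apply: ler_sum.
rewrite sz sum_Posz lez_nat => le_sum; have := leq_trans max_le (leqnn t).
by rewrite -(leq_add2r 3) in le_sum; move/(leq_trans le_sum); have := t_ge3 X; lia.
Qed.

Lemma exists2_nonmax : exists i j,
  [/\ i != j, l i != (wt X i - 1)%N & l j != (wt X j - 1)%N].
Proof.
have : (1 < #|[predC [pred i | l i == (wt X i - 1)%N]]|)%N.
  have cE : (\sum_(i < t) (l i == wt X i - 1) =
      #|[pred i | l i == (wt X i - 1)%N]|)%N.
    rewrite -sum1_card [RHS]big_mkcond /=; apply: eq_bigr => i _.
    by rewrite inE; case: eqP.
  have := cardC [pred i | l i == (wt X i - 1)%N].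
  rewrite card_ord.
  move: max_le; rewrite cE; move: #|_| #|_| => a b h e.
  by lia.
by case/card_gt1P => i [j [hi hj ij]]; exists i, j; split.
Qed.

End Degrees.
End GradingGroup.

(** * Normal forms in S *)

Section LinearExtension.
Variables (R : comNzRingType) (n : nat) (V : lmodType R) (g : 'X_{1..n} -> V).
Implicit Types p q : {mpoly R[n]}.

Definition linext p : V := \sum_(m <- msupp p) p@_m *: g m.

Lemma linext_wide p K : (msize p <= K)%N ->
  linext p = \sum_(m : 'X_{1..n < K}) p@_m *: g m.
Proof.
move=> pK; pose I : subFinType _ := 'X_{1..n < K}.
rewrite /linext (big_mksub I) ?msupp_uniq //=; last first.
  by move=> m /msize_mdeg_lt /leq_trans; apply.
by rewrite big_rmcond //= => m /memN_msupp_eq0 ->; rewrite scale0r.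
Qed.

Lemma linext_linear : linear linext.
Proof.
move=> a p q; pose K := (msize (a *: p + q) + (msize p + msize q))%N.
rewrite !(@linext_wide _ K) ?leq_addr //; first last.
- by rewrite /K addnCA leq_addr.
- by rewrite /K !addnA leq_addl.
rewrite scaler_sumr -big_split; apply: eq_bigr => m _ /=.
by rewrite mcoeffD mcoeffZ scalerDl scalerA.
Qed.
HB.instance Definition _ :=
  GRing.isLinear.Build R {mpoly R[n]} V _ linext linext_linear.

Lemma linextX m : linext 'X_[m] = g m.
Proof. by rewrite /linext msuppX big_seq1 mcoeffX eqxx scale1r. Qed.
End LinearExtension.

Section Support.
Variables (R : comNzRingType) (n : nat).
Implicit Types (P Q T : 'X_{1..n} -> Prop) (f g : {mpoly R[n]}).

Definition supp_in P f := forall m, m \in msupp f -> P m.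

Lemma supp_in0 P : supp_in P 0.
Proof. by move=> m; rewrite msupp0. Qed.

Lemma supp_inX P m : P m -> supp_in P 'X_[m].
Proof. by move=> Pm m'; rewrite msuppX inE => /eqP ->. Qed.

Lemma supp_inD P f g : supp_in P f -> supp_in P g -> supp_in P (f + g).
Proof. by move=> hf hg m /msuppD_le; rewrite mem_cat => /orP[/hf|/hg]. Qed.

Lemma supp_inZ P c f : supp_in P f -> supp_in P (c *: f).
Proof. by move=> hf m /msuppZ_le/hf. Qed.

Lemma supp_inM P Q T f g : (forall m m', P m -> Q m' -> T (m + m')%MM) ->
  supp_in P f -> supp_in Q g -> supp_in T (f * g).
Proof.
move=> PQT hf hg m /msuppM_le /allpairsP[[m1 m2] /= [/hf h1 /hg h2 ->]].
exact: PQT.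
Qed.
End Support.

Section CoordinateAlgebra.
Variables (k : closedFieldType) (t : nat) (X : wpl k t).
Implicit Types (i j : 'I_t) (m b : 'X_{1..t}) (d e : L X) (s r : S X).

Local Notation x1 := (idx1 X).
Local Notation x2 := (idx2 X).

Lemma piS_is_zmod_morphism : zmod_morphism (piS X).
Proof. by move=> f g; rewrite /piS raddfB. Qed.
Lemma piS_is_monoid_morphism : monoid_morphism (piS X).
Proof. by rewrite /piS; split=> [|f g]; rewrite ?rmorph1 ?rmorphM. Qed.
HB.instance Definition _ :=
  GRing.isZmodMorphism.Build {mpoly k[t]} (S X) (piS X) piS_is_zmod_morphism.
HB.instance Definition _ :=
  GRing.isMonoidMorphism.Build {mpoly k[t]} (S X) (piS X) piS_is_monoid_morphism.

Definition xS i : S X := piS X 'X_i.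
Definition kS (c : k) : S X := piS X c%:MP.
Definition mS m : S X := piS X 'X_[m].

Lemma piSZ c f : piS X (c *: f) = kS c * piS X f.
Proof. by rewrite -mul_mpolyC rmorphM. Qed.

Lemma kS0 : kS 0 = 0.
Proof. by rewrite /kS mpolyC0 raddf0. Qed.
Lemma kS1 : kS 1 = 1.
Proof. by rewrite /kS mpolyC1 rmorph1. Qed.
Lemma kSD c c' : kS (c + c') = kS c + kS c'.
Proof. by rewrite /kS mpolyCD rmorphD. Qed.
Lemma kSM c c' : kS (c * c') = kS c * kS c'.
Proof. by rewrite /kS mpolyCM rmorphM. Qed.

Lemma mSD m m' : mS (m + m')%MM = mS m * mS m'.
Proof. by rewrite /mS mpolyXD rmorphM. Qed.

Lemma mSXn i n : mS (U_(i) *+ n)%MM = xS i ^+ n.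
Proof. by rewrite /mS -mpolyXn rmorphXn. Qed.

Lemma homog_eq d e s : homogeneous d s -> d = e -> homogeneous e s.
Proof. by move=> ? <-. Qed.

Lemma homog_piS d f : supp_in (fun m => wdeg X m = d) f -> homogeneous d (piS X f).
Proof. by exists f. Qed.

Lemma homog_mS m : homogeneous (wdeg X m) (mS m).
Proof. by apply: homog_piS; apply: supp_inX. Qed.

Lemma homog_xS i : homogeneous (xL X i) (xS i).
Proof. by rewrite -wdeg1; apply: homog_mS. Qed.

Lemma homog_kS c : homogeneous 0 (kS c).
Proof.
exists c%:MP; split=> // m; rewrite msuppC; case: eqP => // _.
by rewrite inE => /eqP ->; apply: wdeg0.
Qed.

Lemma homog_sum d (I : Type) (r : seq I) (P : pred I) (F : I -> S X) :
  (forall a, P a -> homogeneous d (F a)) ->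
  homogeneous d (\sum_(a <- r | P a) F a).
Proof.
by move=> h; elim/big_ind: _ => [|p q|i Pi]; [exact: homog0|exact: homogD|exact: h].
Qed.

Lemma homog_ind d (P : S X -> Prop) : P 0 ->
  (forall s s', P s -> P s' -> P (s + s')) ->
  (forall c m, wdeg X m = d -> P (kS c * mS m)) ->
  forall s, homogeneous d s -> P s.
Proof.
move=> P0 PD Pm s [f [hf ->]]; rewrite (mpolyE f) raddf_sum big_seq /=.
elim/big_ind: _ => // m /hf dm; rewrite piSZ; exact: Pm.
Qed.

Lemma homog_not_le d s : ~ leL 0 d -> homogeneous d s -> s = 0.
Proof.
move=> hd; elim/homog_ind => [//|s1 s2 -> ->|c m dm]; first by rewrite addr0.
by case: hd; apply/leL0P; exists m.
Qed.

Lemma homog0_scalar s : homogeneous 0 s -> exists c, s = kS c.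
Proof.
elim/homog_ind=> [|s1 s2 [c1 ->] [c2 ->]|c m].
- by exists 0; rewrite kS0.
- by exists (c1 + c2); rewrite kSD.
- by move/wdeg_eq0 ->; exists c; rewrite /mS mpolyX0 rmorph1 mulr1.
Qed.

Definition lin_poly i : {mpoly k[t]} :=
  'X_x1 ^+ wt X x1 + lam X i *: 'X_x2 ^+ wt X x2.

Lemma rel_polyE i : rel_poly X i = 'X_i ^+ wt X i - lin_poly i.
Proof. by rewrite /rel_poly /lin_poly opprD addrA. Qed.

Lemma piS_lin_poly i :
  piS X (lin_poly i) = xS x1 ^+ wt X x1 + kS (lam X i) * xS x2 ^+ wt X x2.
Proof. by rewrite raddfD /= piSZ !rmorphXn. Qed.

Lemma xS_wt i : (2 <= i)%N ->
  xS i ^+ wt X i = xS x1 ^+ wt X x1 + kS (lam X i) * xS x2 ^+ wt X x2.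
Proof.
move=> i2; apply/eqP; rewrite -piS_lin_poly.
have -> : xS i ^+ wt X i = piS X ('X_i ^+ wt X i) by rewrite rmorphXn.
rewrite -subr_eq0 -raddfB -rel_polyE -(raddf0 (piS X)) -Quotient.idealrBE subr0.
apply/asboolP.
exists (fun j => (j == i)%:R); rewrite (bigD1 i) //= eqxx mul1r big1 ?addr0 //.
by move=> j /andP[_ /negPf ->]; rewrite mul0r.
Qed.

Definition red_mnm m : 'X_{1..t} :=
  [multinom if (2 <= i)%N then m i %% wt X i else m i | i < t].

Definition nf_mnm m : {mpoly k[t]} :=
  'X_[red_mnm m] * \prod_(i < t | (2 <= i)%N) lin_poly i ^+ (m i %/ wt X i).

(* The normal form modulo [relS]: S is free over k[x_1, x_2] on the monomials
   in x_3, ..., x_t with exponents less than the weights. *)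
Definition nf : {mpoly k[t]} -> {mpoly k[t]} := linext nf_mnm.
HB.instance Definition _ := GRing.Linear.on nf.

Definition reduced m := forall i, (2 <= i)%N -> (m i < wt X i)%N.

Lemma nf_mnm_wt m i : (2 <= i)%N ->
  nf_mnm (m + U_(i) *+ wt X i)%MM = nf_mnm m * lin_poly i.
Proof.
move=> i2; rewrite /nf_mnm; have -> : red_mnm (m + U_(i) *+ wt X i)%MM = red_mnm m.
  apply/mnmP => j; rewrite !mnmE mulmnE mnm1E.
  case: (eqVneq i j) => [<-|_]; last by rewrite mul0n addn0.
  by rewrite i2 mul1n modnDr.
rewrite -mulrA; congr (_ * _); rewrite (bigD1 i) //= [in RHS](bigD1 i) //=.
rewrite mnmDE mulmnE mnm1E eqxx mul1n divnDr ?dvdnn // divnn wt_gt0 addn1 exprSr.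
rewrite -!mulrA; congr (_ * _); rewrite mulrC; congr (_ * _).
apply: eq_bigr => j /andP[_ ji].
by rewrite mnmDE mulmnE mnm1E eq_sym (negPf ji) mul0n addn0.
Qed.

Lemma nf_mnm_free m i n : (i < 2)%N ->
  nf_mnm (m + U_(i) *+ n)%MM = nf_mnm m * 'X_i ^+ n.
Proof.
move=> i2; rewrite /nf_mnm mulrAC; congr (_ * _); last first.
  apply: eq_bigr => j j2; rewrite mnmDE mulmnE mnm1E.
  by case: (eqVneq i j) => [e|_]; [move: j2; rewrite -e; lia|rewrite mul0n addn0].
rewrite mpolyXn -mpolyXD; congr 'X_[_]; apply/mnmP => j; rewrite mnmDE !mnmE mulmnE mnm1E.
case: ifP => // j2; case: (eqVneq i j) => [e|_]; first by move: j2; rewrite -e; lia.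
by rewrite mul0n !addn0.
Qed.

Lemma nfX m : nf 'X_[m] = nf_mnm m.
Proof. exact: linextX. Qed.

(** Multiplying a monomial by x_i^(p_i) raises the quotient of its i-th exponent by one and keeps
    the remainder, so its normal form is multiplied by [lin_poly i]. Multiplication by powers of x_1
    and x_2 passes through the normal form, so the two halves of the relation cancel. *)
Lemma nf_rel i p : (2 <= i)%N -> nf (p * rel_poly X i) = 0.
Proof.
move=> i2; elim/mpolyind: p => [|c m p _ _ IHp]; first by rewrite mul0r linear0.
rewrite mulrDl linearD /= IHp addr0 -scalerAl linearZ /= rel_polyE mulrBr.
rewrite linearB /= mpolyXn -mpolyXD /= nfX nf_mnm_wt // /lin_poly !mulrDr -!scalerAr.
rewrite !mpolyXn -!mpolyXD [nf (_ + _)]linearD /= [nf (_ *: _)]linearZ /=.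
rewrite !nfX !nf_mnm_free // !mpolyXn.
by rewrite subrr scaler0.
Qed.

Lemma nf_piS0 p : piS X p = 0 -> nf p = 0.
Proof.
rewrite -(raddf0 (piS X)) => /eqP; rewrite -Quotient.idealrBE subr0.
move=> /asboolP[q ->]; rewrite linear_sum big1 // => i; exact: nf_rel.
Qed.

Lemma nf_piS p q : piS X p = piS X q -> nf p = nf q.
Proof.
move=> /eqP; rewrite -subr_eq0 -raddfB => /eqP/nf_piS0.
by rewrite linearB => /eqP; rewrite subr_eq0 => /eqP.
Qed.

Lemma nfM p i n : (i < 2)%N -> nf (p * 'X_i ^+ n) = nf p * 'X_i ^+ n.
Proof.
move=> i2; elim/mpolyind: p => [|c m p _ _ IHp]; first by rewrite mul0r linear0 mul0r.
rewrite mulrDl !linearD /= IHp mulrDl -scalerAl !linearZ /=; congr (_ + _).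
by rewrite mpolyXn -mpolyXD !nfX nf_mnm_free // scalerAl mpolyXn.
Qed.

Lemma nf_reduced p : supp_in reduced p -> nf p = p.
Proof.
move=> hp; rewrite {2}(mpolyE p) /nf /linext [LHS]big_seq [RHS]big_seq.
apply: eq_bigr => m /hp mr; congr (_ *: _); rewrite /nf_mnm big1 => [|i i2].
  rewrite mulr1; congr 'X_[_]; apply/mnmP => i; rewrite mnmE.
  by case: ifP => // i2; rewrite modn_small // mr.
by rewrite divn_small ?expr0 // mr.
Qed.

Definition in_x12 d m := wdeg X m = d /\ forall i, (2 <= i)%N -> m i = 0%N.

Lemma supp_lin_poly i : supp_in (in_x12 (cL X)) (lin_poly i).
Proof.
have h j : (j < 2)%N -> in_x12 (cL X) (U_(j) *+ wt X j)%MM.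
  move=> j2; split; first by rewrite wdegMn wdeg1 xL_wt.
  move=> i' i2; rewrite mulmnE mnm1E; case: (eqVneq j i') => [e|_]; last by rewrite mul0n.
  by move: i2; rewrite -e; lia.
apply: supp_inD; last apply: supp_inZ.
  by rewrite mpolyXn; apply: supp_inX; apply: h.
by rewrite mpolyXn; apply: supp_inX; apply: h.
Qed.

Lemma in_x12D d e m m' : in_x12 d m -> in_x12 e m' -> in_x12 (d + e) (m + m')%MM.
Proof.
move=> [dm hm] [em' hm']; split=> [|i i2]; first by rewrite wdegD dm em'.
by rewrite mnmDE hm // hm'.
Qed.

Lemma in_x12_0 : in_x12 0 0%MM.
Proof. by split=> [|i _]; rewrite ?wdeg0 // mnm0E. Qed.

Lemma supp_nf_mnm m :
  supp_in (fun m' => wdeg X m' = wdeg X m /\ reduced m') (nf_mnm m).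
Proof.
pose D := \sum_(i < t | (2 <= i)%N) cL X *+ (m i %/ wt X i).
have hD : supp_in (in_x12 D) (\prod_(i < t | (2 <= i)%N) lin_poly i ^+ (m i %/ wt X i)).
  rewrite /D; elim/big_rec2: _ => [|i p d _ hp].
    by rewrite -mpolyX0; apply: supp_inX; apply: in_x12_0.
  apply: supp_inM hp; first exact: in_x12D.
  elim: (m i %/ wt X i)%N => [|n IHn].
    by rewrite expr0 -mpolyX0; apply: supp_inX; apply: in_x12_0.
  by rewrite exprS mulrS; apply: supp_inM IHn; [exact: in_x12D|exact: supp_lin_poly].
apply: supp_inM hD; last by apply: (supp_inX (P := eq (red_mnm m))).
move=> _ m' <- [dm' hm']; split.
  rewrite wdegD dm' /D /wdeg [RHS](bigID (fun i : 'I_t => 2 <= i)%N) /=.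
  rewrite [X in X + _](bigID (fun i : 'I_t => 2 <= i)%N) /= addrAC -big_split /=.
  congr (_ + _); apply: eq_bigr => i hi; rewrite mnmE.
    by rewrite hi -(xL_wt X i) -mulrnA -mulrnDr {3}(divn_eq (m i) (wt X i)) addnC mulnC.
  by rewrite (negPf hi).
by move=> i i2; rewrite mnmDE hm' // addn0 mnmE i2 ltn_mod wt_gt0.
Qed.

Lemma supp_nf p d : supp_in (fun m => wdeg X m = d) p ->
  supp_in (fun m => wdeg X m = d /\ reduced m) (nf p).
Proof.
move=> hp; rewrite /nf /linext big_seq; elim/big_ind: _ => [|f g|m /hp <-].
- exact: supp_in0.
- exact: supp_inD.
- by apply: supp_inZ; apply: supp_nf_mnm.
Qed.

Lemma piS_nf p : piS X (nf p) = piS X p.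
Proof.
elim/mpolyind: p => [|c m p _ _ IHp]; first by rewrite linear0.
rewrite linearD !raddfD /= IHp linearZ /= !piSZ nfX; congr (_ * _ + _).
rewrite /nf_mnm rmorphM rmorph_prod /=.
have -> : 'X_[m] = 'X_[red_mnm m] * \prod_(i < t | (2 <= i)%N) ('X_i ^+ wt X i)
   ^+ (m i %/ wt X i) :> {mpoly k[t]}.
  rewrite !mpolyXE_id [LHS](bigID (fun i : 'I_t => 2 <= i)%N) /=.
  rewrite [X in _ = X * _](bigID (fun i : 'I_t => 2 <= i)%N) /= mulrAC -big_split /=.
  congr (_ * _); apply: eq_bigr => i hi; rewrite mnmE.
    by rewrite hi -exprM -exprD mulnC addnC -divn_eq.
  by rewrite (negPf hi).
rewrite rmorphM rmorph_prod; congr (_ * _); apply: eq_bigr => i i2.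
rewrite !rmorphXn /=; congr (_ ^+ _).
by rewrite piS_lin_poly -xS_wt.
Qed.

Lemma homog_nf d s : homogeneous d s -> exists f,
  [/\ s = piS X f, supp_in (fun m => wdeg X m = d /\ reduced m) f & nf f = f].
Proof.
case=> f [hf ->]; exists (nf f); split; first by rewrite piS_nf.
  exact: supp_nf.
by apply: nf_piS; rewrite piS_nf.
Qed.

Lemma xS_nf i n p : (i < 2)%N -> nf p = p ->
  nf (p * 'X_i ^+ n) = p * 'X_i ^+ n.
Proof. by move=> i2 e; rewrite nfM // e. Qed.

Lemma piS_MXn p i n : piS X (p * 'X_i ^+ n) = xS i ^+ n * piS X p.
Proof. by rewrite rmorphM rmorphXn mulrC. Qed.

Lemma mpoly_MXn_inj i n (p q : {mpoly k[t]}) :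
  p * 'X_i ^+ n = q * 'X_i ^+ n -> p = q.
Proof.
rewrite mpolyXn => e; apply/mpolyP => m.
by rewrite -(mcoeffMX p (U_(i) *+ n)%MM m) e mcoeffMX.
Qed.

Lemma mpoly_MXn_mcoeff i n (p : {mpoly k[t]}) m : (m i < n)%N ->
  (p * 'X_i ^+ n)@_m = 0.
Proof.
move=> mn; apply: memN_msupp_eq0; rewrite mpolyXn; apply/negP.
move/msuppM_le/allpairsP => -[[m1 m2] /= [_]]; rewrite msuppX inE => /eqP -> e.
by move: mn; rewrite e mnmDE mulmnE mnm1E eqxx mul1n; lia.
Qed.

(** Normal forms commute with multiplication by x_1 and x_2, so cancellation is inherited from the
    polynomial ring. *)
Lemma xS_regular d i n s : (i < 2)%N -> homogeneous d s ->
  xS i ^+ n * s = 0 -> s = 0.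
Proof.
move=> i2 /homog_nf[f [-> _ fE]]; rewrite -piS_MXn => /nf_piS0.
rewrite xS_nf // -[RHS](mul0r ('X_i ^+ n)) => /mpoly_MXn_inj ->.
by rewrite raddf0.
Qed.

(** Powers of x_1 and x_2 form a regular sequence: the hypothesis becomes an equality of polynomials
    between normal forms, and there x_1^n must divide every monomial of f. This will turn a pair of
    fractions that agree on D(x_1 x_2) into one element of S. *)
Lemma xS_regular_seq d e n n' s r : homogeneous d s -> homogeneous e r ->
  xS x2 ^+ n' * s = xS x1 ^+ n * r ->
  exists h, homogeneous (d - xL X x1 *+ n) h /\ s = xS x1 ^+ n * h.
Proof.
move=> /homog_nf[f [-> ff fE]] /homog_nf[g [-> _ gE]].
rewrite -!piS_MXn => /nf_piS; rewrite !xS_nf // => efg.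
have nle m : m \in msupp f -> (U_(x1) *+ n <= m)%MM.
  move=> mf; apply/mnm_lepP => i; rewrite mulmnE mnm1E.
  case: (eqVneq x1 i) => [<-|_]; last by rewrite mul0n.
  rewrite mul1n leqNgt; apply/negP => mn.
  move: mf; rewrite mcoeff_msupp -(mcoeffMX f (U_(x2) *+ n')%MM m) -mpolyXn efg.
  by rewrite mpoly_MXn_mcoeff ?eqxx // mnmDE mulmnE mnm1E /= mul0n add0n.
pose h := \sum_(m <- msupp f) f@_m *: 'X_[m - U_(x1) *+ n] : {mpoly k[t]}.
exists (piS X h); split.
  apply: homog_piS; rewrite /h big_seq; elim/big_ind: _ => [|p q|m mf].
  - exact: supp_in0.
  - exact: supp_inD.
  apply: supp_inZ; apply: supp_inX; have [<- _] := ff m mf.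
  by rewrite -{2}(submK (nle m mf)) wdegD wdegMn wdeg1; zmod.
rewrite -piS_MXn; congr piS; rewrite /h mulr_suml [LHS]mpolyE.
rewrite big_seq [RHS]big_seq; apply: eq_bigr => m mf.
by rewrite -scalerAl mpolyXn -mpolyXD submK // nle.
Qed.

Lemma mS_regular c m n i : (i < 2)%N -> reduced m ->
  xS i ^+ n * (kS c * mS m) = 0 -> c = 0.
Proof.
move=> i2 mr /(xS_regular i2 (homogM (homog_kS c) (homog_mS m))).
rewrite -piSZ => /nf_piS0; rewrite linearZ /= nf_reduced; last exact: supp_inX.
by move/(congr1 (mcoeff m)); rewrite mcoeffZ mcoeffX eqxx mulr1 mcoeff0.
Qed.

(** The degree e part of the ideal (x_1^n, x_2^n). For s in it, s / (x_1 x_2)^n = A / x_2^n + B /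
    x_1^n is a Cech coboundary. *)
Definition in_J n e s := exists A B, [/\ homogeneous (e - xL X x1 *+ n) A,
  homogeneous (e - xL X x2 *+ n) B & s = xS x1 ^+ n * A + xS x2 ^+ n * B].

Lemma in_J0 n e : in_J n e 0.
Proof. by exists 0, 0; split; rewrite ?mulr0 ?addr0 //; apply: homog0. Qed.

Lemma in_JD n e s r : in_J n e s -> in_J n e r -> in_J n e (s + r).
Proof.
move=> [A [B [hA hB ->]]] [A' [B' [hA' hB' ->]]]; exists (A + A'), (B + B').
by split; [exact: homogD|exact: homogD|rewrite !mulrDr addrACA].
Qed.

Lemma in_J_eq n d e s : in_J n d s -> d = e -> in_J n e s.
Proof. by move=> ? <-. Qed.

Lemma in_JM n d e s r : homogeneous d r -> in_J n e s -> in_J n (d + e) (r * s).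
Proof.
move=> hr [A [B [hA hB ->]]]; exists (r * A), (r * B); split.
- by apply: homog_eq (homogM hr hA) _; zmod.
- by apply: homog_eq (homogM hr hB) _; zmod.
- by ring.
Qed.

Lemma in_JZ n e c s : in_J n e s -> in_J n e (kS c * s).
Proof. by move=> hs; apply: in_J_eq (in_JM (homog_kS c) hs) _; rewrite add0r. Qed.

Lemma in_J_sum n e (I : Type) (r : seq I) (P : pred I) (F : I -> S X) :
  (forall a, P a -> in_J n e (F a)) -> in_J n e (\sum_(a <- r | P a) F a).
Proof. by move=> h; elim/big_ind: _ => //; [exact: in_J0|exact: in_JD]. Qed.

Lemma x12P i : (i < 2)%N -> i = x1 \/ i = x2.
Proof.
by case: i => -[|[|]] // hi _; [left|right]; apply: val_inj.
Qed.

Lemma in_J_x n i : (i < 2)%N -> in_J n (xL X i *+ n) (xS i ^+ n).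
Proof.
move=> i2; have [->|->] := x12P i2.
- exists 1, 0; rewrite mulr0 addr0 mulr1 subrr; split=> //; [exact: homog1|exact: homog0].
- exists 0, 1; rewrite mulr0 add0r mulr1 subrr; split=> //; [exact: homog0|exact: homog1].
Qed.

Lemma in_J_mS n m i : (i < 2)%N -> (n <= m i)%N -> in_J n (wdeg X m) (mS m).
Proof.
move=> i2 nm; have le : (U_(i) *+ n <= m)%MM.
  apply/mnm_lepP => j; rewrite mulmnE mnm1E.
  by case: (eqVneq i j) => [<-|_]; rewrite ?mul1n ?mul0n.
rewrite -(submK le) mSD wdegD mSXn wdegMn wdeg1.
by apply: in_JM; [exact: homog_mS|exact: in_J_x].
Qed.

End CoordinateAlgebra.

(** * The socle monomial *)

(** Computes the degree of a product from its factors; [hdeg] then compares it in L by [zmod]. A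
    hypothesis on a monomial takes precedence over [homog_mS], so that the socle monomial enters
    with its degree in closed form. *)
Ltac hdeg_aux := lazymatch goal with
  | H : homogeneous _ (mS ?X ?m) |- homogeneous _ (mS ?X ?m) => exact H
  | |- homogeneous _ (_ * _) => eapply homogM; hdeg_aux
  | |- homogeneous _ (_ ^+ _) => eapply homogX; hdeg_aux
  | |- homogeneous _ (- _) => eapply homogN; hdeg_aux
  | |- homogeneous _ (_ + _) =>
      eapply homogD; [hdeg_aux | eapply homog_eq; [hdeg_aux | zmod]]
  | |- homogeneous _ (xS _ _) => eapply homog_xS
  | |- homogeneous _ (kS _ _) => eapply homog_kS
  | |- homogeneous _ (mS _ _) => eapply homog_mS
  | |- homogeneous _ 1 => eapply homog1
  | |- homogeneous _ (sof _) => eapply so_homog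
  | H : homogeneous _ ?s |- homogeneous _ ?s => exact H
  end.
Ltac hdeg := eapply homog_eq; [hdeg_aux | zmod].

(** * The pencil spanned by x_1^(p_1) and x_2^(p_2) *)

Section Pencil.
Variables (k : closedFieldType) (t : nat) (X : wpl k t).
Implicit Types (i j : 'I_t) (m b : 'X_{1..t}) (d e : L X) (s r : S X).

Local Notation x1 := (idx1 X).
Local Notation x2 := (idx2 X).

(** Coordinates of x_i^(p_i) in the pencil. As points of the projective line the pairs are distinct,
    because the lambda_i are nonzero and pairwise different. *)
Definition pencil_coef i : k * k :=
  if i == x1 then (1, 0) else if i == x2 then (0, 1) else (1, lam X i).

Lemma xS_wt_pencil i : xS X i ^+ wt X i =
  kS X (pencil_coef i).1 * xS X x1 ^+ wt X x1
    + kS X (pencil_coef i).2 * xS X x2 ^+ wt X x2.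
Proof.
rewrite /pencil_coef; case: (eqVneq i x1) => [->|i1] /=.
  by rewrite kS1 kS0 mul1r mul0r addr0.
case: (eqVneq i x2) => [->|i2] /=; first by rewrite kS1 kS0 mul1r mul0r add0r.
rewrite kS1 mul1r xS_wt // ltnNge; apply/negP; rewrite -ltnS => /(x12P X)[/eqP|/eqP].
  by rewrite (negPf i1).
by rewrite (negPf i2).
Qed.

Lemma pencil_det i j : i != j ->
  (pencil_coef i).1 * (pencil_coef j).2 - (pencil_coef j).1 * (pencil_coef i).2 != 0.
Proof.
have x21 : (x2 == x1) = false by [].
have big h : h != x1 -> h != x2 -> (2 <= h)%N.
  move=> h1 h2; rewrite ltnNge; apply/negP; rewrite -ltnS => /(x12P X)[/eqP|/eqP].
    by rewrite (negPf h1).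
  by rewrite (negPf h2).
move=> ij; rewrite /pencil_coef.
case: (eqVneq i x1) ij => [->|i1] ij.
  rewrite eq_sym in ij; rewrite (negPf ij).
  case: (eqVneq j x2) => [_|j2] /=; first by rewrite mulr1 mulr0 subr0 oner_neq0.
  by rewrite mul1r mulr0 subr0 lam_neq0 // big.
case: (eqVneq i x2) ij => [->|i2] ij.
  case: (eqVneq j x1) ij => [_|j1] ij /=.
    by rewrite mul0r sub0r mulr1 oppr_eq0 oner_neq0.
  rewrite eq_sym in ij; rewrite (negPf ij) /=.
  by rewrite mul0r sub0r mulr1 oppr_eq0 oner_neq0.
case: (eqVneq j x1) ij => [_|j1] ij /=.
  by rewrite mulr0 sub0r mul1r oppr_eq0 lam_neq0 // big.
case: (eqVneq j x2) ij => [_|j2] ij /=; first by rewrite mul0r subr0 mulr1 oner_neq0.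
rewrite !mul1r subr_eq0; apply: contraNneq ij => e; apply/eqP/esym.
exact: (lam_inj (big _ j1 j2) (big _ i1 i2) e).
Qed.

Lemma pencil_span i j h : i != j -> exists a b : k,
  xS X h ^+ wt X h = kS X a * xS X i ^+ wt X i + kS X b * xS X j ^+ wt X j.
Proof.
move=> /pencil_det; rewrite (xS_wt_pencil h) (xS_wt_pencil i) (xS_wt_pencil j).
case: (pencil_coef i) (pencil_coef j) (pencil_coef h) => [a b] [c d] [u v] /= D.
(* Cramer's rule. *)
exists ((u * d - c * v) / (a * d - c * b)), ((a * v - u * b) / (a * d - c * b)).
set P := xS X x1 ^+ _; set Q := xS X x2 ^+ _.
rewrite !mulrDr !mulrA -!kSM addrACA -!mulrDl -!kSD.
by congr (kS X _ * _ + kS X _ * _); field.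
Qed.

Lemma in_J_Mn n e s q : in_J n e s -> in_J n e (s *+ q).
Proof.
move=> hs; elim: q => [|q IHq]; first by rewrite mulr0n; apply: in_J0.
by rewrite mulrS; apply: in_JD.
Qed.

(** In each term of the binomial expansion of exponent 2n, one of the two factors has exponent at
    least n. *)
Lemma in_J_expD n d s r : homogeneous d s -> homogeneous d r ->
  in_J n (d *+ n) (s ^+ n) -> in_J n (d *+ n) (r ^+ n) ->
  in_J n (d *+ (n + n)) ((s + r) ^+ (n + n)).
Proof.
move=> hs hr Js Jr; rewrite exprDn; apply: in_J_sum => -[q /= qn] _.
apply: in_J_Mn; case: (leqP n q) => nq.
  rewrite -[X in r ^+ X](subnK nq) exprD mulrA.
  by apply: in_J_eq (in_JM (d := d *+ (n + n - q + (q - n))) _ Jr) _;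
    [hdeg | rewrite -mulrnDr; congr (_ *+ _); lia].
have nq' : (n <= n + n - q)%N by lia.
rewrite -[X in s ^+ X](subnK nq') exprD mulrAC.
by apply: in_J_eq (in_JM (d := d *+ (n + n - q - n + q)) _ Js) _;
  [hdeg | rewrite -mulrnDr; congr (_ *+ _); lia].
Qed.

Lemma in_J_xwt n i :
  in_J n (xL X i *+ (wt X i * (n + n))) (xS X i ^+ (wt X i * (n + n))).
Proof.
rewrite mulrnA xL_wt exprM xS_wt_pencil.
have h c j : (j < 2)%N -> in_J n (cL X *+ n) ((kS X c * xS X j ^+ wt X j) ^+ n).
  move=> j2; rewrite -(xL_wt X j) -!mulrnA exprMn -!exprM mulnC.
  have w1 : (n <= n * wt X j)%N by rewrite leq_pmulr // wt_gt0.
  rewrite -{2}(subnK w1) exprD mulrA.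
  apply: in_J_eq (in_JM (d := xL X j *+ (n * wt X j - n)) _ (in_J_x _ n j2)) _.
    by hdeg.
  by rewrite -mulrnDr subnK.
apply: in_J_expD; [| |exact: h|exact: h].
  by rewrite -(xL_wt X x1); hdeg.
by rewrite -(xL_wt X x2); hdeg.
Qed.

(** D(x_1) and D(x_2) cover Proj S: every variable has a power in (x_1^n, x_2^n) by the pencil
    relations, and every monomial of a high power of s contains one of these powers. *)
Lemma in_J_radical n d s : d <> 0 -> homogeneous d s ->
  exists N, in_J n (d *+ N) (s ^+ N).
Proof.
move=> d0 [f [hf ->]]; pose M i := (wt X i * (n + n))%N.
(* Pigeonhole: as d is nonzero, no monomial of f is constant, so those of f^N have total exponent at
   least N, and some exponent reaches [M i]. *)
pose N := (\sum_i M i).+1; exists N.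
have : supp_in (fun m => wdeg X m = d *+ N /\ (N <= mdeg m)%N) (f ^+ N).
  elim: N => [|q IHq]; first by rewrite expr0 -mpolyX0; apply: supp_inX; rewrite wdeg0.
  rewrite exprS; apply: supp_inM hf IHq => m m' dm [dm' qm'].
  rewrite wdegD dm dm' mulrS mdegD; split=> //; rewrite -add1n leq_add //.
  by rewrite lt0n mdeg_eq0; apply: contra_notN d0 => /eqP m0; rewrite -dm m0 wdeg0.
rewrite -rmorphXn; move: (f ^+ N) => g hg.
rewrite (mpolyE g) raddf_sum big_seq /=; apply: in_J_sum => m /hg[dm Nm].
rewrite piSZ; apply: in_JZ; rewrite -/(mS X m).
have [i Mi] : exists i, (M i <= m i)%N.
  apply/existsP; rewrite -[X in is_true X]negbK negb_exists; apply/negP => /forallP h.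
  move: Nm; rewrite mdegE /N ltnNge; apply/negP; rewrite negbK.
  by apply: leq_sum => i _; have := h i; rewrite -ltnNge => /ltnW.
have le : (U_(i) *+ M i <= m)%MM.
  apply/mnm_lepP => j; rewrite mulmnE mnm1E.
  by case: (eqVneq i j) => [<-|_]; rewrite ?mul1n ?mul0n.
rewrite -dm -(submK le) mSD wdegD mSXn wdegMn wdeg1.
by apply: in_JM; [exact: homog_mS|exact: in_J_xwt].
Qed.
End Pencil.

(** * The socle class and multiplication on it *)

Section Socle.
Variables (k : closedFieldType) (t : nat) (X : wpl k t) (l : 'I_t -> nat).
Hypothesis ll : forall i, (l i <= wt X i - 1)%N.
Implicit Types (i j : 'I_t) (m b : 'X_{1..t}) (d e : L X) (s r : S X).

Local Notation x1 := (idx1 X).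
Local Notation x2 := (idx2 X).
Local Notation x12 := (xL X x1 + xL X x2).

(* [x ^ socle_mnm n / (x_1 x_2)^n] spans H^1(O(omega - x)) as Cech cohomology
   for the covering by D(x_1) and D(x_2). *)
Definition socle_mnm n : 'X_{1..t} :=
  [multinom (if (i < 2)%N then n else wt X i) - (1 + l i) | i < t].

Definition socle_deg n : L X := omegaL X - xsum X l + x12 *+ n.

Lemma sum_x12 (V : nmodType) (F : 'I_t -> V) :
  \sum_i F i = F x1 + F x2 + \sum_(i < t | (2 <= i)%N) F i.
Proof.
rewrite (bigD1 x1) //= (bigD1 x2) //= addrA; congr (_ + _); apply: eq_bigl => i.
by case: i => -[|[|i]] hi.
Qed.

Lemma l_lt_x12 n i : (wt X x1 <= n)%N -> (wt X x2 <= n)%N -> (i < 2)%N ->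
  (l i < n)%N.
Proof.
move=> w1n w2n /(x12P X) [->|->]; have := ll x1; have := ll x2;
by have := wt_gt0 X x1; have := wt_gt0 X x2; lia.
Qed.

(** Adding the sum of the (1 + l_i) x_i turns the exponents of x_1 and x_2 into n and every other
    one into p_i, which contributes t - 2 copies of c. *)
Lemma wdeg_socle n : (l x1 < n)%N -> (l x2 < n)%N ->
  wdeg X (socle_mnm n) = socle_deg n.
Proof.
move=> n1 n2; have card_ge2 : (\sum_(i < t | 2 <= i) 1 = t - 2)%N.
  have e : (2 + \sum_(i < t | 2 <= i) 1 = t)%N.
    by rewrite -[RHS]card_ord -sum1_card [RHS](sum_x12 (V := nat)).
  by rewrite -[X in _ = (X - 2)%N]e addKn.
apply: (addIr (xsum X l + \sum_i xL X i)); rewrite -!big_split /=.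
rewrite (eq_bigr (fun i => if (i < 2)%N then xL X i *+ n else cL X)); last first.
  move=> i _; rewrite -[xL X i in X in _ + (_ + X)]mulr1n -!mulrnDr mnmE.
  case: ifP => i2; last rewrite -(xL_wt X i); congr (_ *+ _).
    by case: (x12P X i2) => ->; lia.
  by have := ll i; have := wt_gt0 X i; lia.
rewrite sum_x12 /= (eq_bigr (fun=> cL X *+ 1)) => [|i i2]; last by rewrite (ltnNge i 2) i2.
rewrite sumrMnr card_ge2 /socle_deg big_split /= -omegaLE -/(xsum X l).
by zmod.
Qed.

Lemma socle_homog n : (wt X x1 <= n)%N -> (wt X x2 <= n)%N ->
  homogeneous (omegaL X - xsum X l + x12 *+ n) (mS X (socle_mnm n)).
Proof.
move=> w1n w2n; rewrite -/(socle_deg n) -wdeg_socle; first exact: homog_mS.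
  exact: l_lt_x12.
exact: l_lt_x12.
Qed.

(** A reduced monomial of this degree can differ from the socle monomial only in the exponents of
    x_1 and x_2, since the others lie below the weights. A difference there raises one exponent by
    at least p_i >= 1 + l_i, hence to at least n. *)
Lemma socle_decomp n s : (wt X x1 <= n)%N -> (wt X x2 <= n)%N ->
  homogeneous (socle_deg n) s ->
  exists c, in_J n (socle_deg n) (s - kS X c * mS X (socle_mnm n)).
Proof.
move=> w1n w2n; have ln i : (i < 2)%N -> (l i < n)%N by exact: l_lt_x12.
have dM := wdeg_socle (ln x1 isT) (ln x2 isT).
case/homog_nf=> f [-> hf _]; rewrite (mpolyE f) raddf_sum big_seq /=.
elim/big_ind: _ => [|s1 s2 [c1 h1] [c2 h2]|m mf].
- by exists 0; rewrite kS0 mul0r subr0; apply: in_J0.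
- by exists (c1 + c2); rewrite kSD mulrDl opprD addrACA; apply: in_JD.
have [dm mr] := hf m mf; rewrite piSZ -/(mS X m) -dm.
have inJ i : (i < 2)%N -> (n <= m i)%N ->
    exists c, in_J n (wdeg X m) (kS X f@_m * mS X m - kS X c * mS X (socle_mnm n)).
  move=> i2 ni; exists 0; rewrite kS0 mul0r subr0; apply: in_JZ.
  exact: (in_J_mS X i2 ni).
have [z [sz zE]] : exists z : 'I_t -> int, \sum_i z i = 0 /\
    forall i, (m i)%:Z - (socle_mnm n i)%:Z = (wt X i)%:Z * z i.
  by apply: wdeg_eqP; rewrite dM.
have z0 i : (2 <= i)%N -> z i = 0.
  move=> i2; have := zE i; have := mr i i2; rewrite mnmE (ltnNge i 2) i2 /=.
  by have := ll i; have := wt_ge2 X i; nia.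
move: sz; rewrite (sum_x12 (V := int)) big1 ?addr0 // => sz.
have := zE x1; have := zE x2; rewrite !mnmE /=.
have := ln x1 isT; have := ln x2 isT; have := wt_gt0 X x1; have := wt_gt0 X x2.
have [z1|[z1|z1]] : z x1 = 0 \/ (z x1 >= 1) \/ (z x1 <= -1) by lia.
- have z2 : z x2 = 0 by move: sz; rewrite z1 add0r.
  move=> _ _ _ _ e2 e1; exists f@_m.
  suff -> : m = socle_mnm n by rewrite subrr; apply: in_J0.
  apply/mnmP => i; case: (leqP 2 i) => i2.
    by have := zE i; rewrite z0 // mulr0 => /eqP; rewrite subr_eq0 => /eqP[].
  case: (x12P X i2) => ->; rewrite mnmE /=.
    by move: e1; rewrite z1 mulr0 => /eqP; rewrite subr_eq0 => /eqP[].
  by move: e2; rewrite z2 mulr0 => /eqP; rewrite subr_eq0 => /eqP[].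
- move=> ? ? ? ? e2 e1; apply: (inJ x1) => //.
  by have := ll x1; nia.
- move=> ? ? ? ? e2 e1; apply: (inJ x2) => //.
  have : z x2 >= 1 by lia.
  by have := ll x2; nia.
Qed.

(** For j <= 2 the exponent of x_j reaches n. For j >= 3 it reaches p_j, and the relation trades
    x_j^(p_j) for x_1^(p_1) and x_2^(p_2), each of which lifts an exponent n - 1 - l_i to at least
    n. *)
Lemma socle_kill n j : (wt X x1 <= n)%N -> (wt X x2 <= n)%N ->
  in_J n (xL X j *+ (1 + l j) + socle_deg n)
    (xS X j ^+ (1 + l j) * mS X (socle_mnm n)).
Proof.
move=> w1n w2n; have ln i : (i < 2)%N -> (l i < n)%N by exact: l_lt_x12.
rewrite -(wdeg_socle (ln x1 isT) (ln x2 isT)).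
rewrite -mSXn -mSD -(wdeg1 X j) -wdegMn -wdegD.
set m := (_ + _)%MM.
have mj : m j = if (j < 2)%N then n else wt X j.
  rewrite /m mnmDE mulmnE mnm1E eqxx mul1n mnmE; case: ifP => j2.
    by rewrite subnKC //; have := ln j j2; lia.
  by have := ll j; have := wt_gt0 X j; lia.
case: (ltnP j 2) mj => j2 mj; first by apply: (in_J_mS X j2); rewrite mj.
have le : (U_(j) *+ wt X j <= m)%MM.
  apply/mnm_lepP => i; rewrite mulmnE mnm1E.
  by case: (eqVneq j i) => [<-|_]; rewrite ?mul1n ?mul0n // mj.
rewrite -(submK le) mSD wdegD mSXn wdegMn wdeg1 xL_wt xS_wt // mulrDr.
set m' := (m - _)%MM.
have m'i i : (i < 2)%N -> (n <= m' i + wt X i)%N.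
  move=> i2; rewrite /m' /m mnmBE mnmDE !mulmnE !mnm1E mnmE i2.
  have -> /= : (j == i) = false by apply: contraTF j2 => /eqP ->; rewrite -ltnNge.
  by have := ll i; have := wt_gt0 X i; lia.
have inJ i : (i < 2)%N -> in_J n (wdeg X m' + cL X) (mS X m' * xS X i ^+ wt X i).
  move=> i2; rewrite -(xL_wt X i) -(wdeg1 X i) -wdegMn -wdegD -mSXn -mSD.
  by apply: (in_J_mS X i2); rewrite mnmDE mulmnE mnm1E eqxx mul1n; apply: m'i.
by apply: in_JD; [exact: inJ|rewrite mulrCA; apply: in_JZ; exact: inJ].
Qed.

(** Multiplying by the complementary divisor of x^l reduces to b = l. The product then has exponents
    n + N - 1 at x_1 and x_2 and p_i - 1 elsewhere, so it is its own normal form and lies outside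
    the ideal. The power N allows for a larger common denominator in a Cech computation. *)
Lemma socle_notin n N e c b : (wt X x1 <= n)%N -> (wt X x2 <= n)%N ->
  (forall i, (b i <= l i)%N) ->
  in_J (n + N) e
    ((xS X x1 * xS X x2) ^+ N * (kS X c * (mS X b * mS X (socle_mnm n)))) ->
  c = 0.
Proof.
move=> w1n w2n bl; have ln i : (i < 2)%N -> (l i < n)%N by exact: l_lt_x12.
pose lm : 'X_{1..t} := [multinom l i | i < t].
have ble : (b <= lm)%MM by apply/mnm_lepP => i; rewrite mnmE.
move=> /(in_JM (homog_mS X (lm - b)%MM)).
pose U := ((lm + socle_mnm n) + (U_(x1) *+ N + U_(x2) *+ N))%MM.
have -> : mS X (lm - b) * ((xS X x1 * xS X x2) ^+ N *
    (kS X c * (mS X b * mS X (socle_mnm n)))) = kS X c * mS X U.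
  by rewrite /U !mSD -{2}(submK ble) !mSD !mSXn exprMn; ring.
have Ured : reduced X U.
  move=> i i2; rewrite !mnmDE !mulmnE !mnm1E !mnmE (ltnNge i 2) i2 /=.
  have -> : (x1 == i) = false by apply: contraTF i2 => /eqP <-.
  have -> : (x2 == i) = false by apply: contraTF i2 => /eqP <-.
  by have := ll i; have := wt_gt0 X i; lia.
have Ui i : (i < 2)%N -> (U i < n + N)%N.
  move=> i2; rewrite !mnmDE !mulmnE !mnm1E !mnmE i2.
  by have := ln i i2; case: (x12P X i2) => -> /=; lia.
move=> [A [B [[a [_ ->]] [b' [_ ->]]]]].
rewrite -!piS_MXn -raddfD -piSZ => /nf_piS; rewrite [nf _ (_ + _)]linearD /=.
rewrite !nfM // linearZ /= nf_reduced; last exact: supp_inX.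
move/(congr1 (mcoeff U)); rewrite mcoeffD mcoeffZ mcoeffX eqxx mulr1.
by rewrite !mpoly_MXn_mcoeff ?addr0 ?Ui.
Qed.

Hypothesis max_le : (\sum_(i < t) (l i == wt X i - 1) + 3 <= t)%N.

Lemma wdeg_small_inj b b' : (forall i, (b i <= l i)%N) ->
  (forall i, (b' i <= l i)%N) -> wdeg X b = wdeg X b' -> b = b'.
Proof.
move=> bl b'l /wdeg_eqP[z [_ zE]]; apply/mnmP => i.
have := zE i; have := bl i; have := b'l i; have := ll i; have := wt_gt0 X i.
have [->|[z1|z1]] : z i = 0 \/ (z i >= 1) \/ (z i <= -1) by lia.
- by lia.
- by nia.
- by nia.
Qed.

(** A monomial that does not divide x^l has some exponent m_j > l_j. If l_j < p_j - 1, it is a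
    multiple of a wanted generator; if l_j = p_j - 1, it contains x_j^(p_j), which the pencil
    expresses through two non-maximal indices. Divisors of x^l are determined by their degree, so a
    single one remains; the alternative c = 0 covers degrees in which there is none. *)
Lemma homog_mod_ideal d s : homogeneous d s ->
  exists (c : k) (b : 'X_{1..t}) (g : 'I_t -> S X),
  [/\ forall j, homogeneous (d - xL X j *+ (1 + l j)) (g j),
      forall j, l j = (wt X j - 1)%N -> g j = 0,
      s = kS X c * mS X b + \sum_j xS X j ^+ (1 + l j) * g j
    & c = 0 \/ (forall i, (b i <= l i)%N) /\ wdeg X b = d].
Proof.
elim/homog_ind=> [|s1 s2 [c1 [b1 [g1 [hg1 zg1 -> h1]]]]
    [c2 [b2 [g2 [hg2 zg2 -> h2]]]]|c m dm].
- exists 0, 0%MM, (fun=> 0); split=> //; last by left.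
    by move=> j; apply: homog0.
  by rewrite kS0 mul0r big1 ?addr0 // => j _; rewrite mulr0.
- have hg j : homogeneous (d - xL X j *+ (1 + l j)) (g1 j + g2 j) by exact: homogD.
  have zg j : l j = (wt X j - 1)%N -> g1 j + g2 j = 0.
    by move=> lj; rewrite zg1 // zg2 // addr0.
  case: h1 => [->|[bl1 db1]].
    exists c2, b2, (fun j => g1 j + g2 j); split=> //.
    rewrite kS0 mul0r add0r addrCA -big_split; congr (_ + _).
    by apply: eq_bigr => j _; rewrite mulrDr.
  case: h2 => [->|[bl2 db2]].
    exists c1, b1, (fun j => g1 j + g2 j); split=> //; last by right.
    rewrite kS0 mul0r add0r -addrA -big_split; congr (_ + _).
    by apply: eq_bigr => j _; rewrite mulrDr.
  exists (c1 + c2), b1, (fun j => g1 j + g2 j); split=> //; last by right.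
  rewrite -(wdeg_small_inj bl1 bl2) ?db1 // kSD mulrDl addrACA -big_split.
  by congr (_ + _); apply: eq_bigr => j _; rewrite mulrDr.
case: (pselect (forall i, (m i <= l i)%N)) => [ml|/existsNP[j /negP]].
  exists c, m, (fun=> 0); split=> //; last by right.
    by move=> j; apply: homog0.
  by rewrite big1 ?addr0 // => j _; rewrite mulr0.
rewrite -ltnNge => lmj.
have leU n : (n <= m j)%N -> (U_(j) *+ n <= m)%MM.
  move=> nm; apply/mnm_lepP => i; rewrite mulmnE mnm1E.
  by case: (eqVneq j i) => [<-|_]; rewrite ?mul1n ?mul0n.
case: (eqVneq (l j) (wt X j - 1)%N) => lj; last first.
  exists 0, 0%MM, (fun i => if i == j then kS X c * mS X (m - U_(j) *+ (1 + l j))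
    else 0); split; last by left.
  - move=> i; case: eqP => [->|_]; last exact: homog0.
    by rewrite -dm -{1}(submK (leU _ lmj)) wdegD wdegMn wdeg1; hdeg.
  - by move=> i; case: eqP => // -> /eqP; rewrite (negPf lj).
  rewrite kS0 mul0r add0r (bigD1 j) //= eqxx big1 ?addr0 => [|i /negPf ->].
    by rewrite -{1}(submK (leU _ lmj)) mSD mSXn; ring.
  by rewrite mulr0.
(* The maximal case: x_j^(p_j) is rewritten in x_i^(p_i) and x_i'^(p_i'), both multiples of
   generators that occur in the sum. *)
have [i [i' [ii' li li']]] := exists2_nonmax max_le.
have [u [v uv]] := pencil_span X j ii'.
have wj : (wt X j <= m j)%N by have := wt_gt0 X j; lia.
pose m' := (m - U_(j) *+ wt X j)%MM.
have wlt h : l h != (wt X h - 1)%N -> (wt X h = (1 + l h) + (wt X h - 1 - l h))%N.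
  by have := ll h; have := wt_gt0 X h; lia.
exists 0, 0%MM, (fun h =>
  if h == i then kS X (c * u) * mS X m' * xS X i ^+ (wt X i - 1 - l i)
  else if h == i' then kS X (c * v) * mS X m' * xS X i' ^+ (wt X i' - 1 - l i')
  else 0).
have dm' : d = wdeg X m' + cL X.
  by rewrite -dm -{1}(submK (leU _ wj)) wdegD wdegMn wdeg1 xL_wt.
have hdeg' h a : l h != (wt X h - 1)%N ->
   homogeneous (d - xL X h *+ (1 + l h))
     (kS X (c * a) * mS X m' * xS X h ^+ (wt X h - 1 - l h)).
  by move=> lh; rewrite dm' -(xL_wt X h) {1}(wlt h lh); hdeg.
split; last by left.
- move=> h; case: (eqVneq h i) => [->|_]; first exact: hdeg'.
  case: (eqVneq h i') => [->|_]; first exact: hdeg'.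
  exact: homog0.
- move=> h; case: (eqVneq h i) => [->|_] => [/eqP|]; first by rewrite (negPf li).
  by case: (eqVneq h i') => [->|_] // /eqP; rewrite (negPf li').
rewrite kS0 mul0r add0r (bigD1 i) //= eqxx (bigD1 i') /=; last by rewrite eq_sym.
rewrite eqxx [i' == i]eq_sym (negPf ii') big1 => [|h /andP[/negPf -> /negPf ->]].
  rewrite addr0 -(submK (leU _ wj)) mSD mSXn uv -/m'.
  have -> : xS X i ^+ wt X i = xS X i ^+ (1 + l i) * xS X i ^+ (wt X i - 1 - l i).
    by rewrite {1}(wlt i li) exprD.
  have -> : xS X i' ^+ wt X i' =
      xS X i' ^+ (1 + l i') * xS X i' ^+ (wt X i' - 1 - l i').
    by rewrite {1}(wlt i' li') exprD.
  by rewrite !kSM; ring.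
by rewrite mulr0.
Qed.
End Socle.

(** * Graded modules, sheaves and frames *)

Section GradedModules.
Variables (k : closedFieldType) (t : nat) (X : wpl k t).
Implicit Types (a b c d : L X) (s r : S X) (f g h : sopen X) (n : nat).

Section Gmod.
Variables (M N : gmod X) (u : ghom M N).

Lemma gact0r a b s : homogeneous (b - a) s -> gact b s (0 : M a) = 0.
Proof. by move=> hs; apply: (addrI (gact b s (0 : M a))); rewrite -gactDr // !addr0. Qed.

Lemma gactNr a b s (m : M a) : homogeneous (b - a) s -> gact b s (- m) = - gact b s m.
Proof.
by move=> hs; apply: (addrI (gact b s m)); rewrite -gactDr // !subrr gact0r.
Qed.

Lemma gactBr a b s (m m' : M a) : homogeneous (b - a) s ->
  gact b s (m - m') = gact b s m - gact b s m'.
Proof. by move=> hs; rewrite gactDr // gactNr. Qed.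

Lemma gact0l a b (m : M a) : gact b 0 m = 0.
Proof.
have h0 : homogeneous (b - a) (0 : S X) := homog0 _.
by apply: (addrI (gact b 0 m)); rewrite -gactDl // !addr0.
Qed.

Lemma gactNl a b s (m : M a) : homogeneous (b - a) s -> gact b (- s) m = - gact b s m.
Proof.
move=> hs; have hN := homogN hs.
by apply: (addrI (gact b s m)); rewrite -gactDl // !subrr gact0l.
Qed.

Lemma gactBl a b s r (m : M a) : homogeneous (b - a) s -> homogeneous (b - a) r ->
  gact b (s - r) m = gact b s m - gact b r m.
Proof. by move=> hs hr; have hN := homogN hr; rewrite gactDl // gactNl. Qed.

Lemma gact_sumr a b s (I : Type) (z : seq I) (F : I -> M a) :
  homogeneous (b - a) s -> gact b s (\sum_(i <- z) F i) = \sum_(i <- z) gact b s (F i).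
Proof.
move=> hs; elim: z => [|i z IHz]; first by rewrite !big_nil gact0r.
by rewrite !big_cons gactDr // IHz.
Qed.

Lemma gact_suml a b (I : Type) (z : seq I) (F : I -> S X) (m : M a) :
  (forall i, homogeneous (b - a) (F i)) ->
  gact b (\sum_(i <- z) F i) m = \sum_(i <- z) gact b (F i) m.
Proof.
move=> hF; elim: z => [|i z IHz]; first by rewrite !big_nil gact0l.
by rewrite !big_cons gactDl ?IHz //; apply: homog_sum.
Qed.

Lemma gfun0 a : u a 0 = 0.
Proof. by apply: (addrI (u a 0)); rewrite -gfunD !addr0. Qed.

Lemma gfunN a (m : M a) : u a (- m) = - u a m.
Proof. by apply: (addrI (u a m)); rewrite -gfunD !subrr gfun0. Qed.

Lemma gfunB a (m m' : M a) : u a (m - m') = u a m - u a m'.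
Proof. by rewrite gfunD gfunN. Qed.

Lemma gfun_sum a (I : Type) (z : seq I) (F : I -> M a) :
  u a (\sum_(i <- z) F i) = \sum_(i <- z) u a (F i).
Proof.
elim: z => [|i z IHz]; first by rewrite !big_nil gfun0.
by rewrite !big_cons gfunD IHz.
Qed.
End Gmod.

Section Qcoh.
Variable F : qcoh X.

Lemma res0 f g a : sub_open g f -> res g (0 : F f a) = 0.
Proof. by move=> gf; apply: (addrI (res g (0 : F f a))); rewrite -resD // !addr0. Qed.

Lemma resN f g a (m : F f a) : sub_open g f -> res g (- m) = - res g m.
Proof.
by move=> gf; apply: (addrI (res g m)); rewrite -resD // !subrr res0.
Qed.

Lemma resB f g a (m m' : F f a) : sub_open g f -> res g (m - m') = res g m - res g m'.
Proof. by move=> gf; rewrite resD // resN. Qed.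

Lemma res_sum f g a (I : Type) (z : seq I) (m : I -> F f a) : sub_open g f ->
  res g (\sum_(i <- z) m i) = \sum_(i <- z) res g (m i).
Proof.
move=> gf; elim: z => [|i z IHz]; first by rewrite !big_nil res0.
by rewrite !big_cons resD // IHz.
Qed.

Lemma act_pow_inj f n a b (m m' : F f a) : b = a + sodeg f *+ n ->
  gact b ((f : S X) ^+ n) m = gact b ((f : S X) ^+ n) m' -> m = m'.
Proof.
elim: n b => [|n IHn] b e.
  have {e} -> : b = a by rewrite e addr0.
  by rewrite expr0 !gact1.
pose b' := a + sodeg f *+ n; have {e} -> : b = b' + sodeg f by rewrite e /b'; zmod.
have hn : homogeneous (b' - a) ((f : S X) ^+ n) by rewrite /b'; hdeg.
have hf : homogeneous (b' + sodeg f - b') (f : S X) by hdeg.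
rewrite exprS -!(@gactA _ _ _ _ a b') //; move/so_act_inj; exact: IHn.
Qed.

Lemma act_pow_surj f n a b (m : F f b) : b = a + sodeg f *+ n ->
  exists m' : F f a, gact b ((f : S X) ^+ n) m' = m.
Proof.
elim: n b m => [|n IHn] b m e.
  have {}e : b = a by rewrite e addr0.
  by subst b; exists m; rewrite expr0 gact1.
pose b' := a + sodeg f *+ n; have {}e : b = b' + sodeg f by rewrite e /b'; zmod.
subst b; have [m1 <-] := so_act_surj m; have [m2 <-] := IHn b' m1 erefl.
exists m2; rewrite gactA -?exprS //; first by rewrite /b'; hdeg.
by hdeg.
Qed.

Lemma act_pow_eq0 f n a b (m : F f a) : b = a + sodeg f *+ n ->
  gact b ((f : S X) ^+ n) m = 0 -> m = 0.
Proof.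
move=> e e0; apply: (act_pow_inj e); rewrite e0 gact0r // e; hdeg.
Qed.

Definition compat a (m : forall f, F f a) :=
  forall f g, sub_open g f -> res g (m f) = m g.
End Qcoh.

(* Every morphism below is obtained from its graph: the value is only known
   after multiplication by a power of the equation of the open set. *)
Lemma qhom_of_graph (F G : qcoh X) (R : forall f a, F f a -> G f a -> Prop) :
  (forall f a m, exists m', R f a m m') ->
  (forall f a m1 m1' m2 m2', R f a m1 m1' -> R f a m2 m2' ->
    R f a (m1 - m2) (m1' - m2')) ->
  (forall f a m', R f a 0 m' -> m' = 0) ->
  (forall f a b s m m', homogeneous (b - a) s -> R f a m m' ->
    R f b (gact b s m) (gact b s m')) ->
  (forall f g a m m', sub_open g f -> R f a m m' -> R g a (res g m) (res g m')) ->
  exists u : qhom F G, forall f a m, R f a m (u f a m).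
Proof.
move=> tot RB R0 Ract Rres.
pose u f a (m : F f a) := sval (cid (tot f a m)).
have uP f a m : R f a m (u f a m) by rewrite /u; case: cid.
have Rfun f a m m1 m2 : R f a m m1 -> R f a m m2 -> m1 = m2.
  move=> h1 h2; apply/eqP; rewrite -subr_eq0; apply/eqP; apply: R0.
  by have := RB _ _ _ _ _ _ h1 h2; rewrite subrr.
have R00 f a : R f a 0 0.
  by have := RB _ _ _ _ _ _ (uP f a 0) (uP f a 0); rewrite !subrr.
have RD f a m1 m1' m2 m2' : R f a m1 m1' -> R f a m2 m2' ->
    R f a (m1 + m2) (m1' + m2').
  move=> h1 h2; have := RB _ _ _ _ _ _ h1 (RB _ _ _ _ _ _ (R00 f a) h2).
  by rewrite !sub0r !opprK.
have uD f a m m' : u f a (m + m') = u f a m + u f a m'.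
  by apply: (Rfun _ _ (m + m')); [exact: uP|apply: RD; exact: uP].
have uact f a b s m : homogeneous (b - a) s -> u f b (gact b s m) = gact b s (u f a m).
  by move=> hs; apply: (Rfun _ _ (gact b s m)); [exact: uP|apply: Ract => //; exact: uP].
pose U f : ghom (F f) (G f) := Ghom (uD f) (uact f).
have ures f g a m : sub_open g f -> U g a (res g m) = res g (U f a m).
  by move=> gf; apply: (Rfun _ _ (res g m)); [exact: uP|apply: Rres => //; exact: uP].
by exists (Qhom ures).
Qed.

Definition qid (F : qcoh X) : qhom F F :=
  @Qhom k t X F F (fun f => @Ghom k t X (F f) (F f) (fun a m => m)
    (fun a m m' => erefl) (fun a b s m _ => erefl)) (fun f g a m _ => erefl).

Lemma qcomp_key (F G H : qcoh X) (v : qhom G H) (u : qhom F G) :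
  exists w : qhom F H, comp_eq v u w.
Proof.
have uD f a (m m' : F f a) : v f a (u f a (m + m')) = v f a (u f a m) + v f a (u f a m').
  by rewrite !gfunD.
have uact f a b s (m : F f a) : homogeneous (b - a) s ->
    v f b (u f b (gact b s m)) = gact b s (v f a (u f a m)).
  by move=> hs; rewrite !gfun_act.
have ures f g a (m : F f a) : sub_open g f ->
   v g a (u g a (res g m)) = res g (v f a (u f a m)).
  by move=> gf; rewrite !hfun_res.
by exists (@Qhom k t X F H (fun f => Ghom (uD f) (uact f)) ures).
Qed.

Section Frames.
Variable F : qcoh X.

(* A frame amounts to an isomorphism from the shift by [- a] of the structure
   sheaf. *)
Definition frame a (e : forall f, F f a) : Prop :=
  [/\ compat e,
      forall f b (m : F f b), exists n s,
        homogeneous (b + sodeg f *+ n - a) s /\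
        gact (b + sodeg f *+ n) ((f : S X) ^+ n) m = gact (b + sodeg f *+ n) s (e f)
    & forall f b s, homogeneous (b - a) s -> gact b s (e f) = 0 ->
        exists n, (f : S X) ^+ n * s = 0].

Definition has_frame a : Prop := exists e : forall f, F f a, frame e.
End Frames.

(** The universal property of O(-a): a compatible family of sections of degree a is the image of the
    generator. In the graph, x and y correspond when f^n x and f^n y are the same multiple of the
    generator and of the given section. *)
Lemma frame_hom (F G : qcoh X) a (e : forall f, F f a) (w : forall f, G f a) :
  frame e -> compat w -> exists u : qhom F G, forall f, u f a (e f) = w f.
Proof.
move=> [ce gen fr] cw.
pose R f b (x : F f b) (y : G f b) := exists n s,
  [/\ homogeneous (b + sodeg f *+ n - a) s,
  gact (b + sodeg f *+ n) ((f : S X) ^+ n) x = gact (b + sodeg f *+ n) s (e f) &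
  gact (b + sodeg f *+ n) ((f : S X) ^+ n) y = gact (b + sodeg f *+ n) s (w f)].
have [||||| u uP] := @qhom_of_graph F G R.
- move=> f b x; have [n [s [hs xs]]] := gen f b x.
  have [y ys] := @act_pow_surj G f n b _ (gact (b + sodeg f *+ n) s (w f)) erefl.
  by exists y, n, s.
- move=> f b x1 y1 x2 y2 [n [s [hs xs ys]]] [n' [s' [hs' xs' ys']]].
  exists (n + n')%N, ((f : S X) ^+ n' * s - (f : S X) ^+ n * s').
  have hx (M : gmod X) (p q : M b) (v : M a) :
      gact (b + sodeg f *+ n) ((f : S X) ^+ n) p = gact (b + sodeg f *+ n) s v ->
      gact (b + sodeg f *+ n') ((f : S X) ^+ n') q = gact (b + sodeg f *+ n') s' v ->
      gact (b + sodeg f *+ (n + n')) ((f : S X) ^+ (n + n')) (p - q) =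
      gact (b + sodeg f *+ (n + n'))
        ((f : S X) ^+ n' * s - (f : S X) ^+ n * s') v.
    move=> ep eq; rewrite gactBl; [|hdeg|hdeg].
    rewrite -[in RHS](@gactA _ _ _ _ _ (b + sodeg f *+ n)); [|hdeg|hdeg].
    rewrite -[X in _ = _ - X](@gactA _ _ _ _ _ (b + sodeg f *+ n')); [|hdeg|hdeg].
    rewrite -ep -eq !gactA; [|hdeg|hdeg|hdeg|hdeg].
    rewrite gactBr; last by hdeg.
    by rewrite addnC exprD [in X in _ - X]mulrC.
  by split; [hdeg|exact: hx|exact: hx].
- move=> f b y [n [s [hs]]]; rewrite gact0r; last by hdeg.
  move=> /esym/(fr f _ _ hs)[N sN] ys; apply: (@act_pow_eq0 G f (N + n) b _ _ erefl).
  rewrite exprD -(@gactA _ _ _ _ _ (b + sodeg f *+ n)); [|hdeg|hdeg].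
  rewrite ys gactA; [|hdeg|hdeg].
  by rewrite sN gact0l.
- move=> f b c r x y hr [n [s [hs xs ys]]]; exists n, (r * s).
  have hx (M : gmod X) (p : M b) (v : M a) :
      gact (b + sodeg f *+ n) ((f : S X) ^+ n) p = gact (b + sodeg f *+ n) s v ->
      gact (c + sodeg f *+ n) ((f : S X) ^+ n) (gact c r p) =
      gact (c + sodeg f *+ n) (r * s) v.
    move=> ep; rewrite gactA; [|hdeg|hdeg].
    rewrite mulrC -(@gactA _ _ _ _ _ (b + sodeg f *+ n) _ ((f : S X) ^+ n));
      [|hdeg|hdeg].
    by rewrite ep gactA; [|hdeg|hdeg].
  by split; [hdeg|exact: hx|exact: hx].
- move=> f g b x y gf [n [s [hs xs ys]]]; have [q [r [hr er]]] := gf.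
  exists (q * n)%N, (r ^+ n * s).
  have hx (M : qcoh X) (p : M f b) (v : M f a) :
      gact (b + sodeg f *+ n) ((f : S X) ^+ n) p = gact (b + sodeg f *+ n) s v ->
      gact (b + sodeg g *+ (q * n)) ((g : S X) ^+ (q * n)) (res g p) =
      gact (b + sodeg g *+ (q * n)) (r ^+ n * s) (res g v).
    move=> ep; rewrite exprM er exprMn mulrC.
    rewrite -(@gactA _ _ _ _ _ (b + sodeg f *+ n) _ ((f : S X) ^+ n));
      [|hdeg|hdeg].
    rewrite -res_act //; last by hdeg.
    rewrite ep res_act //.
    by rewrite gactA; [|hdeg|hdeg].
  split; [hdeg| |]; first by rewrite -(ce f g gf); exact: hx.
  by rewrite -(cw f g gf); exact: hx.
(* The relation may use any s for the generator itself; s and f^n then agree up to a power of f,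
   which acts injectively. *)
exists u => f; have [n [s [hs xs ys]]] := uP f a (e f).
have : gact (a + sodeg f *+ n) ((f : S X) ^+ n - s) (e f) = 0.
  by rewrite gactBl ?xs ?subrr //; hdeg.
case/fr => [|N eN]; first by hdeg.
apply: (@act_pow_inj G f (N + n) a _ _ _ erefl).
rewrite exprD -!(@gactA _ _ _ _ _ (a + sodeg f *+ n)); [|hdeg|hdeg|hdeg|hdeg].
rewrite ys !gactA; [|hdeg|hdeg|hdeg|hdeg].
apply/eqP; rewrite eq_sym -subr_eq0 -gactBl; [|hdeg|hdeg].
by rewrite -mulrBr eN gact0l.
Qed.

Lemma frame_hom_eq (F G : qcoh X) a (e : forall f, F f a) (u v : qhom F G) :
  frame e -> (forall f, u f a (e f) = v f a (e f)) ->
  forall f b (m : F f b), u f b m = v f b m.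
Proof.
move=> [_ gen _] uv f b m; have [n [s [hs ms]]] := gen f b m.
apply: (@act_pow_inj G f n b _ _ _ erefl).
by rewrite -!gfun_act ?ms; [rewrite !gfun_act // uv|hdeg|hdeg].
Qed.

End GradedModules.

(** * Line bundles and gluing *)

Section LineBundles.
Variables (k : closedFieldType) (t : nat) (X : wpl k t).
Implicit Types (a b c d : L X) (s r : S X) (f g h : sopen X) (n : nat).

Lemma pdeg1 f : pdeg f 0 (1 : {poly S X}).
Proof. by rewrite -polyC1; apply: pdegC; apply: homog1. Qed.

Lemma locpi0 f a : locpi f a 0 = 0.
Proof.
have h : pdeg f a 0 by move=> i; rewrite coef0; apply: homog0.
by apply: (addrI (locpi f a 0)); rewrite -locpiD // !addr0.
Qed.

Lemma frame_structure_sheaf : has_frame (structure_sheaf X) 0.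
Proof.
exists (fun f => locpi f 0 1); split.
- move=> f g gf; rewrite /= loc_res_pi //; last exact: pdeg1.
  by rewrite -polyC1 comp_polyC.
- move=> f b m; have hm := locrepP m.
  have [n [s [hs es]]] := loc_norm hm; exists n, s.
  have hs0 : homogeneous (b + sodeg f *+ n - 0) s by rewrite subr0.
  have hn : homogeneous (b + sodeg f *+ n - b) ((f : S X) ^+ n) by hdeg.
  split=> //=; rewrite -{1}(locrepK m) !loc_act_pi //; last exact: pdeg1.
  apply/locpiE; [exact: pdegZ hn hm|exact: pdegZ hs0 (pdeg1 f)|].
  by rewrite alg_polyC.
- move=> f b s hs /=; rewrite loc_act_pi //; last exact: pdeg1.
  rewrite -(locpi0 f b) => /locpiE; rewrite subr0 alg_polyC => h.
  apply: in_locI_const; apply: h; first by apply: pdegC; rewrite subr0 in hs.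
  by move=> i; rewrite coef0; apply: homog0.
Qed.

Lemma frame_shift (F : qcoh X) x a : has_frame F a -> has_frame (shift F x) (a - x).
Proof.
have : a = x + (a - x) by zmod.
move: (a - x) => a' -> [e [ce gen fr]]; exists e; split=> [||f b s hs].
- exact: ce.
- move=> f b m; have [n [s [hs es]]] := gen f (x + b) m; exists n, s.
  split; first by hdeg.
  (* Acting by 1 transports between the degrees (x + b) + d and x + (b + d), which are equal but not
     convertible. *)
  have := congr1 (gact (x + (b + sodeg f *+ n)) 1) es.
  by rewrite !gactA ?mul1r //=; hdeg.
- by apply: fr; hdeg.
Qed.

Lemma frame_iso (F G : qcoh X) a : has_frame F a -> has_frame G a -> isomorphic F G.
Proof.
move=> [e he] [w hw]; have [ce _ _] := he; have [cw _ _] := hw.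
have [u uE] := frame_hom he cw; have [v vE] := frame_hom hw ce.
exists u, v; split=> f b m.
  have [w' w'E] := qcomp_key v u; rewrite w'E.
  by apply: (@frame_hom_eq _ _ _ _ _ _ _ w' (qid F) he) => g; rewrite -w'E uE vE.
have [w' w'E] := qcomp_key u v; rewrite w'E.
by apply: (@frame_hom_eq _ _ _ _ _ _ _ w' (qid G) hw) => g; rewrite -w'E vE uE.
Qed.

Lemma has_frame_iso (F G : qcoh X) a : isomorphic F G -> has_frame G a -> has_frame F a.
Proof.
move=> [u [v [vu uv]]] [e [ce gen fr]]; exists (fun f => v f a (e f)); split.
- by move=> f g gf; rewrite -hfun_res // ce.
- move=> f b m; have [n [s [hs es]]] := gen f b (u f b m); exists n, s; split=> //.
  rewrite -[LHS]vu -gfun_act // -es gfun_act //; hdeg.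
- move=> f b s hs; rewrite -gfun_act // => /(congr1 (u f b)); rewrite uv gfun0.
  exact: fr.
Qed.

Lemma line_bundleP (F : qcoh X) : line_bundle F <-> exists a, has_frame F a.
Proof.
split=> [[y iy]|[a ha]].
  by exists (0 - y); apply: has_frame_iso iy _; apply/frame_shift/frame_structure_sheaf.
exists (- a); apply: frame_iso ha _.
by have := frame_shift (- a) frame_structure_sheaf; rewrite sub0r opprK.
Qed.
End LineBundles.

(** * The sheaf property for the covering by D(x_1) and D(x_2) *)

Section Gluing.
Variables (k : closedFieldType) (t : nat) (X : wpl k t).
Implicit Types (a b c d : L X) (s r : S X) (f g h : sopen X) (n : nat).

Local Notation x1 := (idx1 X).
Local Notation x2 := (idx2 X).

Definition so_x i : sopen X := Sopen (homog_xS X i) (xL_pos X i).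
Local Notation D1 := (so_x x1).
Local Notation D2 := (so_x x2).

Lemma so_mul_pos f g : leL 0 (sodeg f + sodeg g) /\ sodeg f + sodeg g <> 0.
Proof.
have [[f0 f1] [g0 _]] := (so_pos f, so_pos g); split; first exact: leL0D.
by move/(leL0_anti f0 g0).
Qed.

Definition so_mul f g : sopen X :=
  Sopen (homogM (so_homog f) (so_homog g)) (so_mul_pos f g).

Lemma so_mul_l f g : sub_open (so_mul f g) f.
Proof.
by exists 1%N, (g : S X); split; [rewrite /=; hdeg|rewrite expr1].
Qed.

Lemma so_mul_r f g : sub_open (so_mul f g) g.
Proof.
by exists 1%N, (f : S X); split; [rewrite /=; hdeg|rewrite expr1 mulrC].
Qed.

Lemma so_mul_sub f g h : sub_open g f -> sub_open (so_mul g h) (so_mul f h).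
Proof.
move=> [n [s [hs e]]]; exists n.+1, (s * (g : S X) * (h : S X) ^+ n); split.
  apply: (@homog_eq _ _ X ((sodeg g *+ n - sodeg f) + sodeg g + sodeg h *+ n)).
    by hdeg.
  by rewrite /=; zmod.
by rewrite /= exprS exprMn e; ring.
Qed.

Lemma so_radical f n : exists N, in_J n (sodeg f *+ N) ((f : S X) ^+ N).
Proof. by have [_ f0] := so_pos f; apply: in_J_radical f0 (so_homog f). Qed.

Section Sheaf.
Variable F : qcoh X.

Lemma res_pow_eq0 f g a (m : F f a) : res (so_mul f g) m = 0 -> exists n,
  gact (a + sodeg g *+ n) ((g : S X) ^+ n) m = 0.
Proof.
case/(loc_inj (so_mul_l f g)) => n /= e0; exists n.
apply: (@act_pow_eq0 _ _ _ _ f n _ (a + (sodeg f + sodeg g) *+ n)); first by zmod.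
by rewrite gactA; [rewrite -exprMn|hdeg|hdeg].
Qed.

Lemma act_pow_le0 g f n n' a (m : F f a) : (n <= n')%N ->
  gact (a + sodeg g *+ n) ((g : S X) ^+ n) m = 0 ->
  gact (a + sodeg g *+ n') ((g : S X) ^+ n') m = 0.
Proof.
move=> /subnK <- e0; rewrite exprD -(@gactA _ _ _ _ _ (a + sodeg g *+ n)); [|hdeg|hdeg].
by rewrite e0 gact0r //; hdeg.
Qed.

(** Partition of unity: x_1^n and x_2^n kill m for some n, and a power of f lies in (x_1^n, x_2^n)
    and acts injectively. *)
Lemma sheaf_separated f a (m : F f a) :
  res (so_mul f D1) m = 0 -> res (so_mul f D2) m = 0 -> m = 0.
Proof.
case/res_pow_eq0 => n1 e1 /res_pow_eq0[n2 e2].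
pose n := maxn n1 n2.
have {}e1 := act_pow_le0 (leq_maxl n1 n2) e1; have {}e2 := act_pow_le0 (leq_maxr n1 n2) e2.
have [N [A [B [hA hB eN]]]] := so_radical f n.
apply: (@act_pow_eq0 _ _ _ _ f N _ (a + sodeg f *+ N)) => //.
rewrite eN gactDl; [|hdeg|hdeg]; rewrite ![xS X _ ^+ _ * _]mulrC.
rewrite -(@gactA _ _ _ _ _ (a + xL X x1 *+ n)); [|hdeg|hdeg].
rewrite -[X in _ + X = _](@gactA _ _ _ _ _ (a + xL X x2 *+ n)); [|hdeg|hdeg].
by rewrite e1 e2 !gact0r ?addr0 //; hdeg.
Qed.

Lemma sheaf_separated_eq f a (m m' : F f a) :
  res (so_mul f D1) m = res (so_mul f D1) m' ->
  res (so_mul f D2) m = res (so_mul f D2) m' -> m = m'.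
Proof.
move=> e1 e2; apply/eqP; rewrite -subr_eq0; apply/eqP.
by apply: sheaf_separated; rewrite resB ?e1 ?e2 ?subrr //; apply: so_mul_l.
Qed.

(** Gluing follows from the localization properties as for modules over a ring: write both sections
    as fractions, clear the torsion on the overlap, and combine the numerators by a partition of
    unity. *)
Lemma sheaf_glue f a (m1 : F (so_mul f D1) a) (m2 : F (so_mul f D2) a) :
  res (so_mul (so_mul f D1) D2) m1 =
    res (f := so_mul f D2) (so_mul (so_mul f D1) D2) m2 ->
  exists m : F f a, res (so_mul f D1) m = m1 /\ res (so_mul f D2) m = m2.
Proof.
set g1 := so_mul f D1; set g2 := so_mul f D2; set w := so_mul g1 D2 => e12.
have g1f : sub_open g1 f := so_mul_l _ _; have g2f : sub_open g2 f := so_mul_l _ _.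
have wg1 : sub_open w g1 := so_mul_l _ _.
have wg2 : sub_open w g2.
  by exists 1%N, (xS X x1); split; [rewrite /=; hdeg|rewrite /= expr1; ring].
have wf : sub_open w f := sub_open_trans g1f wg1.
have [n1 [p1 e1]] := loc_surj m1 g1f; have [n2 [p2 e2]] := loc_surj m2 g2f.
pose n := (n1 + n2)%N.
have ext g nn (q : F g a) (p : F f (a + sodeg g *+ nn)) : sub_open g f -> (nn <= n)%N ->
   res g p = gact (a + sodeg g *+ nn) ((g : S X) ^+ nn) q ->
   exists p' : F f (a + sodeg g *+ n), res g p' = gact (a + sodeg g *+ n) ((g : S X) ^+ n) q.
  move=> gf /subnK nE e; exists (gact (a + sodeg g *+ n) ((g : S X) ^+ (n - nn)) p).
  rewrite res_act //; last by rewrite -{1}nE; hdeg.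
  rewrite e gactA; [|hdeg|rewrite -{1}nE; hdeg].
  by rewrite -exprD nE.
have {p1 p2 e1 e2 ext} [[p1 e1] [p2 e2]] :
    (exists p : F f (a + sodeg g1 *+ n),
      res g1 p = gact (a + sodeg g1 *+ n) ((g1 : S X) ^+ n) m1) /\
    (exists p : F f (a + sodeg g2 *+ n),
      res g2 p = gact (a + sodeg g2 *+ n) ((g2 : S X) ^+ n) m2).
  split; first by apply: ext e1 => //; rewrite leq_addr.
  by apply: ext e2 => //; rewrite leq_addl.
move: n p1 e1 p2 e2 => {n1 n2} n p1 e1 p2 e2.
pose c := a + sodeg g1 *+ n + sodeg g2 *+ n.
(* The cross-multiplied difference of p1 / g1^n and p2 / g2^n. It vanishes on the overlap, hence
   after multiplication by a power of w. *)
pose z := gact c ((g2 : S X) ^+ n) p1 - gact c ((g1 : S X) ^+ n) p2.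
have hg1 : homogeneous (c - (a + sodeg g1 *+ n)) ((g2 : S X) ^+ n) by rewrite /c; hdeg.
have hg2 : homogeneous (c - (a + sodeg g2 *+ n)) ((g1 : S X) ^+ n) by rewrite /c; hdeg.
have : res w z = 0.
  rewrite resB // !res_act // -(res_comp p1 g1f wg1) -(res_comp p2 g2f wg2) e1 e2.
  rewrite !res_act //; [|hdeg|hdeg].
  by rewrite e12 !gactA; [rewrite mulrC subrr|hdeg|exact: hg2|hdeg|exact: hg1].
case/(loc_inj wf) => q zq.
pose N := (n + q)%N.
have zN : gact (a + (sodeg g1 + sodeg g2) *+ N) ((g1 : S X) ^+ q * (g2 : S X) ^+ q) z = 0.
  (* With g1 = f x_1, g2 = f x_2 and w = f x_1 x_2 one has g1 g2 = f w. *)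
  have -> : (g1 : S X) ^+ q * (g2 : S X) ^+ q = (f : S X) ^+ q * (w : S X) ^+ q.
    by rewrite /= !exprMn; ring.
  rewrite -(@gactA _ _ _ _ _ (c + sodeg w *+ q)); first last.
  - by rewrite /c /N /=; hdeg.
  - by hdeg.
  by rewrite zq gact0r // /c /N /=; hdeg.
pose r1 := gact (a + sodeg g1 *+ N) ((g1 : S X) ^+ q) p1.
pose r2 := gact (a + sodeg g2 *+ N) ((g2 : S X) ^+ q) p2.
have hq1 : homogeneous (a + sodeg g1 *+ N - (a + sodeg g1 *+ n)) ((g1 : S X) ^+ q).
  by rewrite /N; hdeg.
have hq2 : homogeneous (a + sodeg g2 *+ N - (a + sodeg g2 *+ n)) ((g2 : S X) ^+ q).
  by rewrite /N; hdeg.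
have res1 : res g1 r1 = gact (a + sodeg g1 *+ N) ((g1 : S X) ^+ N) m1.
  by rewrite /r1 res_act // e1 gactA; [rewrite -exprD addnC|hdeg|exact: hq1].
have res2 : res g2 r2 = gact (a + sodeg g2 *+ N) ((g2 : S X) ^+ N) m2.
  by rewrite /r2 res_act // e2 gactA; [rewrite -exprD addnC|hdeg|exact: hq2].
have r12 : gact (a + (sodeg g1 + sodeg g2) *+ N) ((g2 : S X) ^+ N) r1 =
           gact (a + (sodeg g1 + sodeg g2) *+ N) ((g1 : S X) ^+ N) r2.
  pose b := a + (sodeg g1 + sodeg g2) *+ N.
  have hq : homogeneous (b - c) ((g1 : S X) ^+ q * (g2 : S X) ^+ q).
    by rewrite /b /c /N; hdeg.
  have h1 : homogeneous (b - (a + sodeg g1 *+ N)) ((g2 : S X) ^+ N) by rewrite /b; hdeg.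
  have h2 : homogeneous (b - (a + sodeg g2 *+ N)) ((g1 : S X) ^+ N) by rewrite /b; hdeg.
  apply/eqP; rewrite -subr_eq0 -[X in _ == X]zN /z gactBr //.
  rewrite (gactA _ hg1 hq) (gactA _ hg2 hq) (gactA _ hq1 h1) (gactA _ hq2 h2).
  by apply/eqP; congr (_ - _); congr (gact _ _ _); rewrite /N !exprD; ring.
have [M [A [B [hA hB eM]]]] := so_radical f N.
(* The additional factor f^N turns x_i^N into the power g_i^N of the denominators. *)
pose Q := (M + N)%N.
have hA' : homogeneous (a + sodeg f *+ Q - (a + sodeg g1 *+ N)) A by rewrite /Q /=; hdeg.
have hB' : homogeneous (a + sodeg f *+ Q - (a + sodeg g2 *+ N)) B by rewrite /Q /=; hdeg.
have eQ : (f : S X) ^+ Q = A * (g1 : S X) ^+ N + B * (g2 : S X) ^+ N.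
  by rewrite exprD eM /= !exprMn; ring.
have [m mE] := @act_pow_surj _ _ _ F f Q a _
  (gact (a + sodeg f *+ Q) A r1 + gact (a + sodeg f *+ Q) B r2) erefl.
have key (g g' : sopen X) (C C' : S X) (mi : F g a)
    (r : F f (a + sodeg g *+ N)) (r' : F f (a + sodeg g' *+ N)) :
    sub_open g f ->
    homogeneous (a + sodeg f *+ Q - (a + sodeg g *+ N)) C ->
    homogeneous (a + sodeg f *+ Q - (a + sodeg g' *+ N)) C' ->
    res g r = gact (a + sodeg g *+ N) ((g : S X) ^+ N) mi ->
    gact (a + (sodeg g + sodeg g') *+ N) ((g' : S X) ^+ N) r =
      gact (a + (sodeg g + sodeg g') *+ N) ((g : S X) ^+ N) r' ->
    (f : S X) ^+ Q = C * (g : S X) ^+ N + C' * (g' : S X) ^+ N ->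
    gact (a + sodeg f *+ Q) ((f : S X) ^+ Q) m =
      gact (a + sodeg f *+ Q) C r + gact (a + sodeg f *+ Q) C' r' ->
    res g m = mi.
  move=> gf hC hC' rr err eQ' mE'.
  have em : gact (a + sodeg g *+ N) ((g : S X) ^+ N) m = r.
    apply: (@act_pow_inj _ _ _ F f Q _ (a + sodeg g *+ N + sodeg f *+ Q)) => //.
    rewrite gactA; [|hdeg|hdeg].
    rewrite mulrC -(@gactA _ _ _ _ _ (a + sodeg f *+ Q)); [|hdeg|hdeg].
    rewrite mE' gactDr; last by hdeg.
    rewrite !gactA; [|exact: hC'|hdeg|exact: hC|hdeg].
    rewrite ![((g : S X) ^+ N) * _]mulrC.
    rewrite -[X in _ + X = _](@gactA _ _ _ _ _ (a + (sodeg g + sodeg g') *+ N)); first last.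
    - by hdeg.
    - by hdeg.
    rewrite -err gactA; [|hdeg|hdeg].
    by rewrite -gactDl -?eQ' //; hdeg.
  apply: (@act_pow_inj _ _ _ F g N _ (a + sodeg g *+ N)) => //.
  by rewrite -res_act // ?em //; hdeg.
exists m; split; first exact: key hA' hB' res1 r12 eQ mE.
apply: (key _ _ _ _ _ _ r1 g2f hB' hA' res2 _ _ _).
- by move: r12; rewrite [sodeg g1 + _]addrC => ->.
- by rewrite eQ; apply: addrC.
- by rewrite mE; apply: addrC.
Qed.

Lemma glue_sections a (m1 : F D1 a) (m2 : F D2 a) :
  res (so_mul D1 D2) m1 = res (so_mul D1 D2) m2 ->
  exists m : forall f, F f a, [/\ compat m, m D1 = m1 & m D2 = m2].
Proof.
move=> e12.
(* Over every D(f), the two sections are restricted to D(f x_1) and D(f x_2) and glued there. *)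
have mP f : exists m : F f a, res (so_mul f D1) m = res (so_mul f D1) m1 /\
    res (so_mul f D2) m = res (so_mul f D2) m2.
  apply: sheaf_glue; have W12 : sub_open (so_mul (so_mul f D1) D2) (so_mul D1 D2).
    by apply: so_mul_sub; apply: so_mul_r.
  have W1 := so_mul_l (so_mul f D1) D2; have f1 := so_mul_r f D1.
  have f2 := so_mul_r f D2.
  have W2 : sub_open (so_mul (so_mul f D1) D2) (so_mul f D2).
    by apply: so_mul_sub; apply: so_mul_l.
  rewrite (res_comp m1 f1 W1) (res_comp m2 f2 W2).
  by rewrite -(res_comp m1 (so_mul_l _ _) W12) e12 res_comp //; apply: so_mul_r.
pose m f := sval (cid (mP f)).
have m1E f : res (so_mul f D1) (m f) = res (so_mul f D1) m1.
  by rewrite /m; case: cid => ? [].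
have m2E f : res (so_mul f D2) (m f) = res (so_mul f D2) m2.
  by rewrite /m; case: cid => ? [].
exists m; split.
- move=> f g gf; apply: sheaf_separated_eq.
    have g1 := so_mul_sub D1 gf; rewrite m1E (res_comp (m f) gf (so_mul_l _ _)).
    rewrite -(res_comp (m f) (so_mul_l f D1) g1) m1E res_comp //.
    exact: so_mul_r.
  have g2 := so_mul_sub D2 gf; rewrite m2E (res_comp (m f) gf (so_mul_l _ _)).
  rewrite -(res_comp (m f) (so_mul_l f D2) g2) m2E res_comp //.
  exact: so_mul_r.
- by apply: sheaf_separated_eq; rewrite ?m1E ?m2E.
have D21 : sub_open (so_mul D2 D1) (so_mul D1 D2).
  by exists 1%N, 1; split; [rewrite /=; hdeg|rewrite /= expr1; ring].
apply: sheaf_separated_eq; last by rewrite m2E.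
rewrite m1E -(res_comp m1 (so_mul_l D1 D2) D21) e12 res_comp //; exact: so_mul_r.
Qed.

Lemma sections_eq a (m m' : forall f, F f a) : compat m -> compat m' ->
  m D1 = m' D1 -> m D2 = m' D2 -> forall f, m f = m' f.
Proof.
move=> cm cm' e1 e2 f; apply: sheaf_separated_eq.
  rewrite (cm _ _ (so_mul_l f D1)) (cm' _ _ (so_mul_l f D1)).
  by rewrite -(cm _ _ (so_mul_r f D1)) -(cm' _ _ (so_mul_r f D1)) e1.
rewrite (cm _ _ (so_mul_l f D2)) (cm' _ _ (so_mul_l f D2)).
by rewrite -(cm _ _ (so_mul_r f D2)) -(cm' _ _ (so_mul_r f D2)) e2.
Qed.
End Sheaf.
End Gluing.

(** * Direct sums *)

Definition dprod (J : Type) (V : J -> zmodType) : Type := forall j, V j.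

Section DependentProduct.
Variables (J : Type) (V : J -> zmodType).
HB.instance Definition _ := gen_eqMixin (dprod V).
HB.instance Definition _ := gen_choiceMixin (dprod V).

Lemma dprod_ext (u v : dprod V) : (forall j, u j = v j) -> u = v.
Proof. by move=> uv; apply: functional_extensionality_dep. Qed.

Definition dprod_add (u v : dprod V) : dprod V := fun j => u j + v j.
Definition dprod_opp (u : dprod V) : dprod V := fun j => - u j.
Lemma dprod_addA : associative dprod_add.
Proof. by move=> u v w; apply: dprod_ext => j; apply: addrA. Qed.
Lemma dprod_addC : commutative dprod_add.
Proof. by move=> u v; apply: dprod_ext => j; apply: addrC. Qed.
Lemma dprod_add0 : left_id (fun j => 0 : V j) dprod_add.
Proof. by move=> u; apply: dprod_ext => j; apply: add0r. Qed.
Lemma dprod_addN : left_inverse (fun j => 0 : V j) dprod_opp dprod_add.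
Proof. by move=> u; apply: dprod_ext => j; apply: addNr. Qed.
HB.instance Definition _ := GRing.isZmodule.Build (dprod V)
  dprod_addA dprod_addC dprod_add0 dprod_addN.

Lemma dprodD (u v : dprod V) j : (u + v) j = u j + v j.
Proof. by []. Qed.
Lemma dprod_sum (I : Type) (z : seq I) (F : I -> dprod V) j :
  (\sum_(i <- z) F i) j = \sum_(i <- z) F i j.
Proof. by elim: z => [|i z IHz]; rewrite ?big_nil // !big_cons dprodD IHz. Qed.
End DependentProduct.

Section DirectSums.
Variables (k : closedFieldType) (t : nat) (X : wpl k t).
Implicit Types (a b c d : L X) (s r : S X) (f g h : sopen X) (n : nat).
Variables (J : finType) (A : J -> qcoh X).

Section Modules.
Variable f : sopen X.
Definition dsum_act a b s (m : dprod (fun j => A j f a)) : dprod (fun j => A j f b) :=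
  fun j => gact b s (m j).

Lemma dsum_actDr a b s (m m' : dprod (fun j => A j f a)) : homogeneous (b - a) s ->
  dsum_act b s (m + m') = dsum_act b s m + dsum_act b s m'.
Proof. by move=> hs; apply: dprod_ext => j; apply: gactDr. Qed.
Lemma dsum_actDl a b s r (m : dprod (fun j => A j f a)) : homogeneous (b - a) s ->
  homogeneous (b - a) r -> dsum_act b (s + r) m = dsum_act b s m + dsum_act b r m.
Proof. by move=> hs hr; apply: dprod_ext => j; apply: gactDl. Qed.
Lemma dsum_act1 a (m : dprod (fun j => A j f a)) : dsum_act a 1 m = m.
Proof. by apply: dprod_ext => j; apply: gact1. Qed.
Lemma dsum_actA a b c s r (m : dprod (fun j => A j f a)) : homogeneous (b - a) s ->
  homogeneous (c - b) r -> dsum_act c r (dsum_act b s m) = dsum_act c (r * s) m.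
Proof. by move=> hs hr; apply: dprod_ext => j; apply: gactA. Qed.

Definition dsum_gmod : gmod X := @Gmod k t X (fun a => dprod (fun j => A j f a))
  dsum_act dsum_actDr dsum_actDl dsum_act1 dsum_actA.
End Modules.

Definition dsum_res f g a (m : dsum_gmod f a) : dsum_gmod g a :=
  fun j => res g (m j).

Lemma dsum_resD f g a (m m' : dsum_gmod f a) : sub_open g f ->
  dsum_res g (m + m') = dsum_res g m + dsum_res g m'.
Proof. by move=> gf; apply: dprod_ext => j; apply: resD. Qed.
Lemma dsum_res_act f g a b s (m : dsum_gmod f a) : sub_open g f ->
  homogeneous (b - a) s -> dsum_res g (gact b s m) = gact b s (dsum_res g m).
Proof. by move=> gf hs; apply: dprod_ext => j; apply: res_act. Qed.
Lemma dsum_res_id f a (m : dsum_gmod f a) : dsum_res f m = m.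
Proof. by apply: dprod_ext => j; apply: res_id. Qed.
Lemma dsum_res_comp f g h a (m : dsum_gmod f a) : sub_open g f -> sub_open h g ->
  dsum_res h (dsum_res g m) = dsum_res h m.
Proof. by move=> gf hg; apply: dprod_ext => j; apply: res_comp. Qed.
Lemma dsum_act_inj f a (m m' : dsum_gmod f a) :
  gact (a + sodeg f) (f : S X) m = gact (a + sodeg f) (f : S X) m' -> m = m'.
Proof.
move=> e; apply: dprod_ext => j; apply: so_act_inj.
by have := congr1 (fun u : dsum_gmod f (a + sodeg f) => u j) e.
Qed.
Lemma dsum_act_surj f a (m : dsum_gmod f (a + sodeg f)) :
  exists m' : dsum_gmod f a, gact (a + sodeg f) (f : S X) m' = m.
Proof.
exists (fun j => sval (cid (so_act_surj (m j)))); apply: dprod_ext => j /=.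
by rewrite /dsum_act; case: cid.
Qed.
Lemma dsum_loc_inj f g a (m : dsum_gmod f a) : sub_open g f -> dsum_res g m = 0 ->
  exists n, gact (a + sodeg g *+ n) ((g : S X) ^+ n) m = 0.
Proof.
move=> gf e0; have e0j j : exists n, gact (a + sodeg g *+ n) ((g : S X) ^+ n) (m j) = 0.
  apply: (loc_inj gf); exact: (congr1 (fun u : dsum_gmod g a => u j) e0).
(* J is finite, so the sum of the exponents is large enough for all components. *)
pose n j := sval (cid (e0j j)); exists (\sum_j n j)%N; apply: dprod_ext => j.
apply: (@act_pow_le0 _ _ _ _ g f (n j)); last by rewrite /n; case: cid.
by rewrite (bigD1 j) //= leq_addr.
Qed.
Lemma dsum_loc_surj f g a (m : dsum_gmod g a) : sub_open g f ->
  exists n (m' : dsum_gmod f (a + sodeg g *+ n)),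
    dsum_res g m' = gact (a + sodeg g *+ n) ((g : S X) ^+ n) m.
Proof.
move=> gf; have ej j := loc_surj (m j) gf.
pose n j := sval (cid (ej j)); pose N := (\sum_j n j)%N.
have mP j : exists m' : A j f (a + sodeg g *+ N),
    res g m' = gact (a + sodeg g *+ N) ((g : S X) ^+ N) (m j).
  have [m' e] : exists m' : A j f (a + sodeg g *+ n j),
      res g m' = gact (a + sodeg g *+ n j) ((g : S X) ^+ n j) (m j).
    by rewrite /n; case: cid.
  have nN : (N = (N - n j) + n j)%N by rewrite subnK // /N (bigD1 j) //= leq_addr.
  have hN : homogeneous (a + sodeg g *+ N - (a + sodeg g *+ n j)) ((g : S X) ^+ (N - n j)).
    by rewrite {1}nN; hdeg.
  exists (gact (a + sodeg g *+ N) ((g : S X) ^+ (N - n j)) m').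
  rewrite res_act // e gactA //; last by hdeg.
  by rewrite -exprD -nN.
exists N, (fun j => sval (cid (mP j))); apply: dprod_ext => j.
by rewrite /dsum_res; case: cid.
Qed.

Definition dsum : qcoh X := @Qcoh k t X dsum_gmod dsum_res dsum_resD dsum_res_act
  dsum_res_id dsum_res_comp dsum_act_inj dsum_act_surj dsum_loc_inj dsum_loc_surj.

Definition dsum_proj j : qhom dsum (A j) :=
  @Qhom k t X dsum (A j) (fun f => @Ghom k t X (dsum f) (A j f) (fun a m => m j)
    (fun a m m' => erefl) (fun a b s m _ => erefl)) (fun f g a m _ => erefl).

Definition dsum_in_val j f a (m : A j f a) : dsum f a :=
  @dfwith J (fun i => A i f a) (fun=> 0) j m.

Lemma dsum_in_val_eq j f a (m : A j f a) : dsum_in_val m j = m.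
Proof. exact: dfwith_in. Qed.

Lemma dsum_in_val_neq i j f a (m : A j f a) : i != j -> dsum_in_val m i = 0.
Proof. by move=> ij; apply: dfwith_out; rewrite eq_sym. Qed.

Lemma dsum_in_key j : exists u : qhom (A j) dsum,
  forall f a m, u f a m = dsum_in_val m.
Proof.
have uD f a (m m' : A j f a) : dsum_in_val (m + m') = dsum_in_val m + dsum_in_val m'.
  apply: dprod_ext => i; rewrite dprodD; case: (eqVneq i j) => [->|ij].
    by rewrite !dsum_in_val_eq.
  by rewrite !dsum_in_val_neq // addr0.
have uact f a b s (m : A j f a) : homogeneous (b - a) s ->
    dsum_in_val (gact b s m) = gact b s (dsum_in_val m).
  move=> hs; apply: dprod_ext => i; case: (eqVneq i j) => [->|ij].
    by rewrite /= /dsum_act !dsum_in_val_eq.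
  by rewrite /= /dsum_act !dsum_in_val_neq // gact0r.
have ures f g a (m : A j f a) : sub_open g f ->
    dsum_in_val (res g m) = res g (dsum_in_val m).
  move=> gf; apply: dprod_ext => i; case: (eqVneq i j) => [->|ij].
    by rewrite /= /dsum_res !dsum_in_val_eq.
  by rewrite /= /dsum_res !dsum_in_val_neq // res0.
by exists (@Qhom k t X (A j) dsum (fun f => Ghom (uD f) (uact f)) ures).
Qed.

Definition dsum_in j : qhom (A j) dsum := sval (cid (dsum_in_key j)).
Lemma dsum_inE j f a m : dsum_in j f a m = dsum_in_val m.
Proof. by rewrite /dsum_in; case: cid. Qed.

Lemma dsum_in_eq j f a (m : A j f a) : dsum_in j f a m j = m.
Proof. by rewrite dsum_inE dsum_in_val_eq. Qed.

Lemma dsum_in_neq i j f a (m : A j f a) : i != j -> dsum_in j f a m i = 0.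
Proof. by rewrite dsum_inE; apply: dsum_in_val_neq. Qed.

Lemma dsum_decomp f a (m : dsum f a) : m = \sum_j dsum_in j f a (m j).
Proof.
apply: dprod_ext => i; rewrite dprod_sum (bigD1 i) //= dsum_in_eq.
by rewrite big1 ?addr0 // => j ji; rewrite dsum_in_neq // eq_sym.
Qed.

Lemma dsumP : is_dsum A dsum.
Proof.
exists dsum_in => f a m; exists (fun j => m j); split; first exact: dsum_decomp.
move=> c e; apply: (@dprod_ext _ (fun j => A j f a)) => i.
rewrite e dprod_sum (bigD1 i) //= dsum_in_eq.
by rewrite big1 ?addr0 // => j ji; rewrite dsum_in_neq // eq_sym.
Qed.

Lemma dsum_elim (G : qcoh X) (p : forall j, qhom (A j) G) :
  exists u : qhom dsum G, forall f a m, u f a m = \sum_j p j f a (m j).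
Proof.
pose u f a (m : dsum f a) := \sum_j p j f a (m j).
have uD f a (m m' : dsum f a) : u f a (m + m') = u f a m + u f a m'.
  by rewrite -big_split; apply: eq_bigr => j _; apply: gfunD.
have uact f a b s (m : dsum f a) : homogeneous (b - a) s ->
    u f b (gact b s m) = gact b s (u f a m).
  by move=> hs; rewrite gact_sumr //; apply: eq_bigr => j _; apply: gfun_act.
have ures f g a (m : dsum f a) : sub_open g f -> u g a (res g m) = res g (u f a m).
  move=> gf; rewrite /u res_sum //.
  by apply: eq_bigr => j _; apply: hfun_res.
by exists (@Qhom k t X dsum G (fun f => Ghom (uD f) (uact f)) ures).
Qed.

Lemma dsum_intro (G : qcoh X) (q : forall j, qhom G (A j)) :
  exists u : qhom G dsum, forall f a m j, u f a m j = q j f a m.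
Proof.
pose u f a (m : G f a) : dsum f a := fun j => q j f a m.
have uD f a (m m' : G f a) : u f a (m + m') = u f a m + u f a m'.
  by apply: dprod_ext => j; apply: gfunD.
have uact f a b s (m : G f a) : homogeneous (b - a) s ->
    u f b (gact b s m) = gact b s (u f a m).
  by move=> hs; apply: dprod_ext => j; apply: gfun_act.
have ures f g a (m : G f a) : sub_open g f -> u g a (res g m) = res g (u f a m).
  by move=> gf; apply: dprod_ext => j; apply: hfun_res.
by exists (@Qhom k t X G dsum (fun f => Ghom (uD f) (uact f)) ures).
Qed.
End DirectSums.

(** Transporting c along h' changes the type of each component by a cast; on the image of h the cast
    is trivial by uniqueness of identity proofs on an [eqType]. *)
Lemma dep_reindex (I : Type) (J : eqType) (B : J -> Type) (h : I -> J) (h' : J -> I) :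
  cancel h h' -> cancel h' h ->
  forall c : (forall i, B (h i)), exists c' : (forall j, B j), forall i, c' (h i) = c i.
Proof.
move=> hK h'K c; exists (fun j => ecast j (B j) (h'K j) (c (h' j))) => i.
by move: (h'K (h i)); rewrite hK => e; rewrite (eq_axiomK e).
Qed.

Section LineBundleSums.
Variables (k : closedFieldType) (t : nat) (X : wpl k t).

Lemma is_dsum_reindex (I J : finType) (h : I -> J) (h' : J -> I) (A : J -> qcoh X) P :
  cancel h h' -> cancel h' h -> is_dsum A P -> is_dsum (fun i => A (h i)) P.
Proof.
move=> hK h'K [iota iotaP]; exists (fun i => iota (h i)) => f b m.
have [c [cE cU]] := iotaP f b m; exists (fun i => c (h i)).
have re (c' : forall j, A j f b) :
    \sum_j iota j f b (c' j) = \sum_i iota (h i) f b (c' (h i)).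
  by rewrite (reindex h) //; exists h' => ? _.
split; first by rewrite -re -cE.
move=> d dE; have [d' d'E] := dep_reindex (B := fun j => A j f b) hK h'K d.
have -> : c = d' by apply: cU; rewrite re dE; apply: eq_bigr => i _; rewrite d'E.
by apply: functional_extensionality_dep => i; rewrite d'E.
Qed.

Lemma line_bundle_sumP (J : finType) (A : J -> qcoh X) P :
  (forall j, line_bundle (A j)) -> is_dsum A P -> line_bundle_sum P.
Proof.
move=> lA hP; exists #|J|, (fun i => A (enum_val i)); split=> [i|]; first exact: lA.
by apply: is_dsum_reindex hP; [exact: enum_valK|exact: enum_rankK].
Qed.
End LineBundleSums.

(** * Sections of framed sheaves *)

Section FramedSheaves.
Variables (k : closedFieldType) (t : nat) (X : wpl k t).
Implicit Types (a b c d : L X) (s r : S X) (f g h : sopen X) (n : nat).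

Local Notation x1 := (idx1 X).
Local Notation x2 := (idx2 X).
Local Notation D1 := (so_x X x1).
Local Notation D2 := (so_x X x2).
Local Notation D12 := (so_mul D1 D2).

Lemma D12_D1 : sub_open D12 D1. Proof. exact: so_mul_l. Qed.
Lemma D12_D2 : sub_open D12 D2. Proof. exact: so_mul_r. Qed.

Section Frame.
Variables (F : qcoh X) (a : L X) (e : forall f, F f a).
Hypothesis he : frame e.

Lemma frame_inj_D1 b s : homogeneous (b - a) s -> gact b s (e D1) = 0 -> s = 0.
Proof.
have [_ _ fr] := he; move=> hs /(fr D1 _ _ hs)[n].
by apply: xS_regular hs.
Qed.

Lemma frame_inj_D12 b s : homogeneous (b - a) s -> gact b s (e D12) = 0 -> s = 0.
Proof.
have [_ _ fr] := he; move=> hs /(fr D12 _ _ hs)[n]; rewrite /= exprMn -mulrA.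
move/xS_regular => h; have {}h := h (sodeg D2 *+ n + (b - a)) isT.
by apply: (xS_regular (i := x2) isT hs (n := n)); apply: h; hdeg.
Qed.

Lemma frame_not_zero : ~ is_zero F.
Proof.
move=> F0; have := @frame_inj_D1 a 1; rewrite subrr => h.
by have /eqP := h (homog1 X) (F0 _ _ _); rewrite oner_eq0.
Qed.

(** This is H^0(O(d)) = S_d for d = b - a. Over D(x_1) and D(x_2) the section is a fraction s1 /
    x_1^n1 and s2 / x_2^n2; since they agree on the overlap, the regular sequence x_1, x_2 forces
    both to be one element of S. *)
Lemma frame_sections b (w : forall f, F f b) : compat w ->
  exists s, homogeneous (b - a) s /\ forall f, w f = gact b s (e f).
Proof.
have [ce gen _] := he; move=> cw.
have [n1 [s1 [hs1 e1]]] := gen D1 b (w D1); have [n2 [s2 [hs2 e2]]] := gen D2 b (w D2).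
rewrite /= in hs1 hs2.
have /= e1' := congr1 (@res _ _ _ F D1 D12 _) e1.
have /= e2' := congr1 (@res _ _ _ F D2 D12 _) e2.
rewrite !res_act ?(cw _ _ D12_D1) ?(ce _ _ D12_D1) // in e1'; try exact: D12_D1; try by hdeg.
rewrite !res_act ?(cw _ _ D12_D2) ?(ce _ _ D12_D2) // in e2'; try exact: D12_D2; try by hdeg.
have e12 : xS X x2 ^+ n2 * s1 = xS X x1 ^+ n1 * s2.
  apply/eqP; rewrite -subr_eq0; apply/eqP.
  pose d := b + xL X x1 *+ n1 + xL X x2 *+ n2.
  apply: (@frame_inj_D12 d); first by rewrite /d; hdeg.
  rewrite gactBl; [|rewrite /d; hdeg|rewrite /d; hdeg].
  rewrite -(@gactA _ _ _ _ _ (b + xL X x1 *+ n1)); [|hdeg|rewrite /d; hdeg].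
  rewrite -[X in _ - X](@gactA _ _ _ _ _ (b + xL X x2 *+ n2)); [|hdeg|rewrite /d; hdeg].
  rewrite -e1' -e2' !gactA; [|hdeg|rewrite /d; hdeg|hdeg|rewrite /d; hdeg].
  by rewrite mulrC subrr.
have [s [hs s1E]] := xS_regular_seq hs1 hs2 e12.
have {}hs : homogeneous (b - a) s by hdeg.
have s2E : s2 = xS X x2 ^+ n2 * s.
  apply/eqP; rewrite -subr_eq0; apply/eqP.
  apply: (@xS_regular _ _ X (b + xL X x2 *+ n2 - a) x1 n1) => //; first by hdeg.
  by rewrite mulrBr -e12 s1E; ring.
exists s; split=> //; apply: sections_eq => //.
- by move=> f g gf; rewrite res_act // ce.
- apply: (@act_pow_inj _ _ _ F D1 n1 _ _ _ _ erefl); rewrite e1 s1E.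
  by rewrite gactA //=; hdeg.
- apply: (@act_pow_inj _ _ _ F D2 n2 _ _ _ _ erefl); rewrite e2 s2E.
  by rewrite gactA //=; hdeg.
Qed.

Lemma frame_hom_sections (G : qcoh X) b (w : forall f, G f b) (u : qhom G F) :
  compat w -> exists s, homogeneous (b - a) s /\ forall f, u f b (w f) = gact b s (e f).
Proof.
by move=> cw; apply: frame_sections => f g gf; rewrite -hfun_res // cw.
Qed.

Lemma frame_endo_scalar (u : qhom F F) : exists c : k,
  forall f b (m : F f b), u f b m = gact b (kS X c) m.
Proof.
have [ce gen _] := he.
have [s []] := frame_hom_sections u ce; rewrite subrr => /homog0_scalar[c ->] uE.
exists c => f b m; have [n [r [hr mr]]] := gen f b m.
apply: (@act_pow_inj _ _ _ F f n b _ _ _ erefl).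
rewrite -gfun_act ?mr; last by hdeg.
rewrite gfun_act // uE !gactA; [|hdeg|hdeg|hdeg|hdeg].
rewrite [LHS](_ : _ = gact (b + sodeg f *+ n) (kS X c) (gact (b + sodeg f *+ n) r (e f))).
  by rewrite -mr gactA; [rewrite mulrC|hdeg|hdeg].
by rewrite gactA; [rewrite mulrC|hdeg|hdeg].
Qed.

Lemma frame_hom_zero (G : qcoh X) b : has_frame G b -> ~ leL 0 (b - a) ->
  forall u : qhom G F, hom_zero u.
Proof.
move=> [w hw] nle u; have [cw gen _] := hw.
have [s [hs uE]] := frame_hom_sections u cw.
have s0 : s = 0 by exact: homog_not_le nle hs.
move=> f d m; have [n [r [hr mr]]] := gen f d m.
apply: (@act_pow_eq0 _ _ _ F f n d _ _ erefl).
rewrite -gfun_act ?mr; last by hdeg.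
by rewrite gfun_act // uE s0 gact0l gact0r.
Qed.
End Frame.

(* A socle monomial is not a Cech coboundary. *)
Lemma frame_cech l (F : qcoh X) a (e : forall f, F f a) d n (c : k) (b : 'X_{1..t})
    (m1 : F D1 d) (m2 : F D2 d) :
  (forall i, l i <= wt X i - 1)%N -> (wt X x1 <= n)%N -> (wt X x2 <= n)%N ->
  (forall i, (b i <= l i)%N) -> frame e ->
  d = a + wdeg X b + (omegaL X - xsum X l) ->
  gact (d + sodeg D12 *+ n) ((D12 : S X) ^+ n) (res D12 m1 - res D12 m2) =
    gact (d + sodeg D12 *+ n) (kS X c * (mS X b * mS X (socle_mnm X l n))) (e D12) ->
  c = 0.
Proof.
move=> ll w1n w2n bl he dE eqm; have [ce gen _] := he.
have [n1 [s1 [hs1 e1]]] := gen D1 d m1; have [n2 [s2 [hs2 e2]]] := gen D2 d m2.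
rewrite /= in hs1 hs2 e1 e2 eqm.
have e1' := congr1 (@res _ _ _ F D1 D12 _) e1.
have e2' := congr1 (@res _ _ _ F D2 D12 _) e2.
rewrite !res_act ?(ce _ _ D12_D1) // in e1'; try exact: D12_D1; try by hdeg.
rewrite !res_act ?(ce _ _ D12_D2) // in e2'; try exact: D12_D2; try by hdeg.
pose N := (n1 + n2)%N.
have hM := socle_homog ll w1n w2n.
pose q := d + (xL X x1 + xL X x2) *+ (n + N).
apply: (@socle_notin _ _ X l ll n N (q - a) c b) => //.
(* The numerators of s1 / x_1^n1 - s2 / x_2^n2 over the common denominator (x_1 x_2)^(n + N). *)
exists (- (xS X x2 ^+ (n + n1) * s2)), (xS X x1 ^+ (n + n2) * s1); split.
- by rewrite /q /N; hdeg.
- by rewrite /q /N; hdeg.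
apply/eqP; rewrite -subr_eq0; apply/eqP.
have hL : homogeneous (q - a) ((xS X x1 * xS X x2) ^+ N *
    (kS X c * (mS X b * mS X (socle_mnm X l n)))) by rewrite /q dE; hdeg.
have hR1 : homogeneous (q - a) (xS X x1 ^+ (n + N) * (xS X x2 ^+ (n + n1) * s2)).
  by rewrite /q /N; hdeg.
have hR2 : homogeneous (q - a) (xS X x2 ^+ (n + N) * (xS X x1 ^+ (n + n2) * s1)).
  by rewrite /q /N; hdeg.
apply: (frame_inj_D12 he (b := q)).
  by rewrite mulrN; exact: homogD hL (homogN (homogD (homogN hR1) hR2)).
rewrite mulrN gactBl //; last exact: homogD (homogN hR1) hR2.
rewrite -(@gactA _ _ _ _ _ (d + (xL X x1 + xL X x2) *+ n)); first last.
- by rewrite /q /N; hdeg.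
- by rewrite dE; hdeg.
rewrite -eqm gactA; [|hdeg|rewrite /q /N; hdeg].
rewrite gactBr; last by rewrite /q /N; hdeg.
rewrite gactDl; [|exact: homogN hR1|exact: hR2].
rewrite gactNl // !mulrA -!exprD.
rewrite -[X in _ - (_ + X)](@gactA _ _ _ _ _ (d + xL X x1 *+ n1)); first last.
- by rewrite /q /N; hdeg.
- by hdeg.
rewrite -[X in _ - (- X + _)](@gactA _ _ _ _ _ (d + xL X x2 *+ n2)); first last.
- by rewrite /q /N; hdeg.
- by hdeg.
rewrite -e1' -e2' !gactA; [|hdeg|rewrite /q /N; hdeg|hdeg|rewrite /q /N; hdeg].
rewrite opprD opprK addrACA.
set A1 := gact q _ (res D12 m1); set A2 := gact q _ (res D12 m1).
set B1 := gact q _ (res D12 m2); set B2 := gact q _ (res D12 m2).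
have -> : A2 = A1 by rewrite /A1 /A2; congr gact; rewrite /N exprMn !exprD; ring.
have -> : B2 = B1 by rewrite /B1 /B2; congr gact; rewrite /N exprMn !exprD; ring.
by zmod.
Qed.
End FramedSheaves.

(** * Endomorphisms of orthogonal sums of line bundles *)

Section OrthogonalSums.
Variables (k : closedFieldType) (t : nat) (X : wpl k t).
Variables (J : finType) (A : J -> qcoh X) (a : J -> L X).
Hypothesis fA : forall j, has_frame (A j) (a j).

Lemma frames_orthogonal : (forall i j, i != j -> ~ leL 0 (a i - a j)) ->
  hom_orthogonal A.
Proof.
move=> nle i j ij u; have [e he] := fA j.
exact: (frame_hom_zero he (fA i) (@nle i j ij)).
Qed.

(** The off-diagonal entries of the matrix of u vanish by orthogonality; the diagonal ones lie in
    S_0 = k. *)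
Lemma dsum_endo_scalar (u : qhom (dsum A) (dsum A)) : hom_orthogonal A ->
  exists c : J -> k, forall f b (m : dsum A f b) j,
    u f b m j = gact b (kS X (c j)) (m j).
Proof.
move=> orth; have entry i j : exists w : qhom (A i) (A j),
    forall f b m, w f b m = u f b (dsum_in A i f b m) j.
  have [w1 w1E] := qcomp_key u (dsum_in A i).
  have [w2 w2E] := qcomp_key (dsum_proj A j) w1.
  by exists w2 => f b m; rewrite -w2E -w1E.
have diag j : exists c : k, forall f b (m : A j f b),
    u f b (dsum_in A j f b m) j = gact b (kS X c) m.
  have [w wE] := entry j j; have [e he] := fA j.
  by have [c cE] := frame_endo_scalar he w; exists c => f b m; rewrite -wE.
exists (fun j => sval (cid (diag j))) => f b m j; case: cid => /= c cE.
rewrite {1}(dsum_decomp m) gfun_sum (dprod_sum (V := fun i => A i f b)).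
rewrite (bigD1 j) //= cE big1 ?addr0 // => i ij.
by have [w wE] := entry i j; rewrite -wE orth.
Qed.
End OrthogonalSums.

(** * Short exact sequences *)

Section ExactSequences.
Variables (k : closedFieldType) (t : nat) (X : wpl k t).

Local Notation x1 := (idx1 X).
Local Notation x2 := (idx2 X).
Local Notation D1 := (so_x X x1).
Local Notation D2 := (so_x X x2).

(** Indecomposability only tests decompositions into vector bundles, so the outer terms of a split
    sequence must be recognized as such. *)
Lemma vector_bundle_of_frame (F : qcoh X) a : has_frame F a -> vector_bundle F.
Proof.
move=> hF; exists 2, (fun i : 'I_2 => if i == ord0 then D1 else D2); split.
  move=> g; have [N [A [B [_ _ e]]]] := so_radical g 1.
  exists N, (fun i : 'I_2 => if i == ord0 then A else B).
  by rewrite e !big_ord_recl big_ord0 /= addr0 !expr1 ![_ * xS X _]mulrC.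
have [u [v [vu uv]]] : isomorphic (shift (structure_sheaf X) (- a)) F.
  apply: frame_iso hF; have := frame_shift (- a) (frame_structure_sheaf X).
  by rewrite sub0r opprK.
move=> i; set h := if _ then _ else _.
exists 1%N, (fun=> - a), (fun=> hfun u h) => b m.
exists (fun=> v h b m); split; first by rewrite big_ord1 uv.
move=> c; rewrite big_ord1 => ->; apply: functional_extensionality_dep => j.
by rewrite (ord1 j) vu.
Qed.

Lemma qhom_lincomb (E G : qcoh X) (I : finType) (B : I -> qcoh X) (w : qhom E G)
    (q : forall i, qhom E (B i)) (r : forall i, qhom (B i) G) :
  exists w' : qhom E G, forall f b m,
    w' f b m = w f b m - \sum_i r i f b (q i f b m).
Proof.
pose w' f b (m : E f b) := w f b m - \sum_i r i f b (q i f b m).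
have wD f b (m m' : E f b) : w' f b (m + m') = w' f b m + w' f b m'.
  rewrite /w' gfunD (eq_bigr (fun i => r i f b (q i f b m) + r i f b (q i f b m'))).
    by rewrite big_split opprD addrACA.
  by move=> i _; rewrite !gfunD.
have wact f b c s (m : E f b) : homogeneous (c - b) s ->
    w' f c (gact c s m) = gact c s (w' f b m).
  move=> hs; rewrite /w' gactBr // gact_sumr // gfun_act //; congr (_ - _).
  by apply: eq_bigr => i _; rewrite !gfun_act.
have wres f g b (m : E f b) : sub_open g f -> w' g b (res g m) = res g (w' f b m).
  move=> gf; rewrite /w' resB // hfun_res //; congr (_ - _).
  by rewrite res_sum //; apply: eq_bigr => i _; rewrite !hfun_res.
by exists (@Qhom k t X E G (fun f => Ghom (wD f) (wact f)) wres).
Qed.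

Section ShortExact.
Variables (A E C : qcoh X) (u : qhom A E) (v : qhom E C).
Hypothesis uv_exact : short_exact u v.

Lemma exact_inj f b (m : A f b) : u f b m = 0 -> m = 0.
Proof.
by case: uv_exact => uinj _ _ um; apply: uinj; rewrite um gfun0.
Qed.

Lemma exact_comp0 f b (m : A f b) : v f b (u f b m) = 0.
Proof. by case: uv_exact => _ mid _; apply/mid; exists m. Qed.

Lemma exact_lift f b (m : E f b) : v f b m = 0 -> exists m', u f b m' = m.
Proof. by case: uv_exact => _ mid _ /mid. Qed.

Lemma exact_factor_sections b (m : forall f, E f b) : compat m ->
  (forall f, v f b (m f) = 0) ->
  exists m' : forall f, A f b, compat m' /\ forall f, u f b (m' f) = m f.
Proof.
move=> cm vm; pose m' f := sval (cid (exact_lift (vm f))).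
have m'E f : u f b (m' f) = m f by rewrite /m'; case: cid.
exists m'; split=> // f g gf; case: uv_exact => uinj _ _; apply: uinj.
by rewrite hfun_res // !m'E cm.
Qed.

Lemma exact_factor (G : qcoh X) (w : qhom E G) :
  (forall f b m, w f b (u f b m) = 0) ->
  exists w' : qhom C G, forall f b m, w' f b (v f b m) = w f b m.
Proof.
move=> wu; pose R f b (x : C f b) (y : G f b) := exists m, v f b m = x /\ w f b m = y.
have [_ _ sur] := uv_exact; have [||||| w' w'P] := @qhom_of_graph _ _ _ C G R.
- by move=> f b x; have [m mx] := sur f b x; exists (w f b m), m.
- move=> f b x1 y1 x2 y2 [m1 [<- <-]] [m2 [<- <-]]; exists (m1 - m2).
  by rewrite !gfunB.
- by move=> f b y [m [/exact_lift[m' <-] <-]]; rewrite wu.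
- by move=> f b c s x y hs [m [<- <-]]; exists (gact c s m); rewrite !gfun_act.
- by move=> f g b x y gf [m [<- <-]]; exists (res g m); rewrite !hfun_res.
exists w' => f b m; have [m' [vm wm]] := w'P f b (v f b m).
have /exact_lift[m1 m1E] : v f b (m - m') = 0 by rewrite gfunB vm subrr.
by rewrite -wm -(subrK m' m) gfunD -m1E wu add0r.
Qed.

Lemma exact_split (s : qhom C E) : (forall f b m, v f b (s f b m) = m) ->
  is_dsum (fun b : bool => if b then A else C) E.
Proof.
move=> vs; exists (fun b => if b as b' return qhom (if b' then A else C) E
  then u else s).
move=> f b m; have /exact_lift[m1 m1E] : v f b (m - s f b (v f b m)) = 0.
  by rewrite gfunB vs subrr.
exists (fun x => if x as x' return (if x' then A else C) f b then m1 else v f b m).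
split; first by rewrite big_bool /= m1E subrK.
move=> c; rewrite big_bool /= => e.
have vm : v f b m = c false by rewrite e gfunD exact_comp0 add0r vs.
apply: functional_extensionality_dep => -[] //=; case: uv_exact => uinj _ _.
by apply: uinj; rewrite m1E vm e addrK.
Qed.
End ShortExact.
End ExactSequences.

(** * Extensions of line bundles *)

Section Extensions.
Variables (k : closedFieldType) (t : nat) (X : wpl k t) (l : 'I_t -> nat).
Hypothesis ll : forall i, (l i <= wt X i - 1)%N.
Implicit Types (b d : L X) (s r : S X) (f g h : sopen X).

Local Notation x1 := (idx1 X).
Local Notation x2 := (idx2 X).
Local Notation D1 := (so_x X x1).
Local Notation D2 := (so_x X x2).
Local Notation D12 := (so_mul D1 D2).
Local Notation x12 := (xL X x1 + xL X x2).

Variables (A E C : qcoh X) (u : qhom A E) (v : qhom E C).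
Hypothesis uv_exact : short_exact u v.
Variables (a c : L X) (al : forall f, A f a) (ga : forall f, C f c).
Hypotheses (hal : frame al) (hga : frame ga).
Hypothesis acE : c = a + (omegaL X - xsum X l).

Let cal : compat al. Proof. by case: hal. Qed.
Let cga : compat ga. Proof. by case: hga. Qed.

(** Lifts of the generator of C over D(x_1) and D(x_2) differ on the overlap by a section of A, a
    cocycle for H^1(O(omega - x)). Changing the lifts normalizes it to a scalar q times the socle
    class; this q represents the extension. *)
Lemma local_splitting : exists n (q : k) (e1 : E D1 c) (e2 : E D2 c),
  [/\ (wt X x1 <= n)%N /\ (wt X x2 <= n)%N, v D1 c e1 = ga D1, v D2 c e2 = ga D2 &
    gact (c + x12 *+ n) ((xS X x1 * xS X x2) ^+ n) (res D12 e1 - res D12 e2) =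
    gact (c + x12 *+ n) (kS X q * mS X (socle_mnm X l n)) (u D12 a (al D12))].
Proof.
have [_ _ sur] := uv_exact; have [e1 ve1] := sur D1 c (ga D1).
have [e2 ve2] := sur D2 c (ga D2); have [_ gen _] := hal.
have [be beE] : exists be, u D12 c be = res D12 e1 - res D12 e2.
  apply: (exact_lift uv_exact); rewrite gfunB !hfun_res; try exact: D12_D1; try exact: D12_D2.
  by rewrite ve1 ve2 (cga (@D12_D1 _ _ X)) (cga (@D12_D2 _ _ X)) subrr.
have [n0 [s0 [hs0 es0]]] := gen D12 c be; rewrite /= in hs0 es0.
(* Enlarges the denominator so that n is at least both weights, as the results on the socle monomial
   require. *)
pose w := (wt X x1 + wt X x2)%N; pose n := (w + n0)%N.
pose s := (xS X x1 * xS X x2) ^+ w * s0.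
have hs : homogeneous (socle_deg X l n) s.
  by rewrite /socle_deg /s /n; rewrite acE in hs0; hdeg.
have es : gact (c + x12 *+ n) ((xS X x1 * xS X x2) ^+ n) be =
    gact (c + x12 *+ n) s (al D12).
  rewrite /s /n exprD -!(@gactA _ _ _ _ _ (c + x12 *+ n0)); [|hdeg|hdeg|hdeg|hdeg].
  by rewrite es0.
have w1 : (wt X x1 <= n)%N by rewrite /n /w; lia.
have w2 : (wt X x2 <= n)%N by rewrite /n /w; lia.
have hM := socle_homog ll w1 w2.
have [q [P [Q [hP hQ sE]]]] := socle_decomp ll w1 w2 hs.
rewrite /socle_deg in hP hQ hs.
(* In s = q M + x_1^n P + x_2^n Q, with M the socle monomial, the last two terms become P / x_2^n
   and Q / x_1^n. These are sections over D(x_2) and D(x_1), which the lifts e2 and e1 absorb. *)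
have [p pE] : exists p : A D2 c, gact (c + sodeg D2 *+ n) ((D2 : S X) ^+ n) p =
    gact (c + sodeg D2 *+ n) P (al D2).
  by apply: act_pow_surj.
have [p' p'E] : exists p : A D1 c, gact (c + sodeg D1 *+ n) ((D1 : S X) ^+ n) p =
    gact (c + sodeg D1 *+ n) Q (al D1).
  by apply: act_pow_surj.
rewrite /= in pE p'E.
exists n, q, (e1 - u D1 c p'), (e2 + u D2 c p); split=> //.
- by rewrite gfunB ve1 (exact_comp0 uv_exact) subr0.
- by rewrite gfunD ve2 (exact_comp0 uv_exact) addr0.
have -> : res D12 (e1 - u D1 c p') - res D12 (e2 + u D2 c p) =
    u D12 c (be - (res D12 p' + res D12 p)).
  rewrite gfunB beE gfunD resB; last exact: D12_D1.
  rewrite resD; last exact: D12_D2.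
  by rewrite !hfun_res; [zmod|exact: D12_D2|exact: D12_D1].
have pE' := congr1 (@res _ _ _ A D2 D12 _) pE.
have p'E' := congr1 (@res _ _ _ A D1 D12 _) p'E.
rewrite !res_act ?(cal (@D12_D2 _ _ X)) in pE'; try exact: D12_D2; last first.
- by hdeg.
- by rewrite acE; hdeg.
rewrite !res_act ?(cal (@D12_D1 _ _ X)) in p'E'; try exact: D12_D1; last first.
- by hdeg.
- by rewrite acE; hdeg.
have hn : homogeneous (c + x12 *+ n - c) ((xS X x1 * xS X x2) ^+ n) by hdeg.
have hqM : homogeneous (c + x12 *+ n - a) (kS X q * mS X (socle_mnm X l n)).
  by rewrite acE; hdeg.
rewrite -gfun_act // -gfun_act //; congr (u _ _ _).
rewrite gactBr // es gactDr //.
have -> : gact (c + x12 *+ n) ((xS X x1 * xS X x2) ^+ n) (res D12 p') =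
  gact (c + x12 *+ n) (xS X x2 ^+ n * Q) (al D12).
  rewrite exprMn mulrC -[LHS](@gactA _ _ _ _ _ (c + xL X x1 *+ n)); [|hdeg|hdeg].
  by rewrite p'E' gactA //; rewrite acE; hdeg.
have -> : gact (c + x12 *+ n) ((xS X x1 * xS X x2) ^+ n) (res D12 p) =
  gact (c + x12 *+ n) (xS X x1 ^+ n * P) (al D12).
  rewrite exprMn -[LHS](@gactA _ _ _ _ _ (c + xL X x2 *+ n)); [|hdeg|hdeg].
  by rewrite pE' gactA //; rewrite acE; hdeg.
rewrite -gactDl; try by rewrite acE; hdeg.
rewrite [xS X x2 ^+ n * Q + _]addrC -sE -gactBl; first last.
- by rewrite acE; hdeg.
- by rewrite acE; hdeg.
by congr gact; zmod.
Qed.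

(* The graph, over an open set, of the extension of [psi] along [u] that maps
   a local lift [eps] of the frame of [C] to [y]. *)
Section LocalExtension.
Variables (G : qcoh X) (psi : qhom A G).

Definition ext_graph h (eps : E h c) (y : G h c) b (m : E h b) (m' : G h b) :=
  exists N r (be : A h (b + sodeg h *+ N)),
  [/\ homogeneous (b + sodeg h *+ N - c) r,
      gact (b + sodeg h *+ N) ((h : S X) ^+ N) m =
        gact (b + sodeg h *+ N) r eps + u h _ be
    & gact (b + sodeg h *+ N) ((h : S X) ^+ N) m' =
        gact (b + sodeg h *+ N) r y + psi h _ be].

(** The image of m in C is r / h^N times the generator, so h^N m - r eps comes from A, where psi
    prescribes the value. *)
Lemma ext_graph_total h eps y b m : v h c eps = ga h ->
  exists m', @ext_graph h eps y b m m'.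
Proof.
have [_ gen _] := hga; move=> veps; have [N [r [hr er]]] := gen h b (v h b m).
have hN : homogeneous (b + sodeg h *+ N - b) ((h : S X) ^+ N) by hdeg.
have [be beE] : exists be, u h _ be = gact (b + sodeg h *+ N) ((h : S X) ^+ N) m -
    gact (b + sodeg h *+ N) r eps.
  by apply: (exact_lift uv_exact); rewrite gfunB !gfun_act // er veps subrr.
have [m' m'E] := @act_pow_surj _ _ _ G h N b _
  (gact (b + sodeg h *+ N) r y + psi h _ be) erefl.
by exists m', N, r, be; split=> //; rewrite beE; zmod.
Qed.

Lemma ext_graph_u h eps y b (m : A h b) : @ext_graph h eps y b (u h b m) (psi h b m).
Proof.
exists 0%N, 0, (gact (b + sodeg h *+ 0) 1 m).
have h1 : homogeneous (b + sodeg h *+ 0 - b) (1 : S X) by hdeg.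
by split; [exact: homog0|rewrite gact0l add0r gfun_act|rewrite gact0l add0r gfun_act].
Qed.

(** If r eps + u(be) = 0, applying v shows that a power of h kills r; by injectivity of u it then
    kills be too, and with both the value m'. *)
Lemma ext_graph_zero h eps y b m' : v h c eps = ga h ->
  @ext_graph h eps y b 0 m' -> m' = 0.
Proof.
have [_ _ fr] := hga; move=> veps [N [r [be [hr e0 e0']]]].
rewrite gact0r in e0; last by hdeg.
have := congr1 (v h _) e0; rewrite gfun0 gfunD gfun_act // veps (exact_comp0 uv_exact).
rewrite addr0 => /esym/(fr h _ _ hr)[p pr].
pose b' := b + sodeg h *+ N + sodeg h *+ p.
have hp : homogeneous (b' - (b + sodeg h *+ N)) ((h : S X) ^+ p) by rewrite /b'; hdeg.
have be0 : gact b' ((h : S X) ^+ p) be = 0.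
  apply: (exact_inj uv_exact); rewrite gfun_act //.
  have := congr1 (gact b' ((h : S X) ^+ p)) e0.
  by rewrite gact0r // gactDr // gactA // pr gact0l add0r => <-.
apply: (@act_pow_eq0 _ _ _ G h (p + N) b b'); first by rewrite /b'; zmod.
rewrite exprD -(@gactA _ _ _ _ _ (b + sodeg h *+ N)) //; last by hdeg.
by rewrite e0' gactDr // gactA // pr gact0l add0r -gfun_act // be0 gfun0.
Qed.

Lemma ext_graph_sub h eps y b m1 m1' m2 m2' : @ext_graph h eps y b m1 m1' ->
  ext_graph eps y m2 m2' -> ext_graph eps y (m1 - m2) (m1' - m2').
Proof.
move=> [N1 [r1 [be1 [hr1 e1' e1'']]]] [N2 [r2 [be2 [hr2 e2' e2'']]]].
pose N := (N1 + N2)%N; pose b' := b + sodeg h *+ N.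
have h1 : homogeneous (b' - (b + sodeg h *+ N1)) ((h : S X) ^+ N2).
  by rewrite /b' /N; hdeg.
have h2 : homogeneous (b' - (b + sodeg h *+ N2)) ((h : S X) ^+ N1).
  by rewrite /b' /N; hdeg.
exists N, ((h : S X) ^+ N2 * r1 - (h : S X) ^+ N1 * r2),
  (gact b' ((h : S X) ^+ N2) be1 - gact b' ((h : S X) ^+ N1) be2).
have hh1 : homogeneous (b' - c) ((h : S X) ^+ N2 * r1) by rewrite /b' /N; hdeg.
have hh2 : homogeneous (b' - c) ((h : S X) ^+ N1 * r2) by rewrite /b' /N; hdeg.
have key (H : qcoh X) (p : qhom A H) (z1 z2 : H h b) (z : H h c) :
    gact (b + sodeg h *+ N1) ((h : S X) ^+ N1) z1 =
      gact (b + sodeg h *+ N1) r1 z + p h _ be1 ->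
    gact (b + sodeg h *+ N2) ((h : S X) ^+ N2) z2 =
      gact (b + sodeg h *+ N2) r2 z + p h _ be2 ->
    gact b' ((h : S X) ^+ N) (z1 - z2) =
      gact b' ((h : S X) ^+ N2 * r1 - (h : S X) ^+ N1 * r2) z +
      p h _ (gact b' ((h : S X) ^+ N2) be1 - gact b' ((h : S X) ^+ N1) be2).
  move=> z1E z2E; rewrite gactBr; last by rewrite /b' /N; hdeg.
  rewrite {1}/N addnC exprD -(@gactA _ _ _ _ _ (b + sodeg h *+ N1)) //; last by hdeg.
  rewrite {1}/N exprD -[X in _ - X](@gactA _ _ _ _ _ (b + sodeg h *+ N2)) //; last by hdeg.
  rewrite z1E z2E !gactDr // !gactA // gfunB !gfun_act // gactBl //.
  by zmod.
by split; [exact: homogD hh1 (homogN hh2)|exact: key|exact: key].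
Qed.

Lemma ext_graph_act h eps y b d s m m' : homogeneous (d - b) s ->
  @ext_graph h eps y b m m' -> @ext_graph h eps y d (gact d s m) (gact d s m').
Proof.
move=> hs [N [r [be [hr e1' e1'']]]].
have hs' : homogeneous (d + sodeg h *+ N - (b + sodeg h *+ N)) s by hdeg.
exists N, (s * r), (gact (d + sodeg h *+ N) s be).
have key (H : qcoh X) (p : qhom A H) (z : H h b) (w : H h c) :
    gact (b + sodeg h *+ N) ((h : S X) ^+ N) z =
      gact (b + sodeg h *+ N) r w + p h _ be ->
    gact (d + sodeg h *+ N) ((h : S X) ^+ N) (gact d s z) =
      gact (d + sodeg h *+ N) (s * r) w + p h _ (gact (d + sodeg h *+ N) s be).
  move=> zE; rewrite gactA; [|hdeg|hdeg].
  rewrite mulrC -[LHS](@gactA _ _ _ _ _ (b + sodeg h *+ N)) //; last by hdeg.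
  by rewrite zE gactDr // gactA // gfun_act.
by split; [hdeg|exact: key|exact: key].
Qed.

Lemma ext_graph_res h h' eps y b m m' : sub_open h' h -> @ext_graph h eps y b m m' ->
  @ext_graph h' (res h' eps) (res h' y) b (res h' m) (res h' m').
Proof.
move=> h'h [N [r [be [hr e1' e1'']]]]; have [i [s [hs es]]] := h'h.
pose b' := b + sodeg h' *+ (i * N).
have hs' : homogeneous (b' - (b + sodeg h *+ N)) (s ^+ N) by rewrite /b'; hdeg.
exists (i * N)%N, (s ^+ N * r), (gact b' (s ^+ N) (res h' be)).
have key (H : qcoh X) (p : qhom A H) (z : H h b) (w : H h c) :
    gact (b + sodeg h *+ N) ((h : S X) ^+ N) z =
      gact (b + sodeg h *+ N) r w + p h _ be ->
    gact b' ((h' : S X) ^+ (i * N)) (res h' z) =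
      gact b' (s ^+ N * r) (res h' w) + p h' _ (gact b' (s ^+ N) (res h' be)).
  move=> zE; rewrite exprM es exprMn mulrC.
  rewrite -[LHS](@gactA _ _ _ _ _ (b + sodeg h *+ N)) //; last by hdeg.
  rewrite -res_act //; last by hdeg.
  rewrite zE resD // res_act // gactDr // gactA // gfun_act //.
  by rewrite hfun_res.
split; [rewrite /b' in hs' *; hdeg|exact: key|exact: key].
Qed.

Lemma ext_graph_fun h eps y b m m1 m2 : v h c eps = ga h ->
  @ext_graph h eps y b m m1 -> ext_graph eps y m m2 -> m1 = m2.
Proof.
move=> veps h1 h2; apply/eqP; rewrite -subr_eq0; apply/eqP.
by apply: (ext_graph_zero veps (y := y)); rewrite -(subrr m); apply: ext_graph_sub.
Qed.

(** Change of the local lift: if the pair (eps', y') already lies in the graph of (eps, y), both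
    define the same extension. This matches the two charts on the overlap. *)
Lemma ext_graph_change h eps y eps' y' b m m' : @ext_graph h eps y c eps' y' ->
  @ext_graph h eps' y' b m m' -> @ext_graph h eps y b m m'.
Proof.
move=> [N1 [r1 [be1 [hr1 e1' e1'']]]] [N2 [r2 [be2 [hr2 e2' e2'']]]].
pose N := (N1 + N2)%N; pose b' := b + sodeg h *+ N.
have h1 : homogeneous (b' - (b + sodeg h *+ N2)) ((h : S X) ^+ N1).
  by rewrite /b' /N; hdeg.
have h2 : homogeneous (b' - (c + sodeg h *+ N1)) r2.
  by rewrite /b' /N; hdeg.
exists N, (r2 * r1), (gact b' r2 be1 + gact b' ((h : S X) ^+ N1) be2).
have key (H : qcoh X) (p : qhom A H) (z : H h b) (w w' : H h c) :
    gact (c + sodeg h *+ N1) ((h : S X) ^+ N1) w' =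
      gact (c + sodeg h *+ N1) r1 w + p h _ be1 ->
    gact (b + sodeg h *+ N2) ((h : S X) ^+ N2) z =
      gact (b + sodeg h *+ N2) r2 w' + p h _ be2 ->
    gact b' ((h : S X) ^+ N) z = gact b' (r2 * r1) w +
      p h _ (gact b' r2 be1 + gact b' ((h : S X) ^+ N1) be2).
  move=> wE zE; rewrite {1}/N exprD -(@gactA _ _ _ _ _ (b + sodeg h *+ N2)) //; last by hdeg.
  rewrite zE gactDr // gactA // mulrC.
  rewrite -(@gactA _ _ _ _ _ (c + sodeg h *+ N1) _ ((h : S X) ^+ N1)) //; last by hdeg.
  by rewrite wE gactDr // gactA // gfunD !gfun_act // addrA.
split; first by rewrite /b' /N in h2 *; hdeg.
  exact: key e1' e2'.
exact: key e1'' e2''.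
Qed.
End LocalExtension.

Section Cocycle.
Variables (n : nat) (q : k) (e1 : E D1 c) (e2 : E D2 c).
Hypotheses (w1n : (wt X x1 <= n)%N) (w2n : (wt X x2 <= n)%N).
Hypotheses (ve1 : v D1 c e1 = ga D1) (ve2 : v D2 c e2 = ga D2).
Hypothesis e12 :
  gact (c + x12 *+ n) ((xS X x1 * xS X x2) ^+ n) (res D12 e1 - res D12 e2) =
  gact (c + x12 *+ n) (kS X q * mS X (socle_mnm X l n)) (u D12 a (al D12)).

Local Notation M := (mS X (socle_mnm X l n)).
Let hM : homogeneous (omegaL X - xsum X l + x12 *+ n) M := socle_homog ll w1n w2n.

Lemma cocycle_scaled d e s : homogeneous d s -> e = c + d ->
  gact (e + x12 *+ n) ((xS X x1 * xS X x2) ^+ n)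
    (gact e s (res D12 e1) - gact e s (res D12 e2)) =
  gact (e + x12 *+ n) (s * (kS X q * M)) (u D12 a (al D12)).
Proof.
move=> hs ->; rewrite -gactBr; last by hdeg.
rewrite gactA; [|hdeg|hdeg].
rewrite mulrC -[LHS](@gactA _ _ _ _ _ (c + x12 *+ n)); [|hdeg|hdeg].
by rewrite e12 gactA //; [rewrite acE|]; hdeg.
Qed.

(** For q = 0 the two lifts agree on the overlap and glue to a global lift of the generator of C,
    that is, to a section of v. *)
Lemma cocycle_split : q = 0 -> is_dsum (fun b : bool => if b then A else C) E.
Proof.
move=> q0; have [w [cw w1 w2]] : exists w : forall f, E f c,
    [/\ compat w, w D1 = e1 & w D2 = e2].
  apply: glue_sections; apply/eqP; rewrite -subr_eq0; apply/eqP.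
  apply: (@act_pow_eq0 _ _ _ E D12 n c (c + x12 *+ n)) => //.
  by rewrite [LHS]e12 q0 kS0 mul0r gact0l.
have vw : forall f, v f c (w f) = ga f.
  apply: sections_eq => //; rewrite ?w1 ?w2 //.
  by move=> f g gf; rewrite -hfun_res // cw.
have [s sE] := frame_hom hga cw; apply: (exact_split uv_exact (s := s)).
have [vs vsE] := qcomp_key v s => f b m; rewrite vsE.
by apply: (frame_hom_eq (v := qid C) hga) => g; rewrite -vsE sE vw.
Qed.

Section InIdeal.
Variables (d : L X) (s : S X).
Hypotheses (hs : homogeneous d s) (Js : in_J n (d + socle_deg X l n) (s * M)).

(** The connecting map sends s to q s M / (x_1 x_2)^n, by hypothesis the coboundary q P / x_2^n + q
    Q / x_1^n. Correcting s e1 and s e2 by these two terms makes them agree on the overlap. *)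
Lemma lift_section : exists w : forall f, E f (c + d),
  compat w /\ forall f, v f (c + d) (w f) = gact (c + d) s (ga f).
Proof.
have [P [Q [hP hQ sE]]] := Js; rewrite /socle_deg in hP hQ.
have [p pE] : exists p : A D2 (c + d),
    gact (c + d + sodeg D2 *+ n) ((D2 : S X) ^+ n) p =
    gact (c + d + sodeg D2 *+ n) (kS X q * P) (al D2).
  by apply: act_pow_surj.
have [p' p'E] : exists p : A D1 (c + d),
    gact (c + d + sodeg D1 *+ n) ((D1 : S X) ^+ n) p =
    gact (c + d + sodeg D1 *+ n) (kS X q * Q) (al D1).
  by apply: act_pow_surj.
rewrite /= in pE p'E.
have pE' := congr1 (@res _ _ _ A D2 D12 _) pE.
have p'E' := congr1 (@res _ _ _ A D1 D12 _) p'E.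
rewrite !res_act ?(cal (@D12_D2 _ _ X)) in pE'; try exact: D12_D2; last first.
- by hdeg.
- by rewrite acE; hdeg.
rewrite !res_act ?(cal (@D12_D1 _ _ X)) in p'E'; try exact: D12_D1; last first.
- by hdeg.
- by rewrite acE; hdeg.
have hs' : homogeneous (c + d - c) s by hdeg.
have [w [cw w1 w2]] : exists w : forall f, E f (c + d), [/\ compat w,
    w D1 = gact (c + d) s e1 - u D1 (c + d) p' &
    w D2 = gact (c + d) s e2 + u D2 (c + d) p].
  apply: glue_sections; apply/eqP; rewrite -subr_eq0; apply/eqP.
  apply: (@act_pow_eq0 _ _ _ E D12 n (c + d) (c + d + x12 *+ n)) => //.
  rewrite resB ?resD; try exact: D12_D1; try exact: D12_D2.
  rewrite !res_act //; try exact: D12_D1; try exact: D12_D2.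
  rewrite -!hfun_res; try exact: D12_D1; try exact: D12_D2.
  set z1 := gact _ s (res D12 e1); set z2 := gact _ s (res D12 e2).
  set y1 := u D12 _ _; set y2 := u D12 _ _.
  have -> : z1 - y1 - (z2 + y2) = z1 - z2 - (y1 + y2) by zmod.
  have hn : homogeneous (c + d + x12 *+ n - (c + d)) ((xS X x1 * xS X x2) ^+ n) by hdeg.
  rewrite [LHS]gactBr; last exact: hn.
  rewrite (@cocycle_scaled d) // gactDr; last exact: hn.
  rewrite /y1 /y2 -!gfun_act //; last by rewrite acE; hdeg.
  have -> : gact (c + d + x12 *+ n) ((xS X x1 * xS X x2) ^+ n) (res D12 p') =
      gact (c + d + x12 *+ n) (kS X q * (xS X x2 ^+ n * Q)) (al D12).
    rewrite exprMn mulrC -[LHS](@gactA _ _ _ _ _ (c + d + xL X x1 *+ n)); [|hdeg|hdeg].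
    by rewrite p'E' gactA; [rewrite mulrCA|rewrite acE; hdeg|hdeg].
  have -> : gact (c + d + x12 *+ n) ((xS X x1 * xS X x2) ^+ n) (res D12 p) =
      gact (c + d + x12 *+ n) (kS X q * (xS X x1 ^+ n * P)) (al D12).
    rewrite exprMn -[LHS](@gactA _ _ _ _ _ (c + d + xL X x2 *+ n)); [|hdeg|hdeg].
    by rewrite pE' gactA; [rewrite mulrCA|rewrite acE; hdeg|hdeg].
  rewrite -gfunD -gactDl; try by rewrite acE; hdeg.
  by rewrite -mulrDr [xS X x2 ^+ n * Q + _]addrC -sE mulrCA subrr.
exists w; split=> //; apply: sections_eq.
- by move=> f g gf; rewrite -hfun_res // cw.
- by move=> f g gf; rewrite res_act // cga.
- by rewrite w1 gfunB (exact_comp0 uv_exact) subr0 gfun_act // ve1.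
- by rewrite w2 gfunD (exact_comp0 uv_exact) addr0 gfun_act // ve2.
Qed.
End InIdeal.

(** If w lifts r x^b, its differences from r x^b e1 and r x^b e2 are sections of A over the two
    charts, and they exhibit - q r x^b times the socle class as a coboundary. *)
Lemma lift_section_only_if (r : k) (b : 'X_{1..t}) d d' (w : forall f, E f d') :
  d' = c + d -> (forall i, (b i <= l i)%N) -> wdeg X b = d -> compat w ->
  (forall f, v f d' (w f) = gact d' (kS X r * mS X b) (ga f)) ->
  q * r = 0.
Proof.
move=> d'E; subst d' => bl bd cw vw.
have hb : homogeneous d (mS X b) by rewrite -bd; apply: homog_mS.
have hb' : homogeneous (c + d - c) (kS X r * mS X b) by hdeg.
have [be1 be1E] : exists m, u D1 (c + d) m = w D1 - gact (c + d) (kS X r * mS X b) e1.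
  by apply: (exact_lift uv_exact); rewrite gfunB vw gfun_act // ve1 subrr.
have [be2 be2E] : exists m, u D2 (c + d) m = w D2 - gact (c + d) (kS X r * mS X b) e2.
  by apply: (exact_lift uv_exact); rewrite gfunB vw gfun_act // ve2 subrr.
have uinj : injective (u D12 (c + d + x12 *+ n)).
  by case: uv_exact => h _ _ m m'; apply: h.
suff /eqP : - (q * r) = 0 by rewrite oppr_eq0 => /eqP.
apply: (frame_cech (l := l) (b := b) (m1 := be1) (m2 := be2) ll w1n w2n bl hal).
  by rewrite acE bd; zmod.
apply: uinj; rewrite /= !gfun_act; first last.
- by hdeg.
- by rewrite acE; hdeg.
rewrite gfunB !hfun_res; try exact: D12_D1; try exact: D12_D2.
rewrite be1E be2E !resB; try exact: D12_D1; try exact: D12_D2.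
rewrite !res_act //; try exact: D12_D1; try exact: D12_D2.
rewrite (cw _ _ (@D12_D1 _ _ X)) (cw _ _ (@D12_D2 _ _ X)).
set z1 := gact _ _ (res D12 e1); set z2 := gact _ _ (res D12 e2).
have -> : w D12 - z1 - (w D12 - z2) = - (z1 - z2) by zmod.
rewrite gactNr; last by hdeg.
have hb2 : homogeneous d (kS X r * mS X b) by hdeg.
rewrite (@cocycle_scaled d) // -gactNl; last by rewrite acE; hdeg.
congr gact; rewrite /kS mpolyCN mpolyCM raddfN /= rmorphM /=; ring.
Qed.
Section Extend.
Variables (G : qcoh X) (d e : L X) (g : forall f, G f d) (s : S X).
Hypotheses (hg : frame g) (ad : a = d + e) (hs : homogeneous e s).

(** Multiplication by s on A extends to E once values y1, y2 for the lifts e1, e2 are found whose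
    difference on the overlap is the image q s M / (x_1 x_2)^n of the cocycle. *)
Lemma extend_hom : in_J n (e + socle_deg X l n) (s * M) ->
  exists w : qhom E G, forall f, w f a (u f a (al f)) = gact a s (g f).
Proof.
move=> [P [Q [hP hQ sE]]]; rewrite /socle_deg in hP hQ; have [cg _ _] := hg.
have has : homogeneous (a - d) s by rewrite ad; hdeg.
have [psi psiE] : exists psi : qhom A G, forall f, psi f a (al f) = gact a s (g f).
  by apply: frame_hom hal _ => f h hf; rewrite res_act // cg.
(* As s M = x_1^n P + x_2^n Q, the choice is y1 = q Q / x_1^n and y2 = - q P / x_2^n. *)
have [y1 y1E] : exists y : G D1 c, gact (c + sodeg D1 *+ n) ((D1 : S X) ^+ n) y =
    gact (c + sodeg D1 *+ n) (kS X q * Q) (g D1).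
  by apply: act_pow_surj.
have [y2 y2E] : exists y : G D2 c, gact (c + sodeg D2 *+ n) ((D2 : S X) ^+ n) y =
    gact (c + sodeg D2 *+ n) (- (kS X q * P)) (g D2).
  by apply: act_pow_surj.
rewrite /= in y1E y2E.
have y1E' := congr1 (@res _ _ _ G D1 D12 _) y1E.
have y2E' := congr1 (@res _ _ _ G D2 D12 _) y2E.
have hQ' : homogeneous (c + xL X x1 *+ n - d) (kS X q * Q) by rewrite acE ad; hdeg.
have hP' : homogeneous (c + xL X x2 *+ n - d) (- (kS X q * P)) by rewrite acE ad; hdeg.
rewrite !res_act ?(cg _ _ (@D12_D1 _ _ X)) // in y1E'; try exact: D12_D1; last by hdeg.
rewrite !res_act ?(cg _ _ (@D12_D2 _ _ X)) // in y2E'; try exact: D12_D2; last by hdeg.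
(* The pair (e1, y1) lies in the graph determined by (e2, y2), so the two local extensions coincide
   on the overlap. *)
have h12 : ext_graph psi (res D12 e2) (res D12 y2) (res D12 e1) (res D12 y1).
  exists n, ((xS X x1 * xS X x2) ^+ n), (gact (c + x12 *+ n) (kS X q * M) (al D12)).
  have hqM : homogeneous (c + x12 *+ n - a) (kS X q * M) by rewrite acE; hdeg.
  have hn : homogeneous (c + x12 *+ n - c) ((xS X x1 * xS X x2) ^+ n) by hdeg.
  split; first exact: hn.
    by rewrite /= gfun_act // -e12 gactBr //; zmod.
  rewrite /= gfun_act // psiE gactA //.
  have -> : gact (c + x12 *+ n) ((xS X x1 * xS X x2) ^+ n) (res D12 y1) =
      gact (c + x12 *+ n) (xS X x2 ^+ n * (kS X q * Q)) (g D12).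
    rewrite exprMn mulrC -[LHS](@gactA _ _ _ _ _ (c + xL X x1 *+ n)); [|hdeg|hdeg].
    by rewrite y1E' gactA //; hdeg.
  have -> : gact (c + x12 *+ n) ((xS X x1 * xS X x2) ^+ n) (res D12 y2) =
      gact (c + x12 *+ n) (xS X x1 ^+ n * (- (kS X q * P))) (g D12).
    rewrite exprMn -[LHS](@gactA _ _ _ _ _ (c + xL X x2 *+ n)); [|hdeg|hdeg].
    by rewrite y2E' gactA //; hdeg.
  have hr1 : homogeneous (c + x12 *+ n - d) (xS X x2 ^+ n * (kS X q * Q)).
    by rewrite acE ad; hdeg.
  have hr2 : homogeneous (c + x12 *+ n - d) (xS X x1 ^+ n * - (kS X q * P)).
    by rewrite acE ad; hdeg.
  rewrite -gactDl //; last by rewrite acE; hdeg.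
  have -> : kS X q * M * s = kS X q * (s * M) by ring.
  by congr gact; rewrite sE; ring.
(* A value over D(f) is characterized by its restrictions to D(f x_1) and D(f x_2), where the local
   extensions exist. *)
pose R f b (m : E f b) (m' : G f b) :=
  ext_graph psi (res (so_mul f D1) e1) (res (so_mul f D1) y1)
    (res (so_mul f D1) m) (res (so_mul f D1) m') /\
  ext_graph psi (res (so_mul f D2) e2) (res (so_mul f D2) y2)
    (res (so_mul f D2) m) (res (so_mul f D2) m').
have f1 f : sub_open (so_mul f D1) D1 := so_mul_r f D1.
have f2 f : sub_open (so_mul f D2) D2 := so_mul_r f D2.
have ff1 f : sub_open (so_mul f D1) f := so_mul_l f D1.
have ff2 f : sub_open (so_mul f D2) f := so_mul_l f D2.
have v1 h : sub_open h D1 -> v h c (res h e1) = ga h.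
  by move=> hh; rewrite hfun_res // ve1 cga.
have v2 h : sub_open h D2 -> v h c (res h e2) = ga h.
  by move=> hh; rewrite hfun_res // ve2 cga.
have [||||| w wP] := @qhom_of_graph _ _ _ E G R.
- move=> f b m.
  have [m1 m1P] := ext_graph_total psi (res (so_mul f D1) y1) (res (so_mul f D1) m)
    (v1 _ (f1 f)).
  have [m2 m2P] := ext_graph_total psi (res (so_mul f D2) y2) (res (so_mul f D2) m)
    (v2 _ (f2 f)).
  pose W := so_mul (so_mul f D1) D2.
  have W1 : sub_open W (so_mul f D1) := so_mul_l _ _.
  have W2 : sub_open W (so_mul f D2) by apply: so_mul_sub; apply: so_mul_l.
  have W12 : sub_open W D12 by apply: so_mul_sub; apply: so_mul_r.
  have [m' [m'1 m'2]] : exists m' : G f b,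
      res (so_mul f D1) m' = m1 /\ res (so_mul f D2) m' = m2.
    apply: sheaf_glue; have := ext_graph_res W1 m1P; have := ext_graph_res W2 m2P.
    rewrite !(res_comp _ (f1 f) W1) !(res_comp _ (f2 f) W2).
    rewrite (res_comp _ (ff1 f) W1) (res_comp _ (ff2 f) W2) => h2 h1.
    have := ext_graph_res W12 h12.
    rewrite !(res_comp _ (@D12_D1 _ _ X) W12) !(res_comp _ (@D12_D2 _ _ X) W12).
    move=> /ext_graph_change/(_ h1) h1'; apply: ext_graph_fun h1' h2.
    by apply: v2; apply: sub_open_trans (f2 f) W2.
  by exists m'; split; rewrite ?m'1 ?m'2.
- move=> f b m1 m1' m2 m2' [h1 h2] [h1' h2']; split; rewrite !resB //.
    exact: ext_graph_sub.
  exact: ext_graph_sub.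
- move=> f b m' [h1 h2]; rewrite res0 // in h1; rewrite res0 // in h2.
  apply: sheaf_separated; first exact: ext_graph_zero (v1 _ (f1 f)) h1.
  exact: ext_graph_zero (v2 _ (f2 f)) h2.
- move=> f b b' r m m' hr [h1 h2]; split; rewrite !res_act //; exact: ext_graph_act.
- move=> f f' b m m' f'f [h1 h2].
  have s1 := so_mul_sub D1 f'f; have s2 := so_mul_sub D2 f'f; split.
    have := ext_graph_res s1 h1; rewrite !(res_comp _ (f1 f) s1) !(res_comp _ (ff1 f) s1).
    by rewrite !(res_comp _ f'f (ff1 f')).
  have := ext_graph_res s2 h2; rewrite !(res_comp _ (f2 f) s2) !(res_comp _ (ff2 f) s2).
  by rewrite !(res_comp _ f'f (ff2 f')).
exists w => f; rewrite -psiE; have [h1 h2] := wP f a (u f a (al f)).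
rewrite -hfun_res // in h1; rewrite -hfun_res // in h2.
apply: sheaf_separated_eq.
  by rewrite -[RHS]hfun_res //; exact: (ext_graph_fun (v1 _ (f1 f)) h1 (ext_graph_u _ _ _ _)).
by rewrite -[RHS]hfun_res //; exact: (ext_graph_fun (v2 _ (f2 f)) h2 (ext_graph_u _ _ _ _)).
Qed.

(** The values of w at e1 and e2 exhibit q r x^b times the socle class as a coboundary in G. *)
Lemma extend_hom_only_if (w : qhom E G) (r : k) (b : 'X_{1..t}) :
  (forall i, (b i <= l i)%N) -> wdeg X b = e -> s = kS X r * mS X b ->
  (forall f, w f a (u f a (al f)) = gact a s (g f)) -> q * r = 0.
Proof.
move=> bl be sE wE; have has : homogeneous (a - d) s by rewrite ad; hdeg.
apply: (frame_cech (l := l) (b := b) (m1 := w D1 c e1) (m2 := w D2 c e2) ll w1n w2n bl hg).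
  by rewrite acE ad be; zmod.
rewrite -!hfun_res; try exact: D12_D1; try exact: D12_D2.
rewrite -gfunB /= -gfun_act; last by hdeg.
rewrite e12 gfun_act; last by rewrite acE; hdeg.
rewrite wE gactA //; last by rewrite acE; hdeg.
by congr gact; rewrite sE kSM; ring.
Qed.
End Extend.
End Cocycle.
End Extensions.

(** * Cover and hull *)

Lemma big_option_sum (V : nmodType) (T : finType) (F : option T -> V) :
  \sum_o F o = F None + \sum_j F (Some j).
Proof.
rewrite (bigD1 None) //=; congr (_ + _).
rewrite (reindex_omap Some id) => [|[]//].
by apply: eq_bigl => j; rewrite eqxx.
Qed.

Section CoverHull.
Variables (k : closedFieldType) (t : nat) (X : wpl k t) (l : 'I_t -> nat).
Hypothesis ll : forall i, (l i <= wt X i - 1)%N.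
Hypothesis max_le : (\sum_(i < t) (l i == wt X i - 1) + 3 <= t)%N.
Implicit Types (b d : L X) (f g : sopen X) (j : nonmax X l).

Local Notation D1 := (so_x X (idx1 X)).

Lemma homog_mod_nonmax d (s : S X) : homogeneous d s ->
  exists (c : k) (b : 'X_{1..t}) (g : nonmax X l -> S X),
  [/\ forall j, homogeneous (d - xL X (val j) *+ (1 + l (val j))) (g j),
      s = kS X c * mS X b + \sum_j xS X (val j) ^+ (1 + l (val j)) * g j
    & c = 0 \/ (forall i, (b i <= l i)%N) /\ wdeg X b = d].
Proof.
move=> /(homog_mod_ideal ll max_le)[c [b [g [hg g0 sE cb]]]].
exists c, b, (fun j => g (val j)); split=> //.
rewrite sE; congr (_ + _); rewrite (bigID (fun i => l i != (wt X i - 1)%N)) /=.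
rewrite [X in _ + X]big1 => [|i]; last by rewrite negbK => /eqP/g0 ->; rewrite mulr0.
rewrite addr0 (reindex_omap val (insub : 'I_t -> option (nonmax X l))).
  by apply: eq_bigl => j; rewrite (valP j) valK eqxx.
by move=> i li; rewrite insubT.
Qed.

(** Otherwise c - 1 is invertible in k and kills m. *)
Lemma scalar_fix_one (M : gmod X) b (m : M b) c :
  gact b (kS X c) m = m -> m <> 0 -> c = 1.
Proof.
move=> cm m0; apply/eqP; apply/negPn/negP => c1; apply: m0.
have hk (r : k) : homogeneous (b - b) (kS X r) by hdeg.
have h1 : homogeneous (b - b) (1 : S X) by hdeg.
have u : c - 1 != 0 by rewrite subr_eq0.
rewrite -[m]gact1 -(kS1 X) -(mulVf u) kSM -(@gactA _ _ _ _ b b) //.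
have -> : kS X (c - 1) = kS X c - 1.
  by rewrite -(kS1 X) /kS mpolyCB raddfB.
by rewrite gactBl // cm gact1 subrr gact0r.
Qed.

Lemma xS_nonmax_neq0 j : xS X (val j) ^+ (1 + l (val j)) <> 0.
Proof.
move=> e0; have r : reduced X (U_(val j) *+ (1 + l (val j)))%MM.
  move=> i _; rewrite mulmnE mnm1E; case: (eqVneq (val j) i) => [<-|_].
    rewrite mul1n; have := ll (val j); have := valP j.
    by have := wt_gt0 X (val j); lia.
  by rewrite mul0n wt_gt0.
have := @mS_regular _ _ X 1 _ 0 (idx1 X) isT r.
by rewrite expr0 mul1r kS1 mul1r mSXn e0 => /(_ erefl)/eqP; rewrite oner_eq0.
Qed.

Lemma has_frame_eq (F : qcoh X) b d : has_frame F b -> b = d -> has_frame F d.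
Proof. by move=> ? <-. Qed.

Variables (Lb E : qcoh X) (d0 : L X).
Hypothesis hLb : has_frame Lb d0.

Local Notation a := (d0 - omegaL X).
Local Notation c := (d0 - xsum X l).
Local Notation A := (shift Lb (omegaL X)).
Local Notation C := (shift Lb (xsum X l)).

(** Degrees of generators: one of Lb(y) sits in degree d0 - y, so the signs are opposite to those of
    the twists. *)
Definition cover_deg (o : option (nonmax X l)) : L X :=
  if o is Some j then c + xL X (val j) *+ (1 + l (val j)) else a.

Definition hull_deg (o : option (nonmax X l)) : L X :=
  if o is Some j then a - xL X (val j) *+ (1 + l (val j)) else c.

Lemma cover_frame o : has_frame (@cover_summand k t X Lb l o) (cover_deg o).
Proof.
by case: o => [j|] /=; apply: has_frame_eq (frame_shift _ hLb) _; zmod.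
Qed.

Lemma hull_frame o : has_frame (@hull_summand k t X Lb l o) (hull_deg o).
Proof.
by case: o => [j|] /=; apply: has_frame_eq (frame_shift _ hLb) _; zmod.
Qed.

Lemma leL_eq b d : b = d -> leL 0 b -> leL 0 d.
Proof. by move=> ->. Qed.

Lemma cover_orthogonal : hom_orthogonal (@cover_summand k t X Lb l).
Proof.
apply: (frames_orthogonal cover_frame) => -[i|] [j|] //= ij le.
- apply: (not_le_cover_cover ll (_ : val i != val j) (valP i)) => //.
  by apply: leL_eq le; zmod.
- by apply: (not_le_omega_cover ll (j := val i)); apply: leL_eq le; zmod.
- by apply: (not_le_cover_omega ll max_le (j := val j)); apply: leL_eq le; zmod.
Qed.

(** Since [hull_deg o] equals a + c - [cover_deg o], the inequalities are those for the cover with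
    the two summands exchanged. *)
Lemma hull_orthogonal : hom_orthogonal (@hull_summand k t X Lb l).
Proof.
apply: (frames_orthogonal hull_frame) => -[i|] [j|] //= ij le.
- rewrite eq_sym in ij.
  apply: (not_le_cover_cover ll (_ : val j != val i) (valP j)) => //.
  by apply: leL_eq le; zmod.
- by apply: (not_le_cover_omega ll max_le (j := val i)); apply: leL_eq le; zmod.
- by apply: (not_le_omega_cover ll (j := val j)); apply: leL_eq le; zmod.
Qed.

Variables (u : qhom A E) (v : qhom E C).
Hypothesis uv_exact : short_exact u v.


Let acE : c = a + (omegaL X - xsum X l). Proof. by zmod. Qed.

Local Notation D2 := (so_x X (idx2 X)).
Local Notation D12 := (so_mul D1 D2).
Local Notation x12 := (xL X (idx1 X) + xL X (idx2 X)).

Section Cocycle.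
Variables (al : forall f, A f a) (ga : forall f, C f c).
Hypotheses (hal : frame al) (hga : frame ga).
Variables (n : nat) (q : k) (e1 : E D1 c) (e2 : E D2 c).
Hypotheses (w1n : (wt X (idx1 X) <= n)%N) (w2n : (wt X (idx2 X) <= n)%N).
Hypotheses (ve1 : v D1 c e1 = ga D1) (ve2 : v D2 c e2 = ga D2).
Hypothesis e12 :
  gact (c + x12 *+ n) ((xS X (idx1 X) * xS X (idx2 X)) ^+ n)
    (res D12 e1 - res D12 e2) =
  gact (c + x12 *+ n) (kS X q * mS X (socle_mnm X l n)) (u D12 a (al D12)).
Hypothesis q0 : q <> 0.

Lemma homogB d (s r : S X) : homogeneous d s -> homogeneous d r ->
  homogeneous d (s - r).
Proof. by move=> hs hr; apply: homogD hs (homogN hr). Qed.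

Lemma mulq_eq0 (r : k) : q * r = 0 -> r = 0.
Proof. by move=> /eqP; rewrite mulf_eq0 => /orP[/eqP//|/eqP]. Qed.

Lemma cover_exists : exists (P : qcoh X) (p : qhom P E),
  is_dsum (@cover_summand k t X Lb l) P /\ projective_cover p.
Proof.
pose cs := @cover_summand k t X Lb l.
pose phi o : forall f, cs o f (cover_deg o) := sval (cid (cover_frame o)).
have hphi o : frame (phi o) by rewrite /phi; case: cid.
have cphi o : compat (phi o) by case: (hphi o).
(* On Lb(omega) the cover is u; on the summand of j it is a lift to E of multiplication by x_j^(1 +
   l_j) into C. *)
have [po poE] : exists po : forall o, qhom (cs o) E, forall o,
    match o return qhom (cs o) E -> Prop with
    | Some j => fun p => forall f, v f _ (p f _ (phi (Some j) f)) =
        gact (cover_deg (Some j)) (xS X (val j) ^+ (1 + l (val j))) (ga f)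
    | None => fun p => forall f b (m : A f b), p f b m = u f b m
    end (po o).
  have ex o : exists p : qhom (cs o) E,
      match o return qhom (cs o) E -> Prop with
      | Some j => fun p => forall f, v f _ (p f _ (phi (Some j) f)) =
          gact (cover_deg (Some j)) (xS X (val j) ^+ (1 + l (val j))) (ga f)
      | None => fun p => forall f b (m : A f b), p f b m = u f b m
      end p.
    case: o => [j|]; last by exists u.
    have hj : homogeneous (xL X (val j) *+ (1 + l (val j)))
      (xS X (val j) ^+ (1 + l (val j))) by hdeg.
    have [w [cw vw]] := lift_section ll uv_exact hal hga acE w1n w2n ve1 ve2 e12 hj
      (socle_kill ll (val j) w1n w2n).
    have [p pE] := frame_hom (hphi (Some j)) cw.
    by exists p => f; rewrite pE vw.
  by exists (fun o => sval (cid (ex o))) => o; case: cid.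
have [p pE] := dsum_elim po.
exists (dsum cs), p; split; first exact: dsumP.
split.
- apply: line_bundle_sumP (dsumP cs) => o; apply/line_bundleP.
  by exists (cover_deg o); apply: cover_frame.
- move=> F w /line_bundleP[d [ph hph]]; have [cph _ _] := hph.
  have cw : compat (fun f => w f d (ph f)).
    by move=> f g gf; rewrite -hfun_res // cph.
  have [h [hh vwE]] := frame_hom_sections hga v cw.
  (* The composite of w with v is multiplication by h. Its part in the ideal lifts through the
     summands indexed by I; subtracting these lifts leaves sections [z] of E that lie over r x^b. *)
  have [r [b [g [hg hE rb]]]] := homog_mod_nonmax hh.
  have hgj j : homogeneous (d - cover_deg (Some j)) (g j).
    by have := hg j; rewrite /cover_deg => hgj; hdeg.
  pose lj j f := gact d (g j) (po (Some j) f _ (phi (Some j) f)).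
  pose z f := w f d (ph f) - \sum_j lj j f.
  have vz f : v f d (z f) = gact d (kS X r * mS X b) (ga f).
    rewrite /z gfunB vwE gfun_sum.
    rewrite (eq_bigr (fun j =>
      gact d (xS X (val j) ^+ (1 + l (val j)) * g j) (ga f))); last first.
      move=> j _; rewrite gfun_act // (poE (Some j)) gactA //; first by rewrite mulrC.
      by rewrite /=; hdeg.
    have hs j : homogeneous (d - c) (xS X (val j) ^+ (1 + l (val j)) * g j).
      by have := hg j => hgj'; hdeg.
    have hS : homogeneous (d - c) (\sum_j xS X (val j) ^+ (1 + l (val j)) * g j).
      exact: homog_sum.
    rewrite hE gactDl //; last by have := homogB hh hS; rewrite {1}hE addrK.
    by rewrite gact_suml // addrK.
  have cz : compat z.
    move=> f g' gf; rewrite /z resB // cw // res_sum //; congr (_ - _).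
    apply: eq_bigr => j _; rewrite /lj res_act // -hfun_res // cphi //.
  (* The sections [z] lift r x^b, so q r = 0; hence v kills [z], which therefore comes from A. *)
  have r0 : r = 0.
    case: rb => // -[bl db]; apply: mulq_eq0.
    apply: (lift_section_only_if ll uv_exact hal acE w1n w2n ve1 ve2 e12
      (d := d - c) (w := z)) => //.
    by zmod.
  have [be [cbe beE]] : exists m : forall f, A f d,
      compat m /\ forall f, u f d (m f) = z f.
    apply: (exact_factor_sections uv_exact cz) => f.
    by rewrite vz r0 kS0 mul0r gact0l.
  pose y f : dsum cs f d := fun o => match o return cs o f d with
    | Some j => gact d (g j) (phi (Some j) f)
    | None => be f
    end.
  have cy : compat y.
    move=> f g' gf; apply: dprod_ext => -[j|]; last exact: cbe.
    by rewrite /y -(cphi (Some j) _ _ gf); apply: (res_act _ gf (hgj j)).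
  have [w' w'E] := frame_hom hph cy; exists w'.
  have [w2 w2E] := qcomp_key p w'; move=> f b0 m; rewrite w2E.
  apply: (frame_hom_eq hph) => f'; rewrite -w2E w'E pE big_option_sum /=.
  rewrite (poE None) beE /z -[RHS](subrK (\sum_j lj j f')); congr (_ + _).
  by apply: eq_bigr => j _; apply: gfun_act; apply: hgj.
- move=> U pU; have [cc ccE] := dsum_endo_scalar cover_frame U cover_orthogonal.
  (* The endomorphism U acts by a scalar on each summand, and p U = p fixes the image of that
     summand in E. As no summand maps to zero, all the scalars are 1. *)
  have fixp o (m : cs o D1 (cover_deg o)) :
      gact (cover_deg o) (kS X (cc o)) (po o D1 _ m) = po o D1 _ m.
    have h0 : homogeneous (cover_deg o - cover_deg o) (kS X (cc o)) by hdeg.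
    have inE o' m' : p D1 (cover_deg o') (dsum_in cs o' D1 _ m') = po o' D1 _ m'.
      rewrite pE (bigD1 o') //= dsum_in_eq big1 ?addr0 // => i io.
      by rewrite dsum_in_neq // gfun0.
    rewrite -[RHS]inE -pU -gfun_act // -inE; congr (p _ _ _).
    apply: dprod_ext => i; rewrite ccE; case: (eqVneq i o) => [->|io].
      by rewrite !dsum_in_eq.
    by rewrite !dsum_in_neq // gact0r //; hdeg.
  have cc1 o : cc o = 1.
    case: o => [j|].
      apply: (scalar_fix_one (fixp (Some j) (phi (Some j) D1))).
      move=> /(congr1 (v D1 _)); rewrite (poE (Some j)) gfun0.
      move/(frame_inj_D1 hga) => h; apply: (@xS_nonmax_neq0 j); apply: h.
      by rewrite /=; hdeg.
    apply: (scalar_fix_one (fixp None (al D1))).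
    rewrite (poE None) => /(exact_inj uv_exact) e0.
    have h1 : homogeneous (a - a) (1 : S X) by hdeg.
    have := frame_inj_D1 hal h1; rewrite gact1 e0 => /(_ erefl)/eqP.
    by rewrite oner_eq0.
  exists (qid _); split=> f b m /=.
    by apply: dprod_ext => o; rewrite ccE cc1 kS1 gact1.
  by apply: dprod_ext => o; rewrite ccE cc1 kS1 gact1.
Qed.

Lemma hull_exists : exists (I : qcoh X) (p : qhom E I),
  is_dsum (@hull_summand k t X Lb l) I /\ injective_hull p.
Proof.
pose hs := @hull_summand k t X Lb l.
pose phi o : forall f, hs o f (hull_deg o) := sval (cid (hull_frame o)).
have hphi o : frame (phi o) by rewrite /phi; case: cid.
have cphi o : compat (phi o) by case: (hphi o).
have [po poE] : exists po : forall o, qhom E (hs o), forall o,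
    match o return qhom E (hs o) -> Prop with
    | Some j => fun p => forall f, p f _ (u f a (al f)) =
        gact a (xS X (val j) ^+ (1 + l (val j))) (phi (Some j) f)
    | None => fun p => forall f b (m : E f b), p f b m = v f b m
    end (po o).
  have ex o : exists p : qhom E (hs o),
      match o return qhom E (hs o) -> Prop with
      | Some j => fun p => forall f, p f _ (u f a (al f)) =
          gact a (xS X (val j) ^+ (1 + l (val j))) (phi (Some j) f)
      | None => fun p => forall f b (m : E f b), p f b m = v f b m
      end p.
    case: o => [j|]; last by exists v.
    have hj : homogeneous (xL X (val j) *+ (1 + l (val j)))
      (xS X (val j) ^+ (1 + l (val j))) by hdeg.
    have aj : a = hull_deg (Some j) + xL X (val j) *+ (1 + l (val j)).
      by rewrite /=; zmod.
    exact: (extend_hom ll uv_exact hal hga acE w1n w2n ve1 ve2 e12 (hphi (Some j))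
      aj hj (socle_kill ll (val j) w1n w2n)).
  by exists (fun o => sval (cid (ex o))) => o; case: cid.
have [p pE] := dsum_intro po.
exists (dsum hs), p; split; first exact: dsumP.
split.
- apply: line_bundle_sumP (dsumP hs) => o; apply/line_bundleP.
  by exists (hull_deg o); apply: hull_frame.
- move=> F w /line_bundleP[d [ph hph]]; have [cph _ _] := hph.
  have cual : compat (fun f => u f a (al f)).
    by case: hal => cal _ _ f g gf; rewrite -hfun_res // cal.
  have [h [hh wuE]] := frame_hom_sections hph w cual.
  have [r [b [g [hg hE rb]]]] := homog_mod_nonmax hh.
  have hgj j : homogeneous (hull_deg (Some j) - d) (g j).
    by have := hg j; rewrite /hull_deg => hgj; hdeg.
  have ex j : exists rho : qhom (hs (Some j)) F,
      forall f, rho f _ (phi (Some j) f) = gact (hull_deg (Some j)) (g j) (ph f).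
    apply: frame_hom (hphi (Some j)) _ => f g' gf.
    by rewrite res_act // cph.
  pose rho j := sval (cid (ex j)).
  have rhoE j f : rho j f _ (phi (Some j) f) = gact (hull_deg (Some j)) (g j) (ph f).
    by rewrite /rho; case: cid.
  (* Dually to the cover: removing the part that factors through the summands indexed by I leaves a
     map whose restriction to A is r x^b. As it is defined on E, r = 0, and the map factors through
     v. *)
  have [w' w'E] := qhom_lincomb w (fun j => po (Some j)) rho.
  have w'u f : w' f a (u f a (al f)) = gact a (kS X r * mS X b) (ph f).
    rewrite w'E wuE.
    rewrite (eq_bigr (fun j =>
      gact a (xS X (val j) ^+ (1 + l (val j)) * g j) (ph f))); last first.
      move=> j _; rewrite (poE (Some j)) gfun_act; last by rewrite /=; hdeg.
      by rewrite rhoE gactA //; rewrite /=; hdeg.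
    have hs' j : homogeneous (a - d) (xS X (val j) ^+ (1 + l (val j)) * g j).
      by have := hg j => hgj'; hdeg.
    have hS : homogeneous (a - d) (\sum_j xS X (val j) ^+ (1 + l (val j)) * g j).
      exact: homog_sum.
    rewrite hE gactDl //; last by have := homogB hh hS; rewrite {1}hE addrK.
    by rewrite gact_suml // addrK.
  have r0 : r = 0.
    case: rb => // -[bl db]; apply: mulq_eq0.
    have hb : homogeneous (a - d) (kS X r * mS X b).
      by rewrite -db; hdeg.
    apply: (extend_hom_only_if ll acE w1n w2n e12 hph _ hb bl db erefl w'u).
    by zmod.
  have w'u0 f b' (m : A f b') : w' f b' (u f b' m) = 0.
    have [_ gen _] := hal; have [N [s [hs' es]]] := gen f b' m.
    apply: (@act_pow_eq0 _ _ _ F f N b' _ _ erefl).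
    rewrite -!gfun_act; [|hdeg|hdeg]; rewrite es !gfun_act // w'u r0 kS0 mul0r.
    by rewrite gact0l gact0r.
  have [tau tauE] := exact_factor uv_exact w'u0.
  have [V VE] := @dsum_elim _ _ _ _ hs F (fun o => match o return qhom (hs o) F with
    | Some j => rho j | None => tau end).
  exists V => f b' m; rewrite VE big_option_sum /= !pE (poE None) tauE w'E.
  rewrite -[RHS](subrK (\sum_j rho j f b' (po (Some j) f b' m))); congr (_ + _).
  by apply: eq_bigr => j _; rewrite pE.
- move=> U pU; have [cc ccE] := dsum_endo_scalar hull_frame U hull_orthogonal.
  have fixp o f b (m : E f b) : gact b (kS X (cc o)) (po o f b m) = po o f b m.
    by rewrite -!pE -ccE pU.
  have cc1 o : cc o = 1.
    case: o => [j|].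
      apply: (scalar_fix_one (fixp (Some j) D1 a (u D1 a (al D1)))).
      rewrite (poE (Some j)) => /(frame_inj_D1 (hphi (Some j))) h.
      by apply: (@xS_nonmax_neq0 j); apply: h; rewrite /=; hdeg.
    apply: (scalar_fix_one (fixp None D1 c e1)); rewrite (poE None) ve1 => e0.
    have h1 : homogeneous (c - c) (1 : S X) by hdeg.
    have := frame_inj_D1 hga h1; rewrite gact1 e0 => /(_ erefl)/eqP.
    by rewrite oner_eq0.
  exists (qid _); split=> f b m /=.
    by apply: dprod_ext => o; rewrite ccE cc1 kS1 gact1.
  by apply: dprod_ext => o; rewrite ccE cc1 kS1 gact1.
Qed.
End Cocycle.
End CoverHull.

Theorem theorem3 (k : closedFieldType) (t : nat) (X : wpl k t)
    (E Lb : qcoh X) (l : 'I_t -> nat) :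
  vector_bundle E -> indecomposable E -> line_bundle Lb ->
  (forall i, (l i <= wt X i - 1)%N) ->
  leL 0 (xsum X l) -> leL (xsum X l) (deltaL X) ->
  (exists (u : qhom (shift Lb (omegaL X)) E) (v : qhom E (shift Lb (xsum X l))),
      short_exact u v) ->
  [/\ exists (P : qcoh X) (p : qhom P E),
        is_dsum (@cover_summand k t X Lb l) P /\ projective_cover p,
      exists (I : qcoh X) (q : qhom E I),
        is_dsum (@hull_summand k t X Lb l) I /\ injective_hull q,
      hom_orthogonal (@cover_summand k t X Lb l)
    & hom_orthogonal (@hull_summand k t X Lb l)].
Proof.
move=> _ [_ indE] /line_bundleP[d hLb] ll _ /(sum_max_le ll) max_le [u [v uv_exact]].
(* The summand [None] is Lb(omega) in the cover and Lb(x) in the hull, the outer terms of the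
   sequence. *)
have [al hal] := @cover_frame _ _ _ l _ _ hLb None.
have [ga hga] := @hull_frame _ _ _ l _ _ hLb None.
have acE : d - xsum X l = (d - omegaL X) + (omegaL X - xsum X l) by zmod.
have [n [q [e1 [e2 [[w1n w2n] ve1 ve2 e12]]]]] :=
  local_splitting ll uv_exact hal hga acE.
have q0 : q <> 0.
  move=> q0; have split := cocycle_split uv_exact hga ve1 ve2 e12 q0.
  have [|[] /=] := indE _ _ split.
  - by case; [exact: (vector_bundle_of_frame (@cover_frame _ _ _ l _ _ hLb None))
             |exact: (vector_bundle_of_frame (@hull_frame _ _ _ l _ _ hLb None))].
  - exact: frame_not_zero hal.
  - exact: frame_not_zero hga.
split.
- exact: (cover_exists ll max_le hLb uv_exact hal hga w1n w2n ve1 ve2 e12 q0).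
- exact: (hull_exists ll max_le hLb uv_exact hal hga w1n w2n ve1 ve2 e12 q0).
- exact: (cover_orthogonal ll max_le hLb).
- exact: (hull_orthogonal ll max_le hLb).
Qed.
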